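(* (Free Construction.) Let $\mathcal{H}$ be an autonomous signature, $\mathsf{S}$ an autonomous multicategory, and $i$ a map of autonomous signatures from $\mathcal{H}$ to the underlying signature of $\mathsf{S}$. Then there exists a unique autonomous functor $i^\ast:\mathcal{F}_{aut}(\mathcal{H})\to\mathsf{S}$ such that $i^\ast(a)=i(a)$ for every type $a$ and $i^\ast([f(x_1,\dots,x_n)])=i(f)$ for every multiarrow $f$ of $\mathcal{H}$.
   Context: Notation: $S_n$ symmetric group; for a list $\gamma=c_1,\dots,c_n$ and $\sigma\in S_n$, $\gamma\cdot\sigma=c_{\sigma(1)},\dots,c_{\sigma(n)}$; an $(n_1,\dots,n_k)$-shuffle is a bijection $\sum_i[n_i]\cong[\sum n_i]$ monotone on each $[n_i]$; $\mathsf{shu}(\gamma_1,\dots,\gamma_k)$ is the set of $(|\gamma_1|,\dots,|\gamma_k|)$-shuffles acting on the concatenation. An autonomous signature consists of a set $\mathcal{A}$ of atoms and a multigraph $\mathcal{H}$ whose nodes (types) are generated by $a ::= o\in\mathcal{A}\mid(a_1\otimes\cdots\otimes a_k)\mid(a_1\otimes\cdots\otimes a_k)\multimap a$ ($k\in\mathbb{N}$), with sets $\mathcal{H}(a_1,\dots,a_n;b)$ of multiarrows. An autonomous multicategory is a symmetric multicategory (actions $-\cdot\sigma$ permuting sources, satisfying the usual axioms) that is representable (chosen objects $(a_1\otimes\cdots\otimes a_k)$ and morphisms $\mathsf{re}:a_1,\dots,a_k\to(a_1\otimes\cdots\otimes a_k)$ inducing bijections $\mathsf{S}(\gamma,(a_1\otimes\cdots\otimes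 a_k),\delta;a)\cong\mathsf{S}(\gamma,a_1,\dots,a_k,\delta;a)$ by precomposition) and closed (chosen objects $(a_1\otimes\cdots\otimes a_k)\multimap a$ and evaluation morphisms $ev$ inducing bijections $\mathsf{S}(\gamma;(a_1\otimes\cdots\otimes a_k)\multimap a)\cong\mathsf{S}(\gamma,a_1,\dots,a_k;a)$); an autonomous functor preserves all this structure on the nose. A map of autonomous signatures $i$ assigns objects $i(a)$ commuting with $\otimes$ and $\multimap$ and morphisms $i(f)\in\mathsf{S}(i(a_1),\dots,i(a_n);i(b))$. Autonomous terms: $s,t ::= x \mid \lambda\langle x_1^{a_1},\dots,x_k^{a_k}\rangle s \mid s\,t \mid \langle s_1,\dots,s_k\rangle \mid s[x_1^{a_1},\dots,x_k^{a_k}:=t] \mid f(s_1,\dots,s_n)$; variables under $\lambda$ and bound by $[\vec{x}:=t]$ (in $s$) are bound; up to renaming. Typing (contexts: disjoint lists of distinct variables): $x:a\vdash x:a$; if $\gamma_i\vdash s_i:a_i$, $\sigma\in\mathsf{shu}(\gamma_1,\dots,\gamma_k)$ then $(\gamma_1,\dots,\gamma_k)\cdot\sigma\vdash\langle s_1,\dots,s_k\rangle:(a_1\otimes\cdots\otimes a_k)$; if $\gamma,x_1:a_1,\dots,x_k:a_k\vdash s:b$ then $\gamma\vdash\lambda\langle\vec{x}\rangle s:(a_1\otimes\cdots\otimes a_k)\multimap b$; if $\gamma\vdash s:\vec{a}\multimap b$, $\delta\vdash t:\vec{a}$ (with $\vec a$ a tensor type) and $\sigma\in\mathsf{shu}(\gamma,\delta)$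 then $(\gamma,\delta)\cdot\sigma\vdash s\,t:b$; if $\gamma\vdash s:(a_1\otimes\cdots\otimes a_k)$, $\delta_1,x_1:a_1,\dots,x_k:a_k,\delta_2\vdash t:b$, $\sigma\in\mathsf{shu}(\gamma,\delta_1,\delta_2)$ then $(\gamma,\delta_1,\delta_2)\cdot\sigma\vdash t[\vec{x}:=s]:b$; if $f\in\mathcal{H}(a_1,\dots,a_n;b)$, $\gamma_i\vdash s_i:a_i$, $\sigma\in\mathsf{shu}(\gamma_1,\dots,\gamma_n)$ then $(\gamma_1,\dots,\gamma_n)\cdot\sigma\vdash f(s_1,\dots,s_n):b$. Contexts with hole: $\mathtt{C} ::= [\cdot]\mid\langle s_1,\dots,\mathtt{C},\dots,s_n\rangle\mid\mathtt{C}[\vec{x}:=t]\mid s[\vec{x}:=\mathtt{C}]\mid\mathtt{C}\,s\mid s\,\mathtt{C}\mid\lambda\langle\vec{x}\rangle\mathtt{C}\mid f(s_1,\dots,\mathtt{C},\dots,s_n)$; $\mathtt{E}$ same except $s[\vec{x}:=\mathtt{E}]$ requires $\mathtt{E}\neq[\cdot]$; $\mathtt{D}$ same as $\mathtt{C}$ except $\mathtt{D}\,t$ requires $\mathtt{D}\neq[\cdot]$; $\mathtt{L} ::= [\cdot]\mid\mathtt{L}[\vec{x}:=t]$. $\mathsf{LT}$ = terms $\mathtt{L}[\langle s_1,\dots,s_k\rangle]$, $\mathsf{AT}$ = terms $\mathtt{L}[\lambda\langle\vec{x}\rangle t]$. Reductions (with capture-avoiding substitution $s\{\vec t/\vec x\}$):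 $\beta_1$: $s[x_1,\dots,x_k:=\mathtt{L}[\langle t_1,\dots,t_k\rangle]]\to\mathtt{L}[s\{t_1/x_1,\dots,t_k/x_k\}]$; $\beta_2$: $\mathtt{L}[\lambda\langle x_1,\dots,x_k\rangle s]\,\langle t_1,\dots,t_k\rangle\to\mathtt{L}[s\{t_1/x_1,\dots,t_k/x_k\}]$; both closed under $\mathtt{C}$-contexts. $\eta_1$: $s\to\langle x_1,\dots,x_k\rangle[x_1^{a_1},\dots,x_k^{a_k}:=s]$ if $s$ has type $(a_1\otimes\cdots\otimes a_k)$, $x_i$ fresh, $s\notin\mathsf{LT}$, closed under $\mathtt{E}$-contexts; $\eta_2$: $s\to\lambda\langle x_1^{a_1},\dots,x_k^{a_k}\rangle(s\,\langle x_1,\dots,x_k\rangle)$ if $s$ has type $(a_1\otimes\cdots\otimes a_k)\multimap a$, $x_i$ fresh, $s\notin\mathsf{AT}$, closed under $\mathtt{D}$-contexts. $\to_{\mathsf{aut}}$ is the union of these four. Structural equivalence $\equiv$: smallest congruence containing $\mathtt{C}[s[\vec{x}:=t]]\equiv\mathtt{C}[s][\vec{x}:=t]$ when $\mathtt{C}$ binds no free variable of $t$ and $\vec{x}$ not free in $\mathtt{C}$. $\mathcal{F}_{aut}(\mathcal{H})$: objects are types, morphisms $a_1,\dots,a_n\to a$ are terms $s$ with $x_1:a_1,\dots,x_n:a_n\vdash s:a$ modulo the equivalence generated by $\equiv$ and $\to_{\mathsf{aut}}$, composition by substitution, identities $[x]$; it is autonomous with symmetric action reindexing contexts, $\mathsf{re}=[\langle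 x_1,\dots,x_k\rangle]$ and $ev=[y\,\langle x_1,\dots,x_k\rangle]$. *)

(* Defs.v *)
From Stdlib Require Import Permutation Relations.
From mathcomp Require Import all_boot.
From mathcomp Require Import boolp.

Set Implicit Arguments.
Unset Strict Implicit.
Unset Printing Implicit Defensive.

(** * Permutations and shuffles

    A permutation sigma in S_n is represented by its one-line notation, the list
    [:: sigma 0; ...; sigma n.-1] (0-based). *)

Definition is_perm (n : nat) (p : seq nat) : bool := perm_eq p (iota 0 n).

(* c . sigma = c_{sigma(1)}, ..., c_{sigma(n)} *)
Definition permute T (c : seq T) (p : seq nat) : seq T := pmap (onth c) p.

(* sigma o tau, so that (c . sigma) . tau = c . (sigma o tau) *)
Definition perm_comp (p q : seq nat) : seq nat := [seq nth 0 p i | i <- q].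

(* sigma_1 (+) ... (+) sigma_k, each sigma_i acting inside the i-th block *)
Definition perm_sum (ps : seq (seq nat)) : seq nat :=
  foldr (fun p q => p ++ [seq size p + i | i <- q]) [::] ps.

(* sigma acting on consecutive blocks of sizes ns, moved as wholes *)
Definition perm_block (ns : seq nat) (p : seq nat) : seq nat :=
  flatten (permute (reshape ns (iota 0 (sumn ns))) p).

(* In c . sigma the entry c_i lands at position sigma^-1(i), which is
   [index i p].  The bijection sum_i [n_i] -> [sum_i n_i] that is required to be
   monotone on each summand is the one sending an entry to its position in the
   result, so that shuffling interleaves the lists and preserves the order
   inside each of them. *)
Definition shuffle (ns : seq nat) (p : seq nat) : Prop :=
  is_perm (sumn ns) p /\
  forall i j, i < j < sumn ns -> reshape_index ns i = reshape_index ns j ->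
    index i p < index j p.

Definition shu T (cs : seq (seq T)) (d : seq T) : Prop :=
  exists2 p, shuffle (shape cs) p & d = permute (flatten cs) p.

(** * Autonomous multicategories *)

Inductive hlist (A B : Type) (R : A -> B -> Type) : seq A -> seq B -> Type :=
| hnil : hlist R [::] [::]
| hcons a b u v : R a b -> hlist R u v -> hlist R (a :: u) (b :: v).
Arguments hnil {A B R}.

Fixpoint hcat A B (R : A -> B -> Type) u v u' v'
    (h : hlist R u v) (h' : hlist R u' v') : hlist R (u ++ u') (v ++ v') :=
  match h in hlist _ u v return hlist R (u ++ u') (v ++ v') with
  | hnil => h'
  | hcons _ _ _ _ f h => hcons f (hcat h h')
  end.

Fixpoint hflatten A B (R : A -> B -> Type) us vs
    (h : hlist (hlist R) us vs) : hlist R (flatten us) (flatten vs) :=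
  match h in hlist _ us vs return hlist R (flatten us) (flatten vs) with
  | hnil => hnil
  | hcons _ _ _ _ f h => hcat f (hflatten h)
  end.

Fixpoint hmap A B A' B' (R : A -> B -> Type) (R' : A' -> B' -> Type)
    (g : A -> A') (k : B -> B') (m : forall a b, R a b -> R' (g a) (k b)) u v
    (h : hlist R u v) : hlist R' (map g u) (map k v) :=
  match h in hlist _ u v return hlist R' (map g u) (map k v) with
  | hnil => hnil
  | hcons _ _ _ _ f h => hcons (m _ _ f) (hmap m h)
  end.

Fixpoint harrows A B (R : A -> B -> Type) u v (h : hlist R u v) :
    seq {a : A & {b : B & R a b}} :=
  match h with
  | hnil => [::]
  | hcons a b _ _ f h => existT _ a (existT _ b f) :: harrows h
  end.

Record autonomous_data := AutonomousData {
  ob : Type;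
  hom : seq ob -> ob -> Type;
  idm : forall a, hom [:: a] a;
  comp : forall us v b, hom v b -> hlist hom us v -> hom (flatten us) b;
  act : forall u a p, is_perm (size u) p -> hom u a -> hom (permute u p) a;
  tens : seq ob -> ob;
  limp : seq ob -> ob -> ob;               (* (a_1 (x) ... (x) a_k) -o a *)
  re : forall u, hom u (tens u);
  ev : forall u a, hom (limp u a :: u) a
}.
Arguments hom : clear implicits.
Arguments idm : clear implicits.
Arguments tens : clear implicits.
Arguments limp : clear implicits.
Arguments re : clear implicits.
Arguments ev : clear implicits.

Notation homs S := (hlist (hom S)).

Definition cast (S : autonomous_data) u v a b (eu : u = v) (ea : a = b)
    (f : hom S u a) : hom S v b :=
  eq_rect a (hom S v) (eq_rect u (fun w => hom S w a) f v eu) b ea.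

Definition singles T (u : seq T) : seq (seq T) := [seq [:: a] | a <- u].

Fixpoint ids (S : autonomous_data) (u : seq (ob S)) : homs S (singles u) u :=
  match u return homs S (singles u) u with
  | [::] => hnil
  | a :: u => hcons (idm S a) (ids u)
  end.

(* (f_1, ..., f_n), (hs_1, ..., hs_n) |-> (f_1 o hs_1, ..., f_n o hs_n) *)
Fixpoint comps (S : autonomous_data) us v (fs : homs S us v) :
    forall uss, hlist (homs S) uss us -> homs S (map flatten uss) v :=
  match fs in hlist _ us v
    return forall uss, hlist (homs S) uss us -> homs S (map flatten uss) v with
  | hnil => fun uss hs =>
    match hs in hlist _ uss us return
      match us with
      | [::] => homs S (map flatten uss) [::]
      | _ => unit
      end with
    | hnil => hnil
    | hcons _ _ _ _ _ _ => tt
    end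
  | hcons _ b _ v f fs => fun uss hs =>
    match hs in hlist _ uss us return
      match us with
      | [::] => unit
      | u :: us => hom S u b ->
          (forall uss, hlist (homs S) uss us -> homs S (map flatten uss) v) ->
          homs S (map flatten uss) (b :: v)
      end with
    | hnil => tt
    | hcons _ _ _ _ h hs => fun f rec => hcons (comp f h) (rec _ hs)
    end f (comps fs)
  end.

Inductive homs_act (S : autonomous_data) : forall us us' v,
    seq (seq nat) -> homs S us v -> homs S us' v -> Prop :=
| homs_act_nil : homs_act [::] hnil hnil
| homs_act_cons u a us us' v p ps (hp : is_perm (size u) p) (f : hom S u a)
    (fs : homs S us v) (fs' : homs S us' v) :
    homs_act ps fs fs' ->
    homs_act (p :: ps) (hcons f fs) (hcons (act hp f) fs').

(* The equations between sources and targets by which arrows are cast below are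
   all provable; quantifying over them avoids naming the proofs. *)
Record is_autonomous (S : autonomous_data) : Prop := IsAutonomous {
  comp_id_l : forall u a (f : hom S u a) e,
    cast e erefl (comp (idm S a) (hcons f hnil)) = f;
  comp_id_r : forall u a (f : hom S u a) e,
    cast e erefl (comp f (ids u)) = f;
  comp_assoc : forall uss us v a (f : hom S v a) (gs : homs S us v)
      (hs : hlist (homs S) uss us) e,
    cast e erefl (comp (comp f gs) (hflatten hs)) = comp f (comps gs hs);
  act_id : forall u a (f : hom S u a) (p := iota 0 (size u))
      (hp : is_perm (size u) p) e,
    cast e erefl (act hp f) = f;
  act_comp : forall u a (f : hom S u a) p q (hp : is_perm (size u) p)
      (hq : is_perm (size (permute u p)) q)
      (hr : is_perm (size u) (perm_comp p q)) e,
    cast e erefl (act hq (act hp f)) = act hr f;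
  (* f o (g_1 . p_1, ..., g_k . p_k) = (f o (g_1, ..., g_k)) . (p_1 (+) ... (+) p_k) *)
  comp_act_r : forall us us' v a (f : hom S v a) ps (gs : homs S us v)
      (gs' : homs S us' v) (hps : is_perm (size (flatten us)) (perm_sum ps)) e,
    homs_act ps gs gs' ->
    cast e erefl (comp f gs') = act hps (comp f gs);
  (* (f . p) o (g_{p(1)}, ..., g_{p(k)}) = (f o (g_1, ..., g_k)) . p_block *)
  comp_act_l : forall us us' v a (f : hom S v a) p (hp : is_perm (size v) p)
      (gs : homs S us v) (gs' : homs S us' (permute v p))
      (hb : is_perm (size (flatten us)) (perm_block (shape us) p)) e,
    harrows gs' = permute (harrows gs) p ->
    cast e erefl (comp (act hp f) gs') = act hb (comp f gs);
  representable : forall u v w a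
      (e : flatten (singles u ++ v :: singles w) = u ++ v ++ w),
    bijective (fun f : hom S (u ++ tens S v :: w) a =>
      cast e erefl (comp f (hcat (ids u) (hcons (re S v) (ids w)))));
  closed : forall u v a (e : u ++ flatten (singles v) = u ++ v),
    bijective (fun f : hom S u (limp S v a) =>
      cast e erefl (comp (ev S v a) (hcons f (ids v))))
}.

Record autonomous_multicategory := AutonomousMulticategory {
  amc_data :> autonomous_data;
  amc_axioms : is_autonomous amc_data
}.

Record autonomous_functor (S T : autonomous_data) := AutonomousFunctor {
  fob :> ob S -> ob T;
  fhom : forall u a, hom S u a -> hom T (map fob u) (fob a);
  f_idm : forall a, fhom (idm S a) = idm T (fob a);
  f_comp : forall us v a (f : hom S v a) (gs : homs S us v) e,
    cast e erefl (fhom (comp f gs)) = comp (fhom f) (hmap fhom gs);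
  f_act : forall u a (f : hom S u a) p (hp : is_perm (size u) p)
      (hp' : is_perm (size (map fob u)) p) e,
    cast e erefl (fhom (act hp f)) = act hp' (fhom f);
  f_tens : forall u, fob (tens S u) = tens T (map fob u);
  f_limp : forall u a, fob (limp S u a) = limp T (map fob u) (fob a);
  f_re : forall u e, cast erefl e (fhom (re S u)) = re T (map fob u);
  f_ev : forall u a e, cast e erefl (fhom (ev S u a)) = ev T (map fob u) (fob a)
}.

(** * Autonomous signatures *)

Inductive ty (A : Type) : Type :=
| Atom of A
| Tens of seq (ty A)
| Limp of seq (ty A) & ty A.           (* (a_1 (x) ... (x) a_k) -o a *)

Record autonomous_signature := AutonomousSignature {
  atom : Type;
  arr : seq (ty atom) -> ty atom -> Type
}.

Arguments arr : clear implicits.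

Notation type H := (ty (atom H)).

Record signature_map (H : autonomous_signature) (S : autonomous_data) :=
  SignatureMap {
  iob :> type H -> ob S;
  i_tens : forall u, iob (Tens u) = tens S (map iob u);
  i_limp : forall u a, iob (Limp u a) = limp S (map iob u) (iob a);
  iarr : forall u b, arr H u b -> hom S (map iob u) (iob b)
}.

(** * Autonomous terms

    Terms up to renaming of bound variables are de Bruijn terms: variables are
    natural numbers, and under a binder of x_1, ..., x_k the numbers 0, ..., k-1
    are x_1, ..., x_k while k + n is the variable n of the outside. *)

Inductive tm (H : autonomous_signature) : Type :=
| Var of nat
| Lam of seq (type H) & tm H              (* \ <x_1^a_1, ..., x_k^a_k> s *)
| App of tm H & tm H
| Tup of seq (tm H)
| Let of seq (type H) & tm H & tm H       (* Let [a_1; ..; a_k] s t is s[x^a := t] *)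
| Op u b of arr H u b & seq (tm H).
Arguments Var {H}.
Arguments Op {H u b}.

Definition upren (k : nat) (r : nat -> nat) (n : nat) : nat :=
  if n < k then n else k + r (n - k).

Fixpoint ren H (r : nat -> nat) (s : tm H) : tm H :=
  match s with
  | Var n => Var (r n)
  | Lam u s => Lam u (ren (upren (size u) r) s)
  | App s t => App (ren r s) (ren r t)
  | Tup ss => Tup (map (ren r) ss)
  | Let u s t => Let u (ren (upren (size u) r) s) (ren r t)
  | Op _ _ f ss => Op f (map (ren r) ss)
  end.

Definition up H (k : nat) (r : nat -> tm H) (n : nat) : tm H :=
  if n < k then Var n else ren (addn k) (r (n - k)).

Fixpoint subst H (r : nat -> tm H) (s : tm H) : tm H :=
  match s with
  | Var n => r n
  | Lam u s => Lam u (subst (up (size u) r) s)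
  | App s t => App (subst r s) (subst r t)
  | Tup ss => Tup (map (subst r) ss)
  | Let u s t => Let u (subst (up (size u) r) s) (subst r t)
  | Op _ _ f ss => Op f (map (subst r) ss)
  end.

Definition vars H (i k : nat) : seq (tm H) := [seq Var n | n <- iota i k].

(** ** Typing *)

Notation context H := (seq (nat * type H)).

Definition lift H (k : nat) (c : context H) : context H :=
  [seq (k + x.1, x.2) | x <- c].

(* x_1 : a_1, ..., x_k : a_k *)
Definition ctx_of H (u : seq (type H)) : context H := zip (iota 0 (size u)) u.

Inductive typed H : context H -> tm H -> type H -> Prop :=
| T_var x a : typed [:: (x, a)] (Var x) a
| T_tup cs ss u d :
    uniq (unzip1 (flatten cs)) -> typeds cs ss u -> shu cs d ->
    typed d (Tup ss) (Tens u)
| T_lam c u s b :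
    typed (lift (size u) c ++ ctx_of u) s b -> typed c (Lam u s) (Limp u b)
| T_app c d s t u b e :
    uniq (unzip1 (c ++ d)) -> typed c s (Limp u b) -> typed d t (Tens u) ->
    shu [:: c; d] e -> typed e (App s t) b
| T_let c d1 d2 s t u b e :
    uniq (unzip1 (c ++ d1 ++ d2)) -> typed c s (Tens u) ->
    typed (lift (size u) d1 ++ ctx_of u ++ lift (size u) d2) t b ->
    shu [:: c; d1; d2] e -> typed e (Let u t s) b
| T_op u b (f : arr H u b) cs ss d :
    uniq (unzip1 (flatten cs)) -> typeds cs ss u -> shu cs d ->
    typed d (Op f ss) b
with typeds H : seq (context H) -> seq (tm H) -> seq (type H) -> Prop :=
| Ts_nil : typeds [::] [::] [::]
| Ts_cons c s a cs ss u :
    typed c s a -> typeds cs ss u -> typeds (c :: cs) (s :: ss) (a :: u).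

Definition has_type H (s : tm H) (a : type H) : Prop := exists c, typed c s a.

(** ** Contexts with hole *)

Inductive ctx (H : autonomous_signature) : Type :=
| Hole
| CLam of seq (type H) & ctx H
| CAppL of ctx H & tm H
| CAppR of tm H & ctx H
| CTup of seq (tm H) & ctx H & seq (tm H)
| CLetL of seq (type H) & ctx H & tm H    (* C[x := t] *)
| CLetR of seq (type H) & tm H & ctx H    (* s[x := C] *)
| COp u b of arr H u b & seq (tm H) & ctx H & seq (tm H).
Arguments Hole {H}.
Arguments COp {H u b}.

(* Filling the hole lets C capture the variables of s; those bound by C are
   0, ..., depth C - 1 in s. *)
Fixpoint plug H (C : ctx H) (s : tm H) : tm H :=
  match C with
  | Hole => s
  | CLam u C => Lam u (plug C s)
  | CAppL C t => App (plug C s) t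
  | CAppR t C => App t (plug C s)
  | CTup l C r => Tup (l ++ plug C s :: r)
  | CLetL u C t => Let u (plug C s) t
  | CLetR u t C => Let u t (plug C s)
  | COp _ _ f l C r => Op f (l ++ plug C s :: r)
  end.

Fixpoint depth H (C : ctx H) : nat :=
  match C with
  | Hole => 0
  | CLam u C | CLetL u C _ => depth C + size u
  | CAppL C _ | CAppR _ C | CTup _ C _ | CLetR _ _ C | COp _ _ _ _ C _ => depth C
  end.

Fixpoint ren_ctx H (r : nat -> nat) (C : ctx H) : ctx H :=
  match C with
  | Hole => Hole
  | CLam u C => CLam u (ren_ctx (upren (size u) r) C)
  | CAppL C t => CAppL (ren_ctx r C) (ren r t)
  | CAppR t C => CAppR (ren r t) (ren_ctx r C)
  | CTup l C l' => CTup (map (ren r) l) (ren_ctx r C) (map (ren r) l')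
  | CLetL u C t => CLetL u (ren_ctx (upren (size u) r) C) (ren r t)
  | CLetR u t C => CLetR u (ren (upren (size u) r) t) (ren_ctx r C)
  | COp _ _ f l C l' => COp f (map (ren r) l) (ren_ctx r C) (map (ren r) l')
  end.

Definition is_hole H (C : ctx H) : bool := if C is Hole then true else false.

Fixpoint is_E H (C : ctx H) : bool :=
  match C with
  | Hole => true
  | CLetR _ _ C => ~~ is_hole C && is_E C
  | CLam _ C | CAppL C _ | CAppR _ C | CTup _ C _ | CLetL _ C _
  | COp _ _ _ _ C _ => is_E C
  end.

Fixpoint is_D H (C : ctx H) : bool :=
  match C with
  | Hole => true
  | CAppL C _ => ~~ is_hole C && is_D C
  | CLam _ C | CAppR _ C | CTup _ C _ | CLetL _ C _ | CLetR _ _ C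
  | COp _ _ _ _ C _ => is_D C
  end.

Fixpoint is_L H (C : ctx H) : bool :=
  match C with
  | Hole => true
  | CLetL _ C _ => is_L C
  | _ => false
  end.

Definition is_LT H (s : tm H) : Prop :=
  exists L ss, is_L L /\ s = plug L (Tup ss).

Definition is_AT H (s : tm H) : Prop :=
  exists L u t, is_L L /\ s = plug L (Lam u t).

(** ** Reduction and structural equivalence *)

(* s[x := L[<ts>]] -> L[s{ts/x}]: the free variables of s other than x are moved
   under the binders of L. *)
Definition inst_in H (d : nat) (ts : seq (tm H)) (n : nat) : tm H :=
  if n < size ts then nth (Var n) ts n else Var (d + (n - size ts)).

(* L[\<x> s] <ts> -> L[s{ts/x}]: the ts are moved under the binders of L. *)
Definition inst_out H (d : nat) (ts : seq (tm H)) (n : nat) : tm H :=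
  if n < size ts then ren (addn d) (nth (Var n) ts n) else Var (n - size ts).

Inductive beta1 H : tm H -> tm H -> Prop :=
| Beta1 L u s ts : is_L L -> size u = size ts ->
    beta1 (Let u s (plug L (Tup ts))) (plug L (subst (inst_in (depth L) ts) s)).

Inductive beta2 H : tm H -> tm H -> Prop :=
| Beta2 L u s ts : is_L L -> size u = size ts ->
    beta2 (App (plug L (Lam u s)) (Tup ts))
          (plug L (subst (inst_out (depth L) ts) s)).

(* [has_type] leaves open the typing context of s.  Reductions are used below
   only between terms typable in the same context with the same type, where the
   annotations introduced by the expansion force the type of s. *)
Inductive eta1 H : tm H -> tm H -> Prop :=
| Eta1 u s : has_type s (Tens u) -> ~ is_LT s ->
    eta1 s (Let u (Tup (vars H 0 (size u))) s).

Inductive eta2 H : tm H -> tm H -> Prop :=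
| Eta2 u a s : has_type s (Limp u a) -> ~ is_AT s ->
    eta2 s (Lam u (App (ren (addn (size u)) s) (Tup (vars H 0 (size u))))).

Inductive red_aut H : tm H -> tm H -> Prop :=
| Red_beta1 C s t : beta1 s t -> red_aut (plug C s) (plug C t)
| Red_beta2 C s t : beta2 s t -> red_aut (plug C s) (plug C t)
| Red_eta1 C s t : is_E C -> eta1 s t -> red_aut (plug C s) (plug C t)
| Red_eta2 C s t : is_D C -> eta2 s t -> red_aut (plug C s) (plug C t).

(* Exchanges a block of k variables with the block of d variables above it. *)
Definition swap (k d n : nat) : nat :=
  if n < k then d + n else if n < k + d then n - k else n.

(* C[s[x := t]] is equivalent to C[s][x := t]: on the left t is below the binders of C, none of
   which it uses; on the right C and s are below the binder x, which C does not
   use. *)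
Inductive struct_eq H : tm H -> tm H -> Prop :=
| SE_refl s : struct_eq s s
| SE_sym s t : struct_eq s t -> struct_eq t s
| SE_trans s t r : struct_eq s t -> struct_eq t r -> struct_eq s r
| SE_ctx C s t : struct_eq s t -> struct_eq (plug C s) (plug C t)
| SE_let C u s t :
    struct_eq (plug C (Let u s (ren (addn (depth C)) t)))
              (Let u (plug (ren_ctx (addn (size u)) C)
                           (ren (swap (size u) (depth C)) s)) t).

(** ** The morphisms of the free autonomous multicategory *)

Definition tm_step H (c : context H) (a : type H) (s t : tm H) : Prop :=
  [/\ typed c s a, typed c t a & struct_eq s t \/ red_aut s t].

Definition tm_eq H (c : context H) (a : type H) : relation (tm H) :=
  clos_refl_sym_trans _ (tm_step c a).

(* The morphisms a_1, ..., a_n -> a: the equivalence classes of the terms s with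
   x_1 : a_1, ..., x_n : a_n |- s : a. *)
Definition mor H (u : seq (type H)) (a : type H) : Type :=
  {P : tm H -> Prop | exists2 s, typed (ctx_of u) s a & P = tm_eq (ctx_of u) a s}.

Definition class H u a (s : tm H) (hs : typed (ctx_of u) s a) : mor u a :=
  exist _ (tm_eq (ctx_of u) a s) (ex_intro2 _ _ s hs erefl).

Definition repr H u a (m : mor u a) : tm H := s2val (cid2 (svalP m)).

Lemma repr_typed H u a (m : @mor H u a) : typed (ctx_of u) (repr m) a.
Proof. exact: (s2valP (cid2 (svalP m))). Qed.

Lemma reprK H u a (m : @mor H u a) : class (repr_typed m) = m.
Proof.
have eP : tm_eq (ctx_of u) a (repr m) = sval m := esym (s2valP' (cid2 (svalP m))).
case: m eP => P hP; set s := repr _ => eP.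
rewrite /class; move: (repr_typed _); rewrite -/s => hs.
move: (ex_intro2 _ _ _ _ _); rewrite eP => hP'; congr (exist _ _ _); exact: Prop_irrelevance.
Qed.

Lemma permute_map A B (f : A -> B) c p : permute (map f c) p = map f (permute c p).
Proof.
rewrite /permute; elim: p => //= i p IH; rewrite onth_map.
by case: (onth c i) => //= x; rewrite IH.
Qed.

Lemma size_permute T (c : seq T) p : is_perm (size c) p -> size (permute c p) = size c.
Proof.
move=> hp; rewrite size_pmap -[RHS](size_iota 0) -(perm_size hp).
apply/eqP; rewrite -all_count; apply/allP => i; rewrite (perm_mem hp) mem_iota /=.
by rewrite -onthTE.
Qed.

Lemma permute_Permutation T (c : seq T) p : is_perm (size c) p -> Permutation c (permute c p).
Proof.
have h : forall q r, perm_eq q r -> Permutation (permute c q) (permute c r).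
  elim=> [|i q IH] r hr; first by move/perm_size: hr => /esym/size0nil ->.
  have ir : i \in r by rewrite -(perm_mem hr) mem_head.
  case/splitPr: ir hr => r1 r2; rewrite -cat1s perm_sym -cat1s perm_catCA perm_cons perm_sym => hr.
  rewrite /permute /= pmap_cat /=; have := IH _ hr.
  rewrite /permute pmap_cat; case: (onth c i) => [x|] //= hP.
  exact: Permutation_cons_app.
move=> /h/Permutation_sym; congr (Permutation _ _).
rewrite /permute; elim: c {h p} => //= x c IH; congr (_ :: _).
rewrite -[RHS]IH -[1%N]addn0 iotaDl; elim: (iota 0 (size c)) => //= j s IHs; rewrite /= add0n IHs //.
Qed.

Lemma subseq_index (u v : seq nat) i j :
  subseq u v -> uniq v -> i < j < size u -> index (nth 0 u i) v < index (nth 0 u j) v.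
Proof.
elim: v u i j => [|y v IH] [|x u] i j; rewrite ?ltn0 ?andbF //.
move=> /= su /andP[yv uv] /andP[ij ju].
have nin k : k < size u -> subseq u v -> (y == nth 0 u k) = false.
  move=> ku suv; apply/negbTE; apply: contra yv => /eqP ->.
  by rewrite (mem_subseq suv) ?mem_nth.
case: (x =P y) su => [-> suv|nxy suv].
- case: i j ij ju => [|i] [|j] //= ij ju.
    by rewrite eqxx nin.
  rewrite !ltnS in ij ju; have iu : i < size u by exact: ltn_trans ju.
    by rewrite !nin // ltnS; apply: IH => //; rewrite ij.
- have sxu : subseq u v by apply: subseq_trans suv; exact: subseq_cons.
  have yx k : k <= size u -> (y == nth 0 (x :: u) k) = false.
    case: k => [|k] ku /=; last by rewrite nin.
    by apply/eqP => /esym.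
  have iu : i <= size u by rewrite -ltnS; exact: ltn_trans ju.
  by rewrite !yx // ltnS; apply: (IH (x :: u)) => //=; rewrite ij.
Qed.

Lemma shuI (T : Type) (cs : seq (seq (nat * T))) d :
  uniq (unzip1 (flatten cs)) -> Permutation (flatten cs) d ->
  all (fun c => subseq (unzip1 c) (unzip1 d)) cs -> shu cs d.
Proof.
set F := flatten cs => uF hP hs.
have inP (e e' : seq (nat * T)) : Permutation e e' -> perm_eq (unzip1 e) (unzip1 e').
  elim=> //= [x l l' _ h|x y l|l l' l'' _ h _ h']; rewrite ?perm_cons //.
    by rewrite -cat1s -[x.1 :: unzip1 l]cat1s perm_catCA.
  exact: perm_trans h h'.
have hv := inP _ _ hP.
have ud : uniq (unzip1 d) by rewrite -(perm_uniq hv).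
exists [seq index x (unzip1 F) | x <- unzip1 d].
  have szF : sumn (shape cs) = size F by rewrite size_flatten.
  split; rewrite szF.
    apply: (@perm_trans _ [seq index x (unzip1 F) | x <- unzip1 F]).
      by apply: perm_map; rewrite perm_sym.
    suff -> : [seq index x (unzip1 F) | x <- unzip1 F] = iota 0 (size F) by [].
    rewrite -(size_map fst F) -/(unzip1 F); apply: (@eq_from_nth _ 0); rewrite ?size_map ?size_iota // => i hi.
    by rewrite (nth_map 0) ?nth_iota ?size_map // index_uniq ?size_map.
  move=> i j /andP[ij js] eij.
  have is_ : i < size F by exact: ltn_trans js.
  have idx k : k < size F ->
      index k [seq index x (unzip1 F) | x <- unzip1 d] = index (nth 0 (unzip1 F) k) (unzip1 d).
    move=> ks.
    have kF : nth 0 (unzip1 F) k \in unzip1 F by rewrite mem_nth ?size_map.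
    have {1}-> : k = index (nth 0 (unzip1 F) k) (unzip1 F) by rewrite index_uniq ?size_map.
    have : nth 0 (unzip1 F) k \in unzip1 d by rewrite -(perm_mem hv).
    have: {subset unzip1 d <= unzip1 F} by move=> z; rewrite (perm_mem hv).
    elim: (unzip1 d) => //= z l IHl hsub.
    rewrite inE; case: (z =P nth 0 (unzip1 F) k) => [->|nz]; first by rewrite !eqxx.
    have -> : (nth 0 (unzip1 F) k == z) = false by apply/eqP => /esym.
    move=> /= kl; case: eqP => [e|_]; last by rewrite IHl // => w wl; apply: hsub; rewrite inE wl orbT.
    case: nz; rewrite -(nth_index 0 kF) -e nth_index //.
    by apply: hsub; rewrite mem_head.
  rewrite !idx //.
  have nthF k : k < size F -> nth 0 (unzip1 F) k =
      nth 0 (nth [::] (map unzip1 cs) (reshape_index (shape cs) k)) (reshape_offset (shape cs) k).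
    move=> ks; rewrite -(reshape_indexK (shape cs) k) /unzip1 map_flatten nth_flatten.
    have -> : shape (map (map fst) cs) = shape cs.
      by rewrite /shape -map_comp; apply: eq_map => c /=; rewrite size_map.
    by rewrite reshape_indexK.
  have off : reshape_offset (shape cs) i < reshape_offset (shape cs) j.
    move: ij; rewrite -{1}(reshape_indexK (shape cs) i) -{1}(reshape_indexK (shape cs) j) eij.
    by rewrite /flatten_index ltn_add2l.
  rewrite !nthF // eij.
  set r := reshape_index _ j.
  have rs : r < size cs by rewrite -(size_map size); apply: reshape_indexP; rewrite szF.
  have hr : subseq (nth [::] (map unzip1 cs) r) (unzip1 d).
    by rewrite (nth_map [::]) //; exact: (all_nthP [::] hs).
  apply: subseq_index => //; rewrite off /=.
  have := @reshape_offsetP (shape cs) j; rewrite szF => /(_ js).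
  by rewrite (nth_map [::]) // size_map -/r (nth_map [::]).
rewrite /permute.
have : List.incl d F by move=> x; apply: Permutation_in; exact: Permutation_sym.
elim: d {hP hs hv ud} => //= x d IH hd.
have -> : onth F (index x.1 (unzip1 F)) = Some x.
  have : List.In x F by apply: hd; left.
  elim: (F) uF => //= y l IHl /andP[yl ul] [->|xl]; first by rewrite eqxx.
  case: eqP => [e|_]; last exact: IHl.
  case/negP: yl; rewrite e; elim: (l) xl => //= z m IHm [->|]; rewrite inE ?eqxx // => /IHm ->.
  by rewrite orbT.
by rewrite /= -IH // => z zd; apply: hd; right.
Qed.

Scheme typed_mind := Induction for typed Sort Prop
with typeds_mind := Induction for typeds Sort Prop.
Combined Scheme typed_typeds_ind from typed_mind, typeds_mind.

Lemma unzip1_ctx_of H (u : seq (type H)) : unzip1 (ctx_of u) = iota 0 (size u).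
Proof. by rewrite unzip1_zip // size_iota. Qed.

Lemma uniq_ctx_of H (u : seq (type H)) : uniq (unzip1 (ctx_of u)).
Proof. by rewrite unzip1_ctx_of iota_uniq. Qed.

Lemma unzip1_lift H k (c : context H) : unzip1 (lift k c) = map (addn k) (unzip1 c).
Proof. by rewrite /unzip1 -!map_comp. Qed.

Definition ren_context H (r : nat -> nat) (c : context H) : context H :=
  [seq (r x.1, x.2) | x <- c].

Lemma unzip1_ren H r (c : context H) : unzip1 (ren_context r c) = map r (unzip1 c).
Proof. by rewrite /unzip1 -!map_comp. Qed.

Lemma ren_lift H r k (c : context H) :
  ren_context (upren k r) (lift k c) = lift k (ren_context r c).
Proof.
rewrite /ren_context /lift -!map_comp; apply: eq_map => x /=.
by rewrite /upren ltnNge leq_addr /= addKn.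
Qed.

Lemma ren_ctx_of H r (u : seq (type H)) :
  ren_context (upren (size u) r) (ctx_of u) = ctx_of u.
Proof.
rewrite /ctx_of; have: all (fun i => i < size u) (iota 0 (size u)).
  by apply/allP => i; rewrite mem_iota.
move: (iota 0 (size u)); move: (size u) => n s.
elim: u s => [|a u IH] [|i s]; rewrite //= => /andP[hi hs].
by rewrite /upren hi; congr (_ :: _); exact: IH.
Qed.

Lemma shu_map A B (f : A -> B) cs d : shu cs d -> shu (map (map f) cs) (map f d).
Proof.
case=> p hp ->; exists p; last by rewrite -map_flatten permute_map.
rewrite (_ : shape _ = shape cs) // /shape -map_comp; apply: eq_map => c /=.
by rewrite size_map.
Qed.

Lemma shu_Permutation T (cs : seq (seq T)) d : shu cs d -> Permutation (flatten cs) d.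
Proof.
by case=> p [hp _] ->; apply: permute_Permutation; rewrite size_flatten.
Qed.

Lemma Permutation_vars H (c d : context H) :
  Permutation c d -> perm_eq (unzip1 c) (unzip1 d).
Proof.
elim=> //= [x l l' _ h|x y l|l l' l'' _ h _ h']; rewrite ?perm_cons //.
  by rewrite -cat1s -[x.1 :: unzip1 l]cat1s perm_catCA.
exact: perm_trans h h'.
Qed.

Lemma flatten_unzip1 A B (cs : seq (seq (A * B))) :
  unzip1 (flatten cs) = flatten (map unzip1 cs).
Proof. by rewrite /unzip1 map_flatten. Qed.

Lemma sub_uniq_inj (r : nat -> nat) (s : seq nat) :
  {in s &, injective r} -> uniq s -> uniq (map r s).
Proof. by move=> h; rewrite map_inj_in_uniq. Qed.

Lemma ren_typed_mut H :
  (forall c (s : tm H) a, typed c s a -> forall r,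
     {in unzip1 c &, injective r} -> typed (ren_context r c) (ren r s) a) /\
  (forall cs (ss : seq (tm H)) u, typeds cs ss u -> forall r,
     {in unzip1 (flatten cs) &, injective r} ->
     typeds (map (ren_context r) cs) (map (ren r) ss) u).
Proof.
have sh (cs : seq (context H)) d r : uniq (unzip1 (flatten cs)) -> shu cs d ->
    {in unzip1 d &, injective r} ->
    [/\ {in unzip1 (flatten cs) &, injective r},
        uniq (unzip1 (flatten (map (ren_context r) cs))) &
        shu (map (ren_context r) cs) (ren_context r d)].
  move=> hu hs hr; have hp := Permutation_vars (shu_Permutation hs).
  have hr' : {in unzip1 (flatten cs) &, injective r}.
    by move=> x y; rewrite !(perm_mem hp); exact: hr.
  split=> //; last exact: shu_map.
  by rewrite -map_flatten -/(ren_context r _) unzip1_ren; exact: sub_uniq_inj.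
have upinj k (r : nat -> nat) (v v' : seq nat) :
    {in v &, injective r} -> {in v', forall i, i < k} ->
    {in [predU map (addn k) v & v'] &, injective (upren k r)}.
  move=> hr hv x y /orP hx /orP hy; rewrite /upren.
  have cls z : z \in map (addn k) v \/ z \in v' -> z < k \/ exists2 w, w \in v & z = k + w.
    by case=> [/mapP[w wv ->]|/hv]; [right; exists w|left].
  have ge z : (k + z < k) = false by rewrite ltnNge leq_addr.
  case: (cls _ hx) => [xk|[x' x'v ->]]; case: (cls _ hy) => [yk|[y' y'v ->]].
  - by rewrite xk yk.
  - by rewrite xk ge addKn => e; move: xk; rewrite e ge.
  - by rewrite yk ge addKn => e; move: yk; rewrite -e ge.
  by rewrite !ge !addKn => /addnI /hr ->.
apply: typed_typeds_ind => /=.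
- by move=> x a r _; exact: T_var.
- move=> cs ss u d hu _ IH hs r hr; have [h1 h2 h3] := sh _ _ _ hu hs hr.
  by apply: T_tup h2 _ h3; exact: IH.
- move=> c u s b _ IH r hr; apply: T_lam.
  rewrite -ren_lift -(ren_ctx_of r u) -map_cat; apply: IH.
  rewrite /unzip1 map_cat -/(unzip1 _) -/(unzip1 _) unzip1_lift unzip1_ctx_of => x y.
  rewrite !mem_cat; apply: upinj => // i; by rewrite mem_iota.
- move=> c d s t u b e hu _ IHs _ IHt hs r hr.
  have hu' : uniq (unzip1 (flatten [:: c; d])) by rewrite /= cats0.
  have [h1 h2 h3] := sh _ _ _ hu' hs hr; move: h1 h2 => /=; rewrite !cats0 => h1 h2.
  apply: T_app h2 _ _ h3; [apply: IHs|apply: IHt] => x y hx hy;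
    by apply: h1; rewrite /unzip1 map_cat mem_cat ?hx ?hy ?orbT.
- move=> c d1 d2 s t u b e hu _ IHs _ IHt hs r hr.
  have hu' : uniq (unzip1 (flatten [:: c; d1; d2])) by rewrite /= cats0.
  have [h1 h2 h3] := sh _ _ _ hu' hs hr; move: h1 h2 => /=; rewrite !cats0 => h1 h2.
  apply: T_let h2 _ _ h3.
    by apply: IHs => x y hx hy; apply: h1; rewrite /unzip1 map_cat mem_cat ?hx ?hy.
  rewrite -!ren_lift -(ren_ctx_of r u) -!map_cat; apply: IHt.
  rewrite /unzip1 !map_cat -!/(unzip1 _) !unzip1_lift unzip1_ctx_of => x y hx hy.
  apply: (@upinj (size u) r (unzip1 (d1 ++ d2)) (iota 0 (size u))).
  + by move=> x' y' hx' hy'; apply: h1; rewrite /unzip1 map_cat mem_cat ?hx' ?hy' orbT.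
  + by move=> i; rewrite mem_iota.
  + by move: hx; rewrite !inE /unzip1 !map_cat !mem_cat; do 3!case: (x \in _).
  + by move: hy; rewrite !inE /unzip1 !map_cat !mem_cat; do 3!case: (y \in _).
- move=> u b f cs ss d hu _ IH hs r hr; have [h1 h2 h3] := sh _ _ _ hu hs hr.
  by apply: T_op h2 _ h3; exact: IH.
- by move=> r _; exact: Ts_nil.
- move=> c s a cs ss u _ IHc _ IHs r; rewrite /unzip1 map_cat => hr.
  apply: Ts_cons; [apply: IHc|apply: IHs] => x y hx hy;
    by apply: hr; rewrite mem_cat ?hx ?hy ?orbT.
Qed.

Lemma ren_typed H c (s : tm H) a r :
  typed c s a -> {in unzip1 c &, injective r} -> typed (ren_context r c) (ren r s) a.
Proof. by move=> hs; exact: (ren_typed_mut H).1 hs r. Qed.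

Lemma flatten_Permutation T (cs cs' : seq (seq T)) :
  List.Forall2 (@Permutation _) cs cs' -> Permutation (flatten cs) (flatten cs').
Proof. by elim=> [|c c' l l' h _ IH] /=; [exact: perm_nil|exact: Permutation_app]. Qed.


Lemma Permutation_filter T (P : pred T) (c d : seq T) :
  Permutation c d -> Permutation (filter P c) (filter P d).
Proof.
elim=> //= [x l l' _ h|x y l|l l' l'' _ h _ h'].
- by case: (P x) => //; exact: perm_skip.
- by case: (P x); case: (P y) => //; exact: perm_swap.
- exact: Permutation_trans h h'.
Qed.

Lemma filter_block H (c1 c c2 : context H) :
  uniq (unzip1 (c1 ++ c ++ c2)) ->
  [seq x <- c1 ++ c ++ c2 | x.1 \in unzip1 c] = c.
Proof.
rewrite /unzip1 !map_cat -!/(unzip1 _) !cat_uniq !has_cat negb_or.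
case/and5P=> _ /andP[h1 _] _ h2 _; rewrite !filter_cat.
have nil (e : context H) : ~~ has [in unzip1 c] (unzip1 e) ->
    [seq x <- e | x.1 \in unzip1 c] = [::].
  by elim: e => //= x e IH; rewrite negb_or => /andP[/negbTE ->].
have -> : [seq x <- c | x.1 \in unzip1 c] = c.
  apply/all_filterP; suff h (e : context H) :
    {subset unzip1 e <= unzip1 c} -> all (fun x => x.1 \in unzip1 c) e by exact: h.
  elim: e => //= x e IH hs; rewrite hs ?mem_head ?IH // => z ze.
  by apply: hs; rewrite inE ze orbT.
rewrite (nil c2) // nil ?cats0 // has_sym.
by [].
Qed.

Lemma exchange_blocks H (cs : seq (context H)) d :
  uniq (unzip1 (flatten cs)) -> Permutation (flatten cs) d ->
  exists2 cs', List.Forall2 (@Permutation _) cs cs' &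
    uniq (unzip1 (flatten cs')) /\ shu cs' d.
Proof.
move=> hu hp; pose cs' := [seq [seq x <- d | x.1 \in unzip1 c] | c <- cs].
have hF : List.Forall2 (@Permutation _) cs cs'.
  rewrite {}/cs'; have : uniq (unzip1 ([::] ++ flatten cs)) by [].
  have : Permutation ([::] ++ flatten cs) d by [].
  move: [::]; elim: cs {hu hp} => [|c cs IH] c1 //= hp hu.
  constructor; last by apply: (IH (c1 ++ c)); rewrite -catA.
  by rewrite -{1}(filter_block hu); exact: Permutation_filter.
have hp' : Permutation (flatten cs) (flatten cs').
  by elim: hF => [|c c' l l' h _ IH] /=; [exact: perm_nil|exact: Permutation_app].
have hu' : uniq (unzip1 (flatten cs')) by rewrite -(perm_uniq (Permutation_vars hp')).
exists cs' => //; split=> //; apply: shuI => //.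
  exact: Permutation_trans (Permutation_sym hp') hp.
rewrite /cs' all_map; apply/allT => c /=.
by rewrite /unzip1 -(filter_map fst [in map fst c]) filter_subseq.
Qed.

Lemma exchange_mut H :
  (forall c (s : tm H) a, typed c s a -> forall d, Permutation c d -> typed d s a) /\
  (forall cs (ss : seq (tm H)) u, typeds cs ss u -> forall ds,
     List.Forall2 (@Permutation _) cs ds -> typeds ds ss u).
Proof.
apply: typed_typeds_ind => /=.
- move=> x a d hd; rewrite (Permutation_length_1_inv hd); exact: T_var.
- move=> cs ss u d hu _ IH /shu_Permutation hs d' hd.
  have [cs' hF [hu' hs']] := exchange_blocks hu (Permutation_trans hs hd).
  exact: T_tup hu' (IH _ hF) hs'.
- by move=> c u s b _ IH d hd; apply: T_lam; apply: IH;
    apply: Permutation_app => //; exact: Permutation_map.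
- move=> c d s t u b e hu _ IHs _ IHt /shu_Permutation hs d' hd.
  have hu0 : uniq (unzip1 (flatten [:: c; d])) by rewrite /= cats0.
  have [cs' hF] := exchange_blocks hu0 (Permutation_trans hs hd).
  inversion hF as [|? c' ? l1 hc hF1]; subst cs'.
  inversion hF1 as [|? d0 ? l2 hd0 hF2]; subst l1.
  inversion hF2; subst l2 => -[]; rewrite /= cats0 => hu' hs'.
  exact: T_app hu' (IHs _ hc) (IHt _ hd0) hs'.
- move=> c d1 d2 s t u b e hu _ IHs _ IHt /shu_Permutation hs d' hd.
  have hu0 : uniq (unzip1 (flatten [:: c; d1; d2])) by rewrite /= cats0.
  have [cs' hF] := exchange_blocks hu0 (Permutation_trans hs hd).
  inversion hF as [|? c' ? l1 hc hF1]; subst cs'.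
  inversion hF1 as [|? d1' ? l2 hd1 hF2]; subst l1.
  inversion hF2 as [|? d2' ? l3 hd2 hF3]; subst l2.
  inversion hF3; subst l3 => -[]; rewrite /= cats0 => hu' hs'.
  apply: T_let hu' (IHs _ hc) _ hs'; apply: IHt.
  apply: Permutation_app; first exact: Permutation_map.
  by apply: Permutation_app => //; exact: Permutation_map.
- move=> u b f cs ss d hu _ IH /shu_Permutation hs d' hd.
  have [cs' hF [hu' hs']] := exchange_blocks hu (Permutation_trans hs hd).
  exact: T_op hu' (IH _ hF) hs'.
- by move=> ds hF; inversion hF; exact: Ts_nil.
- move=> c s a cs ss u _ IH _ IHs ds hF.
  inversion hF as [|? c' ? l1 hc hF1]; subst ds.
  exact: Ts_cons (IH _ hc) (IHs _ hF1).
Qed.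

Lemma exchange H c d (s : tm H) a : typed c s a -> Permutation c d -> typed d s a.
Proof. by move=> hs; exact: (exchange_mut H).1 hs d. Qed.

Lemma shu_flatten H (cs : seq (context H)) :
  uniq (unzip1 (flatten cs)) -> shu cs (flatten cs).
Proof.
move=> hu; apply: shuI => //; elim: cs {hu} => //= c cs IH.
rewrite /unzip1 map_cat prefix_subseq /=; apply: sub_all IH => d hd.
by apply: subseq_trans hd _; exact: suffix_subseq.
Qed.

Lemma Permutation_flatten H (cs ds : seq (context H)) :
  Permutation cs ds -> Permutation (flatten cs) (flatten ds).
Proof.
elim=> //= [x l l' _ h|x y l|l l' l'' _ h _ h'].
- exact: Permutation_app_head.
- by rewrite !catA; apply: Permutation_app_tail; exact: Permutation_app_comm.
- exact: Permutation_trans h h'.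
Qed.

Definition subst_ok H (r : nat -> tm H) (x : nat * type H) (c : context H) : Prop :=
  typed c (r x.1) x.2.

Lemma flatten_singles T (u : seq T) : flatten (singles u) = u.
Proof. by elim: u => //= a u ->. Qed.

Lemma lift_ok H (r : nat -> tm H) k c gs :
  List.Forall2 (subst_ok r) c gs ->
  List.Forall2 (subst_ok (up k r)) (lift k c) (map (lift k) gs).
Proof.
elim=> [|x g c' gs' h _ IH] /=; constructor=> //.
rewrite /subst_ok /up /= ltnNge leq_addr /= addKn.
by apply: (ren_typed h) => i j _ _; exact: addnI.
Qed.

Lemma ctx_of_ok H (r : nat -> tm H) (u : seq (type H)) :
  List.Forall2 (subst_ok (up (size u) r)) (ctx_of u) (singles (ctx_of u)).
Proof.
have: all (fun x => x.1 < size u) (ctx_of u).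
  rewrite -(all_map fst (fun i => i < size u)) -/(unzip1 _) unzip1_ctx_of.
  by apply/allP => i; rewrite mem_iota.
elim: (ctx_of u) => [|[i a] c IH] /=; first by constructor.
case/andP=> hi hc; constructor; last exact: IH.
by rewrite /subst_ok /up /= hi; exact: T_var.
Qed.

Lemma flatten_lift H k (gs : seq (context H)) :
  flatten (map (lift k) gs) = lift k (flatten gs).
Proof. by rewrite /lift -map_flatten. Qed.

Lemma uniq_lift H k (c : context H) (u : seq (type H)) :
  k = size u -> uniq (unzip1 c) -> uniq (unzip1 (lift k c ++ ctx_of u)).
Proof.
move=> -> hu; rewrite /unzip1 map_cat -!/(unzip1 _) cat_uniq.
rewrite unzip1_lift unzip1_ctx_of iota_uniq map_inj_uniq ?hu; last exact: addnI.
rewrite andbT /=; apply/hasPn => i; rewrite mem_iota add0n /= => hi.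
by apply/mapP => -[j _ e]; move: hi; rewrite e ltnNge leq_addr.
Qed.

Lemma subst_typed_mut H :
  (forall c (s : tm H) a, typed c s a -> forall r gs,
     List.Forall2 (subst_ok r) c gs -> uniq (unzip1 (flatten gs)) ->
     typed (flatten gs) (subst r s) a) /\
  (forall cs (ss : seq (tm H)) u, typeds cs ss u -> forall r gs,
     List.Forall2 (subst_ok r) (flatten cs) gs -> uniq (unzip1 (flatten gs)) ->
     exists2 ds, flatten ds = flatten gs & typeds ds (map (subst r) ss) u).
Proof.
have sh (cs : seq (context H)) d r gs : shu cs d -> List.Forall2 (subst_ok r) d gs ->
    uniq (unzip1 (flatten gs)) ->
    exists gs', [/\ List.Forall2 (subst_ok r) (flatten cs) gs',
      Permutation (flatten gs') (flatten gs) & uniq (unzip1 (flatten gs'))].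
  move=> /shu_Permutation/Permutation_sym hs hF hu.
  have [gs' [hp hF']] := Permutation_Forall2 hs hF; exists gs'.
  have hp' := Permutation_flatten hp.
  split=> //; first exact: Permutation_sym.
  by rewrite -(perm_uniq (Permutation_vars hp')).
apply: typed_typeds_ind => /=.
- move=> x a r gs hF _; inversion hF as [|? c ? l h hl]; subst gs.
  by inversion hl; rewrite /= cats0.
- move=> cs ss u d _ _ IH hs r gs hF hu.
  have [gs' [hF' hp hu']] := sh _ _ _ _ hs hF hu.
  have [ds e hds] := IH _ _ hF' hu'; apply: exchange hp; rewrite -e in hu' *.
  exact: T_tup hu' hds (shu_flatten hu').
- move=> c u s b _ IH r gs hF hu; apply: T_lam.
  rewrite -flatten_lift -(flatten_singles (ctx_of u)) -flatten_cat; apply: IH.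
    by apply: List.Forall2_app; [exact: lift_ok|exact: ctx_of_ok].
  by rewrite flatten_cat flatten_lift flatten_singles; exact: uniq_lift.
- move=> c d s t u b e hu0 _ IHs _ IHt hs r gs hF hu.
  have [gs' [hF' hp hu']] := sh _ _ _ _ hs hF hu; apply: exchange hp.
  move: hF' => /=; rewrite cats0 => /List.Forall2_app_inv_l[g1 [g2 [h1 [h2 e']]]].
  subst gs'; move: hu'; change (g1 ++ g2)%list with (g1 ++ g2); rewrite flatten_cat => hu'.
  have hu3 : uniq (unzip1 (flatten [:: flatten g1; flatten g2])) by rewrite /= cats0.
  have := shu_flatten hu3; rewrite /= cats0 => hs'.
  apply: (T_app hu' _ _ hs'); [apply: IHs|apply: IHt] => //;
    by move: hu'; rewrite /unzip1 map_cat cat_uniq => /and3P[].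
- move=> c d1 d2 s t u b e hu0 _ IHs _ IHt hs r gs hF hu.
  have [gs' [hF' hp hu']] := sh _ _ _ _ hs hF hu; apply: exchange hp.
  move: hF' => /=; rewrite cats0 => /List.Forall2_app_inv_l[g1 [g0 [h1 [h0 e0]]]].
  case/List.Forall2_app_inv_l: h0 => g2 [g3 [h2 [h3 e']]].
  subst g0 gs'; move: hu'.
  change (g1 ++ (g2 ++ g3))%list with (g1 ++ (g2 ++ g3)); rewrite !flatten_cat => hu'.
  have hu3 : uniq (unzip1 (flatten [:: flatten g1; flatten g2; flatten g3])).
    by rewrite /= cats0.
  have := shu_flatten hu3; rewrite /= cats0 => hs'.
  move: (hu'); rewrite {1}/unzip1 map_cat cat_uniq => /and3P[hu1 _ hu23].
  apply: T_let hu' _ _ hs'; first exact: IHs.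
  have -> : lift (size u) (flatten g2) ++ ctx_of u ++ lift (size u) (flatten g3) =
      flatten (map (lift (size u)) g2 ++ singles (ctx_of u) ++ map (lift (size u)) g3).
    by rewrite !flatten_cat !flatten_lift flatten_singles.
  apply: IHt.
    apply: List.Forall2_app; first exact: lift_ok.
    by apply: List.Forall2_app; [exact: ctx_of_ok|exact: lift_ok].
  rewrite !flatten_cat !flatten_lift flatten_singles.
  have hp : Permutation (lift (size u) (flatten g2 ++ flatten g3) ++ ctx_of u)
      (lift (size u) (flatten g2) ++ ctx_of u ++ lift (size u) (flatten g3)).
    rewrite /lift map_cat -catA; apply: Permutation_app_head; exact: Permutation_app_comm.
  rewrite -(perm_uniq (Permutation_vars hp)); exact: uniq_lift.
- move=> u b f cs ss d _ _ IH hs r gs hF hu.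
  have [gs' [hF' hp hu']] := sh _ _ _ _ hs hF hu.
  have [ds e hds] := IH _ _ hF' hu'; apply: exchange hp; rewrite -e in hu' *.
  exact: T_op hu' hds (shu_flatten hu').
- by move=> r gs hF _; inversion hF; exists [::] => //; exact: Ts_nil.
- move=> c s a cs ss u _ IH _ IHs r gs /List.Forall2_app_inv_l[g1 [g2 [h1 [h2 ->]]]].
  change (g1 ++ g2)%list with (g1 ++ g2); rewrite flatten_cat => hu.
  move: (hu); rewrite {1}/unzip1 map_cat cat_uniq => /and3P[hu1 _ hu2].
  have [ds e hds] := IHs _ _ h2 hu2; exists (flatten g1 :: ds); first by rewrite /= e.
  by apply: Ts_cons => //; exact: IH.
Qed.

Lemma subst_typed H c (s : tm H) a r gs :
  typed c s a -> List.Forall2 (subst_ok r) c gs -> uniq (unzip1 (flatten gs)) ->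
  typed (flatten gs) (subst r s) a.
Proof. by move=> hs; exact: (subst_typed_mut H).1 hs r gs. Qed.

(** ** The free autonomous multicategory *)

Lemma typed_idm H (a : type H) : typed (ctx_of [:: a]) (Var 0) a.
Proof. exact: T_var. Qed.

Lemma typeds_vars H k (u : seq (type H)) :
  typeds (singles (zip (iota k (size u)) u)) (vars H k (size u)) u.
Proof.
elim: u k => [|a u IH] k /=; first exact: Ts_nil.
by apply: Ts_cons; [exact: T_var|exact: IH].
Qed.

Lemma typed_re H (u : seq (type H)) :
  typed (ctx_of u) (Tup (vars H 0 (size u))) (Tens u).
Proof.
have hu : uniq (unzip1 (flatten (singles (ctx_of u)))).
  by rewrite flatten_singles uniq_ctx_of.
rewrite -{1}(flatten_singles (ctx_of u)).
exact: T_tup hu (typeds_vars 0 u) (shu_flatten hu).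
Qed.

Lemma typed_gen H (u : seq (type H)) b (f : arr H u b) :
  typed (ctx_of u) (Op f (vars H 0 (size u))) b.
Proof.
have hu : uniq (unzip1 (flatten (singles (ctx_of u)))).
  by rewrite flatten_singles uniq_ctx_of.
rewrite -{1}(flatten_singles (ctx_of u)).
exact: T_op hu (typeds_vars 0 u) (shu_flatten hu).
Qed.

Lemma typed_ev H (u : seq (type H)) a :
  typed (ctx_of (Limp u a :: u)) (App (Var 0) (Tup (vars H 1 (size u)))) a.
Proof.
pose c : context H := [:: (0, Limp u a)]; pose d := zip (iota 1 (size u)) u.
have hu : uniq (unzip1 (c ++ d)) by exact: (uniq_ctx_of (Limp u a :: u)).
have hu' : uniq (unzip1 (flatten [:: c; d])) by rewrite /= cats0.
have := shu_flatten hu'; rewrite /= cats0 => hs.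
apply: (T_app hu _ _ hs); first exact: T_var.
have hd : uniq (unzip1 (flatten (singles d))).
  by rewrite flatten_singles; case/andP: hu.
rewrite -{1}(flatten_singles d).
exact: T_tup hd (typeds_vars 1 u) (shu_flatten hd).
Qed.

(* Representatives of f_1, ..., f_n, using consecutive blocks of variables from k
   on, so that f_1, ..., f_n have disjoint contexts. *)
Fixpoint reprs H (k : nat) us v (fs : hlist (@mor H) us v) : seq (tm H) :=
  match fs with
  | hnil => [::]
  | hcons u _ _ _ f fs => ren (addn k) (repr f) :: reprs (k + size u) fs
  end.

Definition comp_tm H us v b (g : @mor H v b) (fs : hlist (@mor H) us v) : tm H :=
  subst (fun n => nth (Var n) (reprs 0 fs) n) (repr g).

Fixpoint blocks H (k : nat) (us : seq (seq (type H))) : seq (context H) :=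
  if us is u :: us then lift k (ctx_of u) :: blocks (k + size u) us else [::].

Lemma lift_ctx_of H k (u : seq (type H)) : lift k (ctx_of u) = zip (iota k (size u)) u.
Proof.
rewrite /ctx_of -{2}[k]addn0 iotaDl; move: (iota 0 (size u)) => s.
elim: s u => [|i s IH] [|a u] //=; congr (_ :: _); exact: IH.
Qed.

Lemma flatten_blocks H k (us : seq (seq (type H))) :
  flatten (blocks k us) = lift k (ctx_of (flatten us)).
Proof.
elim: us k => //= u us IH k; rewrite IH !lift_ctx_of size_cat iotaD.
by rewrite zip_cat ?size_iota.
Qed.

Lemma reprs_ok H us v (fs : hlist (@mor H) us v) k i r :
  (forall j, j < size v -> r (i + j) = nth (Var (i + j)) (reprs k fs) j) ->
  List.Forall2 (subst_ok r) (zip (iota i (size v)) v) (blocks k us).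
Proof.
elim: fs k i => [|u a us' v' f fs IH] k i hr /=; first by constructor.
constructor.
  rewrite /subst_ok /=; have := hr 0 isT; rewrite addn0 /= => ->.
  by apply: (ren_typed (repr_typed f)) => x y _ _; exact: addnI.
by apply: IH => j hj; rewrite addSnnS hr.
Qed.

Lemma typed_comp H us v b (g : @mor H v b) (fs : hlist (@mor H) us v) :
  typed (ctx_of (flatten us)) (comp_tm g fs) b.
Proof.
have e : flatten (blocks 0 us) = ctx_of (flatten us).
  by rewrite flatten_blocks lift_ctx_of.
rewrite -e; apply: (subst_typed (repr_typed g)); last by rewrite e uniq_ctx_of.
exact: reprs_ok.
Qed.

(* In u . p the variable x_i of u is at position p^-1(i) *)
Definition act_tm H (u : seq (type H)) a (p : seq nat) (g : mor u a) : tm H :=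
  ren (index^~ p) (repr g).

Lemma onth_ctx_of H (u : seq (type H)) i :
  onth (ctx_of u) i = omap (pair i) (onth u i).
Proof.
have h m : onth (zip (iota m (size u)) u) i = omap (pair (m + i)) (onth u i).
  elim: u i m => [|b w IH] [|i] m //=; first by rewrite addn0.
  by rewrite IH addSnnS.
exact: h.
Qed.

Lemma typed_act H (u : seq (type H)) a p (g : mor u a) :
  is_perm (size u) p -> typed (ctx_of (permute u p)) (act_tm p g) a.
Proof.
move=> hp.
have hin i : i < size u -> i \in p by rewrite (perm_mem hp) mem_iota.
have hr : {in unzip1 (ctx_of u) &, injective (index^~ p)}.
  rewrite unzip1_ctx_of => i j; rewrite !mem_iota !add0n /= => hi hj e.
  by rewrite -(nth_index 0 (hin i hi)) e nth_index ?hin.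
apply: exchange (ren_typed (repr_typed g) hr) _.
suff -> : ctx_of (permute u p) = permute (ren_context (index^~ p) (ctx_of u)) p.
  apply: permute_Permutation; rewrite size_map.
  by rewrite size_zip size_iota minnn.
rewrite {1}/ctx_of size_permute // /permute.
have -> : size u = size p by rewrite (perm_size hp) size_iota.
have hx q k : all (fun i => i < size u) q ->
    (forall j, j < size q -> index (nth 0 q j) p = k + j) ->
    zip (iota k (size q)) (pmap (onth u) q) =
    pmap (onth (ren_context (index^~ p) (ctx_of u))) q.
  elim: q k => //= i q IH k /andP[hi hq] hk.
  have : onth (ren_context (index^~ p) (ctx_of u)) i =
      omap (fun a => (k, a)) (onth u i).
    have := hk 0 isT; rewrite addn0 /= => <-.
    by rewrite onth_map onth_ctx_of; case: (onth u i).
  move=> ->; rewrite -onthTE in hi; case: (onth u i) hi => //= b _.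
  by rewrite (IH k.+1) // => j hj; rewrite addSnnS; exact: (hk j.+1).
apply: hx; first by apply/allP => i; rewrite (perm_mem hp) mem_iota.
by move=> j hj; rewrite add0n index_uniq // (perm_uniq hp) iota_uniq.
Qed.

(* Composition and symmetric action are computed on chosen representatives; as
   substitution and renaming are compatible with tm_eq, the resulting class does
   not depend on the choice.  Only the data are given here: the notion of
   autonomous functor does not involve the axioms. *)
Definition F_aut (H : autonomous_signature) : autonomous_data := {|
  ob := type H;
  hom := @mor H;
  idm a := class (typed_idm a);
  comp us v b g fs := class (typed_comp g fs);
  act u a p hp g := class (typed_act g hp);
  tens := @Tens _;
  limp := @Limp _;
  re u := class (typed_re u);
  ev u a := class (typed_ev u a)
|}.

Definition gen_mor H (u : seq (type H)) b (f : arr H u b) : hom (F_aut H) u b :=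
  class (typed_gen f).

(* Main.v *)
From Stdlib Require Import Permutation Relations.
From HB Require Import structures.
From mathcomp Require Import all_boot boolp.
Require Import Defs.

Set Implicit Arguments.
Unset Strict Implicit.
Unset Printing Implicit Defensive.

(** Existence is an interpretation of terms. [sem] sends a well-typed linear term to an arrow of
    [S]: variables become identities, tuples and multiarrows are composed with [re] and [iarr],
    [Let] uses the inverse of precomposition with [re], [Lam] the inverse of composition with [ev],
    and [App] the application arrow that representability extracts from [ev]. It is defined on raw
    terms, with the sources in the order in which the free variables occur, so that no choice of a
    typing derivation or of its shuffles enters; other orders of the sources are reached by the
    symmetric action.

    The main computation is [sem_subst]: substitution is interpreted by composition. Given this,
    beta says that the two inverses are inverses ([le_let_tup], [le_app_lam]), and eta that
    solutions of the two universal problems are unique ([le_eta1], [le_eta2]). For the structural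
    equivalence the bound term is generalised to a variable of tensor type. By representability such
    a variable may be replaced by a tuple of fresh variables ([le_untup]), and then both sides
    beta-reduce to the same term ([le_let_out], [le_let_in]). Reductions below the binders of a
    context [L] follow from the case of the hole by moving these binders outwards. Hence the
    interpretation descends to classes ([tm_eq_sound]), and it preserves composition and action
    ([den_comp], [den_act]), which gives [free_functor].

    Uniqueness holds because every class is built from the variables, the generators, [re] and [ev]
    by composition, the symmetric action and the two universal properties. A tuple, a multiarrow or
    an application is a generic arrow composed with the classes of the subterms. The class of a
    [Lam] composed with [ev], and that of a [Let] over a variable precomposed with [re], contract to
    the class of the body, so that their images under any functor are determined by the image of the
    body ([image_nm]). Here composites of classes have to be computed on arbitrary representatives,
    which is [tm_eq_comp]: a substituted term is expanded to a beta-redex, inside which the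
    equivalences apply as reductions in a context. *)

(** * Arrows bundled with their source and target *)

Section Arrows.
Variable S : autonomous_data.

(** Bundling turns equations between arrows of different but provably equal types into plain
    equalities: [Ar_cast] erases casts, and [Ar_inj] returns to a fixed type. *)
Definition arrow := {u : seq (ob S) & {b : ob S & hom S u b}}.
Definition Ar u b (f : hom S u b) : arrow := existT _ u (existT _ b f).
Definition src (f : arrow) : seq (ob S) := projT1 f.
Definition tgt (f : arrow) : ob S := projT1 (projT2 f).

Lemma arrowP (f : arrow) : exists u b (g : hom S u b), f = Ar g.
Proof. by case: f => u [b g]; exists u, b, g. Qed.

(** Equal bundles have components that agree up to transport along equalities of source and target;
    here these are equalities of an object with itself, which proof irrelevance makes trivial. *)
Lemma Ar_inj u b (f g : hom S u b) : Ar f = Ar g -> f = g.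
Proof.
move=> e.
have h : forall F G : arrow, F = G -> forall (e1 : src F = src G) (e2 : tgt F = tgt G),
    cast e1 e2 (projT2 (projT2 F)) = projT2 (projT2 G).
  move=> F _ <- e1 e2.
  by rewrite (Prop_irrelevance e1 erefl) (Prop_irrelevance e2 erefl).
exact: (h _ _ e erefl erefl).
Qed.

Lemma Ar_cast u v a b (eu : u = v) (ea : a = b) (f : hom S u a) : Ar (cast eu ea f) = Ar f.
Proof. by case: v / eu; case: b / ea. Qed.

(** The intermediate form through which an ordinary list of bundled arrows, which determines its own
    boundary, is turned back into the dependent list that [comp] expects. *)
Definition pack := {us : seq (seq (ob S)) & {v : seq (ob S) & homs S us v}}.
Definition Pack us v (h : homs S us v) : pack := existT _ us (existT _ v h).
Definition pack_cons (f : arrow) (p : pack) : pack :=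
  Pack (hcons (projT2 (projT2 f)) (projT2 (projT2 p))).
Definition pack_of (gs : seq arrow) : pack := foldr pack_cons (Pack hnil) gs.

Lemma pack_of_harrows us v (gs : homs S us v) : pack_of (harrows gs) = Pack gs.
Proof. by elim: gs => //= a b u w f h ->. Qed.

Lemma harrows_pack gs : harrows (projT2 (projT2 (pack_of gs))) = gs.
Proof. by elim: gs => //= -[u [b f]] gs IH; congr (_ :: _). Qed.

Lemma src_harrows us v (gs : homs S us v) : map src (harrows gs) = us.
Proof. by elim: gs => //= a b u w f h ->. Qed.

Lemma tgt_harrows us v (gs : homs S us v) : map tgt (harrows gs) = v.
Proof. by elim: gs => //= a b u w f h ->. Qed.

Lemma harrowsP (gs : seq arrow) :
  exists us v (hs : homs S us v), [/\ gs = harrows hs, us = map src gs & v = map tgt gs].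
Proof.
have := harrows_pack gs; case: (pack_of gs) => us [v hs] /= <-.
by exists us, v, hs; split; rewrite ?src_harrows ?tgt_harrows.
Qed.

(* [f] itself when the [gs] do not fit *)
Definition acomp_pack (f : arrow) (p : pack) : arrow :=
  match pselect (projT1 (projT2 p) = src f) with
  | left e => Ar (comp (projT2 (projT2 f))
      (eq_rect _ (fun v => homs S (projT1 p) v) (projT2 (projT2 p)) _ e))
  | right _ => f
  end.
Definition acomp (f : arrow) (gs : seq arrow) : arrow := acomp_pack f (pack_of gs).

Lemma acompE us v b (f : hom S v b) (gs : homs S us v) :
  acomp (Ar f) (harrows gs) = Ar (comp f gs).
Proof.
rewrite /acomp pack_of_harrows /acomp_pack /=; case: pselect => // e.
by rewrite (Prop_irrelevance e erefl).
Qed.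

Definition aact (f : arrow) (p : seq nat) : arrow :=
  match pselect (is_perm (size (src f)) p) with
  | left hp => Ar (act hp (projT2 (projT2 f)))
  | right _ => f
  end.

Lemma aactE u a p (hp : is_perm (size u) p) (f : hom S u a) : aact (Ar f) p = Ar (act hp f).
Proof. by rewrite /aact /=; case: pselect => // e; rewrite (Prop_irrelevance e hp). Qed.

Definition aid (a : ob S) : arrow := Ar (idm S a).
Definition are (u : seq (ob S)) : arrow := Ar (re S u).
Definition aev u (a : ob S) : arrow := Ar (ev S u a).

Lemma harrows_ids u : harrows (ids u) = map aid u.
Proof. by elim: u => //= a u ->. Qed.

Lemma harrows_cat us v us' v' (h : homs S us v) (h' : homs S us' v') :
  harrows (hcat h h') = harrows h ++ harrows h'.
Proof. by elim: h => //= a b u w f h ->. Qed.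

Lemma acomp_fit f gs : map tgt gs = src f ->
  src (acomp f gs) = flatten (map src gs) /\ tgt (acomp f gs) = tgt f.
Proof.
have [us [v [hs [-> _ _]]]] := harrowsP gs; rewrite src_harrows tgt_harrows.
have [v' [b [g ->]]] := arrowP f => /= e; rewrite /src /= in e; subst v'.
by rewrite acompE.
Qed.

Lemma src_acomp f gs : map tgt gs = src f -> src (acomp f gs) = flatten (map src gs).
Proof. by case/acomp_fit. Qed.

(** When the [gs] do not fit, the value is [f] itself, which has the same target. *)
Lemma tgt_acomp f gs : tgt (acomp f gs) = tgt f.
Proof. by rewrite /acomp /acomp_pack; case: pselect. Qed.

Lemma src_aact f p : is_perm (size (src f)) p -> src (aact f p) = permute (src f) p.
Proof. by rewrite /aact; case: pselect. Qed.

Lemma tgt_aact f p : tgt (aact f p) = tgt f.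
Proof. by rewrite /aact; case: pselect. Qed.

End Arrows.

HB.instance Definition _ (S : autonomous_data) := gen_eqMixin (arrow S).

(** * The unit and associativity laws for bundled arrows *)

Section Laws.
Variable S : autonomous_multicategory.
Notation arrow := (arrow S).
Let ax := amc_axioms S.

Lemma acomp_aid (f : arrow) : acomp f (map (@aid S) (src f)) = f.
Proof.
have [u [a [g ->]]] := arrowP f; rewrite /src /= -harrows_ids acompE.
have e : flatten (singles u) = u by exact: flatten_singles.
by rewrite -[in RHS](comp_id_r ax g e) Ar_cast.
Qed.

Lemma aid_acomp (f : arrow) : acomp (aid (tgt f)) [:: f] = f.
Proof.
have [u [a [g ->]]] := arrowP f; rewrite /tgt /=.
have e : flatten [:: u] = u by rewrite /= cats0.
by rewrite -[in RHS](comp_id_l ax g e) Ar_cast -acompE.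
Qed.

(** The tags in [l] keep the two layers aligned: [h t] is the list of arrows plugged into [g t]. *)
Lemma acompA (T : eqType) (f : arrow) (l : seq T) (g : T -> arrow) (h : T -> seq arrow) :
  [seq tgt (g t) | t <- l] = src f -> {in l, forall t, map (@tgt S) (h t) = src (g t)} ->
  acomp (acomp f (map g l)) (flatten (map h l)) = acomp f [seq acomp (g t) (h t) | t <- l].
Proof.
move=> hf hl.
have [uss [us [v [gs [hs [e1 e2 e3]]]]]] : exists uss us v (gs : homs S us v)
    (hs : hlist (homs S) uss us), [/\ harrows gs = map g l,
     harrows (hflatten hs) = flatten (map h l) &
     harrows (comps gs hs) = [seq acomp (g t) (h t) | t <- l]].
  elim: l hl {hf} => [|t l IH] hl; first by exists [::], [::], [::], hnil, hnil.
  have [|uss [us [v [gs [hs [h1 h2 h3]]]]]] := IH.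
    by move=> x hx; apply: hl; rewrite inE hx orbT.
  have := hl _ (mem_head _ _) => /=.
  have [u [w [k [-> _ _]]]] := harrowsP (h t); rewrite tgt_harrows.
  have [u' [b [g' ->]]] := arrowP (g t); rewrite /src /= => e; subst u'.
  exists (u :: uss), (w :: us), (b :: v), (hcons g' gs), (hcons k hs).
  by rewrite /= harrows_cat h1 h2 h3 acompE.
move: hf; rewrite (map_comp (@tgt S) g) -e1 -e2 -e3 tgt_harrows.
have [u [a [f' ->]]] := arrowP f; rewrite /src /= => e; subst u.
have e : flatten (flatten uss) = flatten (map flatten uss).
  by elim: (uss) => //= x xs IH; rewrite flatten_cat IH.
by rewrite !acompE -(comp_assoc ax f' gs hs e) Ar_cast.
Qed.

End Laws.

(** * Permutations given by two orders of a list of names *)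

(** One-line notation of the permutation that brings entries named by [xs] into the order [ys]. With
    distinct names, composites, block sums and block permutations can be read off from the lists of
    names, which confines the index arithmetic to the lemmas below. *)
Definition perm_to (xs ys : seq nat) : seq nat := [seq index y xs | y <- ys].

Lemma perm_toE xs : uniq xs -> perm_to xs xs = iota 0 (size xs).
Proof.
move=> hu; apply: (@eq_from_nth _ 0); rewrite ?size_map ?size_iota // => i hi.
by rewrite (nth_map 0) // nth_iota // index_uniq.
Qed.

Lemma is_perm_to xs ys : uniq xs -> perm_eq xs ys -> is_perm (size xs) (perm_to xs ys).
Proof. by move=> hu hp; rewrite /is_perm -perm_toE //; apply: perm_map; rewrite perm_sym. Qed.

Lemma permute_to T (h : nat -> T) xs ys : {subset ys <= xs} ->
  permute (map h xs) (perm_to xs ys) = map h ys.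
Proof.
rewrite /permute /perm_to; elim: ys => //= y ys IH hs.
have hy : y \in xs by apply: hs; rewrite mem_head.
rewrite onth_map onthE (nth_map y) ?index_mem // nth_index //= IH // => z hz.
by apply: hs; rewrite inE hz orbT.
Qed.

Lemma index_in_map (T1 T2 : eqType) (f : T1 -> T2) (s : seq T1) x :
  {in s &, injective f} -> x \in s -> index (f x) (map f s) = index x s.
Proof.
elim: s => //= y s IH hf hx; rewrite (inj_in_eq hf) ?mem_head //.
case: eqP hx => //= nyx; rewrite inE => /predU1P[e|hx]; first by case: nyx.
rewrite IH // => a b ha hb; apply: hf; by rewrite inE ?ha ?hb orbT.
Qed.

Lemma perm_to_map (r : nat -> nat) xs ys : {in xs &, injective r} -> {subset ys <= xs} ->
  perm_to (map r xs) (map r ys) = perm_to xs ys.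
Proof.
move=> hr hs; rewrite /perm_to -map_comp; apply/eq_in_map => y /hs hy /=.
by rewrite index_in_map.
Qed.

(** Since the blocks are disjoint, a name of a later block has an index increased by the size of the
    first block, and this is the shift made by [perm_sum]. *)
Lemma perm_to_flatten (T : eqType) (l : seq T) (X Y : T -> seq nat) :
  uniq (flatten (map X l)) -> {in l, forall t, perm_eq (X t) (Y t)} ->
  perm_to (flatten (map X l)) (flatten (map Y l)) =
  perm_sum [seq perm_to (X t) (Y t) | t <- l].
Proof.
elim: l => //= t l IH; rewrite cat_uniq => /and3P[_ hh hu] hp.
rewrite /perm_to map_cat -!/(perm_to _ _); congr (_ ++ _).
  apply/eq_in_map => y hy; rewrite index_cat.
  by rewrite (perm_mem (hp _ (mem_head _ _))) hy.
have hp' : {in l, forall t, perm_eq (X t) (Y t)}.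
  by move=> x hx; apply: hp; rewrite inE hx orbT.
rewrite -IH // /perm_to -map_comp size_map -(perm_size (hp _ (mem_head _ _))).
apply/eq_in_map => y /flatten_mapP[z hz hy] /=; rewrite index_cat.
rewrite -(perm_mem (hp' _ hz)) in hy.
by rewrite (negbTE (hasPn hh _ _)) //; apply/flatten_mapP; exists z.
Qed.

(** The identity permutation that [perm_block] cuts into pieces is [perm_to F F], and its pieces are
    the [perm_to F (N x)]; moving the pieces as wholes is reindexing by [ys]. *)
Lemma perm_to_blocks xs ys (N : nat -> seq nat) :
  uniq (flatten (map N xs)) -> {subset ys <= xs} ->
  perm_to (flatten (map N xs)) (flatten (map N ys)) =
  perm_block [seq size (N x) | x <- xs] (perm_to xs ys).
Proof.
set F := flatten (map N xs) => hu hs; rewrite /perm_block.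
have <- : perm_to F F = iota 0 (sumn [seq size (N x) | x <- xs]).
  rewrite perm_toE // size_flatten /shape -map_comp; congr (iota 0 (sumn _)).
have -> : reshape [seq size (N x) | x <- xs] (perm_to F F) = [seq perm_to F (N x) | x <- xs].
  rewrite {1}/perm_to {2}/F map_flatten -map_comp.
  have -> : [seq size (N x) | x <- xs] = shape [seq perm_to F (N x) | x <- xs].
    by rewrite /shape -map_comp; apply: eq_map => x /=; rewrite size_map.
  exact: flattenK.
by rewrite permute_to // {1}/perm_to map_flatten -map_comp.
Qed.

Lemma permute_cat T (u v : seq T) p q : is_perm (size u) p ->
  permute (u ++ v) (p ++ [seq size p + i | i <- q]) = permute u p ++ permute v q.
Proof.
move=> hp; have sp : size p = size u by rewrite (perm_size hp) size_iota.
rewrite /permute pmap_cat sp; congr (_ ++ _).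
  have: all (fun i => i < size u) p.
    by apply/allP => i; rewrite (perm_mem hp) mem_iota.
  by elim: (p) => //= i p' IH /andP[hi /IH ->]; rewrite onth_cat hi.
elim: q => //= i q ->; by rewrite onth_cat ltnNge leq_addr /= addKn.
Qed.

Lemma permute_iota T (c1 c c2 : seq T) :
  permute (c1 ++ c ++ c2) (iota (size c1) (size c)) = c.
Proof.
elim: c c1 => //= x c IH c1; rewrite /permute /= onth_cat ltnn subnn /=; congr (_ :: _).
by rewrite -[RHS](IH (rcons c1 x)) size_rcons cat_rcons.
Qed.

Lemma permute_block T (us : seq (seq T)) p :
  permute (flatten us) (perm_block (shape us) p) = flatten (permute us p).
Proof.
rewrite /perm_block.
have h : map (permute (flatten us)) (reshape (shape us) (iota 0 (sumn (shape us)))) = us.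
  rewrite -[flatten us]cat0s -[0]/(size (Nil T)); elim: us [::] => //= u us IH c1.
  rewrite iotaD take_size_cat ?size_iota // drop_size_cat ?size_iota // permute_iota.
  by congr (_ :: _); rewrite -size_cat catA IH.
rewrite -[in RHS]h permute_map; elim: (permute _ p) => //= q qs IH.
by rewrite /permute pmap_cat; congr (_ ++ _).
Qed.

(** * Symmetric action and universal properties with named sources *)

Section Reorder.
Variable S : autonomous_multicategory.
Notation arrow := (arrow S).
Let ax := amc_axioms S.

(** The sources of [f] are thought of as named by [xs]; the names belong to the description and not
    to the arrow, so they can be changed injectively ([reo_map]). *)
Definition reo xs ys (f : arrow) : arrow := aact f (perm_to xs ys).

Lemma tgt_reo xs ys f : tgt (reo xs ys f) = tgt f.
Proof. exact: tgt_aact. Qed.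

Lemma src_reo h xs ys f : uniq xs -> perm_eq xs ys -> src f = map h xs ->
  src (reo xs ys f) = map h ys.
Proof.
move=> hu hp e; rewrite src_aact e ?size_map ?is_perm_to // permute_to // => y.
by rewrite (perm_mem hp).
Qed.

Lemma reo_id xs f : uniq xs -> size (src f) = size xs -> reo xs xs f = f.
Proof.
have [u [a [g ->]]] := arrowP f; rewrite /src /= => hu e.
have hp : is_perm (size u) (iota 0 (size u)) by exact: perm_refl.
rewrite /reo perm_toE // -e aactE.
have e' : permute u (iota 0 (size u)) = u.
  rewrite /permute; elim: (u) => //= x c IH; congr (_ :: _).
  by rewrite -[RHS]IH -[1]addn0 iotaDl; elim: (iota _ _) => //= j s ->.
by rewrite -[in RHS](act_id ax g hp e') Ar_cast.
Qed.

Lemma reo_comp xs ys zs f : uniq xs -> perm_eq xs ys -> perm_eq ys zs ->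
  size (src f) = size xs -> reo ys zs (reo xs ys f) = reo xs zs f.
Proof.
have [u [a [g ->]]] := arrowP f; rewrite /src /= => hu h1 h2 e.
have hp : is_perm (size u) (perm_to xs ys) by rewrite e; exact: is_perm_to.
have hy : uniq ys by rewrite -(perm_uniq h1).
rewrite /reo (aactE hp).
have hq : is_perm (size (permute u (perm_to xs ys))) (perm_to ys zs).
  by rewrite size_permute // e (perm_size h1); exact: is_perm_to.
have ec : perm_comp (perm_to xs ys) (perm_to ys zs) = perm_to xs zs.
  rewrite /perm_comp /perm_to -map_comp; apply/eq_in_map => z hz /=.
  have hz' : z \in ys by rewrite (perm_mem h2).
  by rewrite (nth_map 0) ?index_mem // nth_index.
have hr : is_perm (size u) (perm_comp (perm_to xs ys) (perm_to ys zs)).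
  by rewrite ec e; apply: is_perm_to => //; exact: perm_trans h2.
rewrite -ec (aactE hr) (aactE hq).
have e' : permute (permute u (perm_to xs ys)) (perm_to ys zs) =
    permute u (perm_comp (perm_to xs ys) (perm_to ys zs)).
  (* A nonempty source provides the default object needed to write [u] as a function of the names;
     if the source is empty, so are the three lists of names. *)
  have [x0 _|] := pickP (fun i : 'I_(size u) => true); last first.
    case: (u) e => [|x0 u'] // ; last by move=> _ /(_ ord0).
    case: (xs) h1 => // /perm_size; case: (ys) h2 => // /perm_size; by case: (zs).
  case: (u) e hp x0 => [|d u'] e hp x0; first by case: x0.
  have -> : d :: u' = [seq nth d (d :: u') (index x xs) | x <- xs].
    apply: (@eq_from_nth _ d); rewrite ?size_map // => i hi.
    by rewrite (nth_map 0) -?e // index_uniq -?e.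
  rewrite ec !permute_to //; first by move=> x; rewrite (perm_mem h1) (perm_mem h2).
    by move=> x; rewrite (perm_mem h2).
  by move=> x; rewrite (perm_mem h1).
by rewrite -(act_comp ax g hp hq hr e') Ar_cast.
Qed.

Lemma reo_map (r : nat -> nat) xs ys f : {in xs &, injective r} -> {subset ys <= xs} ->
  reo (map r xs) (map r ys) f = reo xs ys f.
Proof. by move=> hr hs; rewrite /reo perm_to_map. Qed.

(** The axiom [comp_act_r] in terms of names: [X t] and [Y t] name the sources of [g t] before and
    after, and the composite has the concatenated names. *)
Lemma acomp_reor (T : eqType) (l : seq T) (X Y : T -> seq nat) (g : T -> arrow) f :
  uniq (flatten (map X l)) -> {in l, forall t, perm_eq (X t) (Y t)} ->
  {in l, forall t, size (src (g t)) = size (X t)} -> [seq tgt (g t) | t <- l] = src f ->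
  acomp f [seq reo (X t) (Y t) (g t) | t <- l] =
  reo (flatten (map X l)) (flatten (map Y l)) (acomp f (map g l)).
Proof.
move=> hu hp hs hf; rewrite /reo perm_to_flatten //.
have [us [us' [v [gs [gs' [e1 e2 e3]]]]]] : exists us us' v (gs : homs S us v)
    (gs' : homs S us' v), [/\ harrows gs = map g l,
     harrows gs' = [seq reo (X t) (Y t) (g t) | t <- l] &
     homs_act [seq perm_to (X t) (Y t) | t <- l] gs gs'].
  elim: l {hf} hu hp hs => [|t l IH] /=.
    by exists [::], [::], [::], hnil, hnil; split=> //; constructor.
  rewrite cat_uniq => /and3P[hx _ hu] hp hs.
  have [//|||us [us' [v [gs [gs' [h1 h2 h3]]]]]] := IH.
  - by move=> x hx'; apply: hp; rewrite inE hx' orbT.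
  - by move=> x hx'; apply: hs; rewrite inE hx' orbT.
  have := hs _ (mem_head _ _); have := hp _ (mem_head _ _).
  have [u [a [k ek]]] := arrowP (g t); rewrite ek /src /= => ht e.
  have hi : is_perm (size u) (perm_to (X t) (Y t)) by rewrite e; exact: is_perm_to.
  exists (u :: us), (permute u (perm_to (X t) (Y t)) :: us'), (a :: v).
  exists (hcons k gs), (hcons (act hi k) gs'); split=> /=.
  - by rewrite h1.
  - by rewrite h2 /reo aactE.
  - exact: homs_act_cons.
move: hf; rewrite (map_comp (@tgt S) g) -e1 tgt_harrows.
have [u [a [f' ->]]] := arrowP f; rewrite /src /= => e; subst u.
rewrite acompE -/(reo _ _ _) -e2 acompE.
have us_e : map size us = [seq size (X t) | t <- l].
  have := congr1 (map (fun h => size (src h))) e1.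
  rewrite (map_comp size (@src S)) src_harrows => ->; rewrite -map_comp.
  by apply/eq_in_map => t ht /=; rewrite hs.
have hps : is_perm (size (flatten us)) (perm_sum [seq perm_to (X t) (Y t) | t <- l]).
  rewrite -perm_to_flatten // size_flatten /shape us_e.
  have -> : sumn [seq size (X t) | t <- l] = size (flatten (map X l)).
    by rewrite size_flatten /shape -map_comp.
  apply: is_perm_to => //; elim: (l) hp => //= t m IH hp.
  apply: perm_cat; first by apply: hp; rewrite mem_head.
  by apply: IH => x hx; apply: hp; rewrite inE hx orbT.
have e' : flatten us' = permute (flatten us) (perm_sum [seq perm_to (X t) (Y t) | t <- l]).
  elim: e3 => //= u' b ws ws' w p ps hq k ks ks' _ ->.
  by rewrite permute_cat.
by rewrite aactE -(comp_act_r ax f' hps e' e3) Ar_cast.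
Qed.

(** The axiom [comp_act_l] in terms of names: [N x] names the sources of the arrow plugged in at
    [x], so permuting the [x] moves these blocks. *)
Lemma acomp_reol xs ys (N : nat -> seq nat) (g : nat -> arrow) f :
  uniq xs -> perm_eq xs ys -> uniq (flatten (map N xs)) ->
  {in xs, forall x, size (src (g x)) = size (N x)} -> [seq tgt (g x) | x <- xs] = src f ->
  acomp (reo xs ys f) (map g ys) =
  reo (flatten (map N xs)) (flatten (map N ys)) (acomp f (map g xs)).
Proof.
have [u [a [f' ->]]] := arrowP f; rewrite /src /= => hu hp hN hs hf; subst u.
have sxy : {subset ys <= xs} by move=> y; rewrite (perm_mem hp).
rewrite /reo perm_to_blocks //.
have hp' : is_perm (size [seq tgt (g x) | x <- xs]) (perm_to xs ys).
  by rewrite size_map is_perm_to.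
rewrite (aactE hp').
have [us [v [gs [e1 us_e v_e]]]] := harrowsP (map g xs).
have [us' [v' [gs' [e1' us_e' v_e']]]] := harrowsP (map g ys).
move: v_e v_e'; rewrite -!map_comp => v_e v_e'; subst v.
have ev' : v' = permute [seq tgt (g x) | x <- xs] (perm_to xs ys).
  by rewrite permute_to // v_e'.
clear v_e'; subst v'; rewrite e1 e1' !acompE.
have sh : shape us = [seq size (N x) | x <- xs].
  by rewrite /shape us_e -!map_comp; apply/eq_in_map => x hx /=; rewrite hs.
have e : harrows gs' = permute (harrows gs) (perm_to xs ys) by rewrite -e1 -e1' permute_to.
have hb : is_perm (size (flatten us)) (perm_block (shape us) (perm_to xs ys)).
  rewrite sh -perm_to_blocks // size_flatten sh.
  have -> : sumn [seq size (N x) | x <- xs] = size (flatten (map N xs)).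
    by rewrite size_flatten /shape -map_comp.
  exact: is_perm_to (perm_flatten (perm_map _ hp)).
have e' : flatten us' = permute (flatten us) (perm_block (shape us) (perm_to xs ys)).
  by rewrite permute_block us_e us_e' -!map_comp permute_to.
by rewrite -sh (aactE hb) -(comp_act_l ax f' hp' hb e' e) Ar_cast.
Qed.

Lemma rep_ex u v w (h : arrow) : src h = u ++ v ++ w -> exists f : arrow,
  [/\ src f = u ++ tens S v :: w, tgt f = tgt h &
      acomp f (map (@aid S) u ++ are v :: map (@aid S) w) = h].
Proof.
have [z [a [h' ->]]] := arrowP h; rewrite /src /= => e; subst z.
have e : flatten (singles u ++ v :: singles w) = u ++ v ++ w.
  by rewrite flatten_cat /= !flatten_singles.
have [k _ hk] := representable ax a e.
exists (Ar (k h')); split=> //.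
have := acompE (k h') (hcat (ids u) (hcons (re S v) (ids w))).
by rewrite harrows_cat /= !harrows_ids => ->; rewrite -[in RHS](hk h') Ar_cast.
Qed.

Lemma rep_inj u v w (f f' : arrow) :
  src f = u ++ tens S v :: w -> src f' = u ++ tens S v :: w -> tgt f = tgt f' ->
  acomp f (map (@aid S) u ++ are v :: map (@aid S) w) =
  acomp f' (map (@aid S) u ++ are v :: map (@aid S) w) -> f = f'.
Proof.
have [z [a [h ->]]] := arrowP f; rewrite /src /tgt /= => e; subst z.
have [z [a' [h' ->]]] := arrowP f'; rewrite /src /tgt /= => e e'; subst z a'.
have e : flatten (singles u ++ v :: singles w) = u ++ v ++ w.
  by rewrite flatten_cat /= !flatten_singles.
have := acompE h (hcat (ids u) (hcons (re S v) (ids w))).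
have := acompE h' (hcat (ids u) (hcons (re S v) (ids w))).
rewrite harrows_cat /= !harrows_ids => -> ->.
rewrite -(Ar_cast e erefl) -[in RHS](Ar_cast e erefl) => /Ar_inj.
by move/(bij_inj (representable ax a e)) => ->.
Qed.

Lemma cl_ex u v (h : arrow) : src h = u ++ v -> exists f : arrow,
  [/\ src f = u, tgt f = limp S v (tgt h) & acomp (aev v (tgt h)) (f :: map (@aid S) v) = h].
Proof.
have [z [a [h' ->]]] := arrowP h; rewrite /src /tgt /= => e; subst z.
have e : u ++ flatten (singles v) = u ++ v by rewrite flatten_singles.
have [k _ hk] := closed ax a e.
exists (Ar (k h')); split=> //.
have := acompE (ev S v a) (hcons (k h') (ids v)).
by rewrite /= harrows_ids => ->; rewrite -[in RHS](hk h') Ar_cast.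
Qed.

Lemma cl_inj u v a (f f' : arrow) :
  src f = u -> src f' = u -> tgt f = limp S v a -> tgt f' = limp S v a ->
  acomp (aev v a) (f :: map (@aid S) v) = acomp (aev v a) (f' :: map (@aid S) v) -> f = f'.
Proof.
have [z [b [h ->]]] := arrowP f; rewrite /src /tgt /= => e; subst z.
have [z [b' [h' ->]]] := arrowP f'; rewrite /src /tgt /= => e1 e2 e3; subst z b b'.
have e : u ++ flatten (singles v) = u ++ v by rewrite flatten_singles.
have := acompE (ev S v a) (hcons h (ids v)).
have := acompE (ev S v a) (hcons h' (ids v)).
rewrite /= !harrows_ids => -> ->.
rewrite -(Ar_cast e erefl) -[in RHS](Ar_cast e erefl) => /Ar_inj.
by move/(bij_inj (closed ax a e)) => ->.
Qed.

(* Inverses of the two universal bijections, with junk value [h] when [h] does not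
   have the required source. *)
Definition unrep u v w (h : arrow) : arrow :=
  match pselect (exists f : arrow, [/\ src f = u ++ tens S v :: w, tgt f = tgt h &
      acomp f (map (@aid S) u ++ are v :: map (@aid S) w) = h]) with
  | left e => sval (cid e)
  | right _ => h
  end.

Definition curry u v (h : arrow) : arrow :=
  match pselect (exists f : arrow, [/\ src f = u, tgt f = limp S v (tgt h) &
      acomp (aev v (tgt h)) (f :: map (@aid S) v) = h]) with
  | left e => sval (cid e)
  | right _ => h
  end.

Lemma unrepP u v w h : src h = u ++ v ++ w ->
  [/\ src (unrep u v w h) = u ++ tens S v :: w, tgt (unrep u v w h) = tgt h &
      acomp (unrep u v w h) (map (@aid S) u ++ are v :: map (@aid S) w) = h].
Proof.
move=> e; rewrite /unrep; case: pselect => [e'|[]]; first by case: (cid e').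
exact: rep_ex.
Qed.

Lemma curryP u v h : src h = u ++ v ->
  [/\ src (curry u v h) = u, tgt (curry u v h) = limp S v (tgt h) &
      acomp (aev v (tgt h)) (curry u v h :: map (@aid S) v) = h].
Proof.
move=> e; rewrite /curry; case: pselect => [e'|[]]; first by case: (cid e').
exact: cl_ex.
Qed.

(** The form in which representability is applied: a candidate is recognised by what it becomes
    after precomposition with [re]. [curry_uniq] does the same for [ev]. *)
Lemma unrep_uniq u v w h f : src h = u ++ v ++ w ->
  src f = u ++ tens S v :: w -> tgt f = tgt h ->
  acomp f (map (@aid S) u ++ are v :: map (@aid S) w) = h -> unrep u v w h = f.
Proof.
move=> e h1 h2 h3; have [e1 e2 e3] := unrepP e.
by apply: (rep_inj e1 h1); rewrite ?e2 ?h2 // e3 h3.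
Qed.

Lemma curry_uniq u v h f : src h = u ++ v ->
  src f = u -> tgt f = limp S v (tgt h) ->
  acomp (aev v (tgt h)) (f :: map (@aid S) v) = h -> curry u v h = f.
Proof.
move=> e h1 h2 h3; have [e1 e2 e3] := curryP e.
by apply: (cl_inj e1 h1 e2 h2); rewrite e3 h3.
Qed.

End Reorder.

(** Classical equality tests make [==] on types and membership in lists of terms available for
    arbitrary atoms and multiarrows. *)
HB.instance Definition _ (A : Type) := gen_eqMixin (ty A).
HB.instance Definition _ (H : autonomous_signature) := gen_eqMixin (tm H).

(** * Free variables, synthesised types and substitution of raw terms *)

Section Syntax.
Variable H : autonomous_signature.
Notation tm := (tm H).
Notation type := (type H).
Implicit Types (s t : tm) (ss : seq tm) (u : seq type) (b : type) (r : nat -> tm).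

Lemma tm_nested_ind (P : tm -> Prop) :
  (forall n, P (Var n)) -> (forall u s, P s -> P (Lam u s)) ->
  (forall s t, P s -> P t -> P (App s t)) ->
  (forall ss, {in ss, forall s, P s} -> P (Tup ss)) ->
  (forall u s t, P s -> P t -> P (Let u s t)) ->
  (forall u b (f : arr H u b) ss, {in ss, forall s, P s} -> P (Op f ss)) ->
  forall s, P s.
Proof.
move=> hV hL hA hT hLet hO; fix IH 1; case.
- exact: hV.
- move=> u s; exact: hL.
- move=> s t; exact: hA.
(* [IH] is cleared so that automation cannot use it on a term that is not a subterm, which the guard
   condition would reject. *)
- move=> ss; apply: hT; elim: ss => [|s ss IHss] t; [by clear IH|rewrite inE].
  by case/predU1P => [->|]; [exact: IH|exact: IHss].
- move=> u s t; exact: hLet.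
- move=> u b f ss; apply: hO; elim: ss => [|s ss IHss] t; [by clear IH|rewrite inE].
  by case/predU1P => [->|]; [exact: IH|exact: IHss].
Qed.

Definition lower (k : nat) (l : seq nat) : seq nat := [seq n - k | n <- l & k <= n].

Definition binds (k : nat) (l : seq nat) : bool :=
  all (fun i => count_mem i l == 1) (iota 0 k).

(* Free variables in the order in which [sem] below lists the sources. *)
Fixpoint fv s : seq nat :=
  match s with
  | Var n => [:: n]
  | Lam u s => lower (size u) (fv s)
  | App s t => fv s ++ fv t
  | Tup ss => flatten (map fv ss)
  | Let u s t => fv t ++ lower (size u) (fv s)
  | Op _ _ f ss => flatten (map fv ss)
  end.

Definition ext u (rho : nat -> type) (n : nat) : type := nth (rho (n - size u)) u n.

(** The annotations on binders determine the type. [Tens [::]] for an application of a term that is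
    not a function is junk, which [wt] excludes. *)
Fixpoint ty_of (rho : nat -> type) s : type :=
  match s with
  | Var n => rho n
  | Lam u s => Limp u (ty_of (ext u rho) s)
  | App s t => if ty_of rho s is Limp _ b then b else Tens [::]
  | Tup ss => Tens (map (ty_of rho) ss)
  | Let u s t => ty_of (ext u rho) s
  | Op _ b f ss => b
  end.

(* Well-typedness, with linearity required only of the bound variables: that of
   the free ones is [uniq (fv s)]. *)
Fixpoint wt (rho : nat -> type) s : bool :=
  match s with
  | Var n => true
  | Lam u s => binds (size u) (fv s) && wt (ext u rho) s
  | App s t => [&& wt rho s, wt rho t &
      if ty_of rho s is Limp u b then ty_of rho t == Tens u else false]
  | Tup ss => all (wt rho) ss
  | Let u s t => [&& wt rho t, ty_of rho t == Tens u, binds (size u) (fv s) &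
      wt (ext u rho) s]
  | Op u b f ss => all (wt rho) ss && (map (ty_of rho) ss == u)
  end.

Lemma ext_lt u rho n d : n < size u -> ext u rho n = nth d u n.
Proof. by move=> h; apply: set_nth_default. Qed.

Lemma ext_ge u rho n : ext u rho (size u + n) = rho n.
Proof. by rewrite /ext nth_default ?leq_addr // addKn. Qed.

Lemma ext_upren u rho f : ext u rho \o upren (size u) f = ext u (rho \o f).
Proof.
apply: funext => n; rewrite /= /upren; case: ltnP => h; first by rewrite !(ext_lt _ (rho 0) h).
by rewrite ext_ge -[in RHS](subnKC h) ext_ge.
Qed.

Lemma ext_addn u rho : ext u rho \o addn (size u) = rho.
Proof. by apply: funext => n /=; rewrite ext_ge. Qed.

Lemma lower_cat k l l' : lower k (l ++ l') = lower k l ++ lower k l'.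
Proof. by rewrite /lower filter_cat map_cat. Qed.

Lemma lower_addn k l : lower k (map (addn k) l) = l.
Proof. by elim: l => //= n l IH; rewrite /lower /= leq_addr /= addKn -/(lower k _) IH. Qed.

Lemma addn_lower k l : map (addn k) (lower k l) = [seq n <- l | k <= n].
Proof. by elim: l => //= n l IH; rewrite /lower /=; case: leqP => //= h; rewrite subnKC // -/(lower k _) IH. Qed.

Lemma mem_lower k l n : (n \in lower k l) = (k + n \in l).
Proof.
by rewrite -(mem_map (@addnI k)) addn_lower mem_filter leq_addr.
Qed.

Lemma lower_upren k f l : lower k (map (upren k f) l) = map f (lower k l).
Proof.
elim: l => //= n l IH; rewrite /lower /= {1 2}/upren; case: (ltnP n k) => h.
  by rewrite leqNgt h /= -IH.
by rewrite leq_addr /= addKn -/(lower k _) IH.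
Qed.

Lemma count_upren k f l i : i < k -> count_mem i (map (upren k f) l) = count_mem i l.
Proof.
move=> hi; elim: l => //= n l ->; congr (_ + _); rewrite /upren.
case: ltnP => // h; rewrite (gtn_eqF (leq_trans hi h)) gtn_eqF //.
exact: leq_trans hi (leq_addr _ _).
Qed.

Lemma binds_upren k f l : binds k (map (upren k f) l) = binds k l.
Proof. by apply: eq_in_all => i; rewrite mem_iota /= => hi; rewrite count_upren. Qed.

Lemma binds_perm k l l' : perm_eq l l' -> binds k l = binds k l'.
Proof. by move/permP=> h; apply: eq_all => i; rewrite h. Qed.

Lemma lower_perm k l l' : perm_eq l l' -> perm_eq (lower k l) (lower k l').
Proof. by move=> h; apply: perm_map; exact: perm_filter. Qed.

(** Turns linearity of the bound variables into a rearrangement, by which they can be brought to one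
    end of the list of sources when a binder is interpreted. *)
Lemma perm_lower k l : binds k l -> perm_eq (iota 0 k ++ map (addn k) (lower k l)) l.
Proof.
move=> hb; rewrite addn_lower; apply/allP => i _; rewrite /= count_cat.
case: (ltnP i k) => hi.
  have /allP/(_ i) := hb; rewrite mem_iota /= => /(_ hi)/eqP ->.
  rewrite count_uniq_mem ?iota_uniq // mem_iota /= hi.
  by rewrite -/(count_mem i _) (count_memPn _) // mem_filter leqNgt hi.
rewrite -/(count_mem i _) (count_memPn _) ?add0n ?mem_iota -?leqNgt //.
rewrite count_filter; apply/eqP/eq_count => j /=.
by case: eqP => //= ->; rewrite hi.
Qed.

Lemma uniq_lower k l : binds k l -> uniq (lower k l) -> uniq l.
Proof.
move=> hb hu; rewrite -(perm_uniq (perm_lower hb)) cat_uniq iota_uniq.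
rewrite (map_inj_uniq (@addnI k)) hu andbT /=; apply/hasPn => i /mapP[j _ ->].
by rewrite mem_iota add0n /= -leqNgt leq_addr.
Qed.

Lemma fv_ren f s : fv (ren f s) = map f (fv s).
Proof.
elim/tm_nested_ind: s f => //= [u s IH|s t IHs IHt|ss IH|u s t IHs IHt|u b g ss IH] f.
- by rewrite IH lower_upren.
- by rewrite IHs IHt map_cat.
- by rewrite map_flatten -!map_comp; congr flatten; apply/eq_in_map => s hs; exact: IH.
- by rewrite IHs IHt lower_upren map_cat.
- by rewrite map_flatten -!map_comp; congr flatten; apply/eq_in_map => s hs; exact: IH.
Qed.

Lemma ty_ren rho f s : ty_of rho (ren f s) = ty_of (rho \o f) s.
Proof.
elim/tm_nested_ind: s f rho => //= [u s IH|s t IHs IHt|ss IH|u s t IHs IHt] f rho.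
- by rewrite IH ext_upren.
- by rewrite IHs.
- by rewrite -map_comp; congr Tens; apply/eq_in_map => s hs; exact: IH.
- by rewrite IHs ext_upren.
Qed.

Lemma wt_ren rho f s : wt rho (ren f s) = wt (rho \o f) s.
Proof.
elim/tm_nested_ind: s f rho => //= [u s IH|s t IHs IHt|ss IH|u s t IHs IHt|u b g ss IH] f rho.
- by rewrite IH ext_upren fv_ren binds_upren.
- by rewrite IHs IHt !ty_ren.
- by rewrite all_map; apply: eq_in_all => s hs; exact: IH.
- by rewrite IHs IHt ext_upren fv_ren binds_upren ty_ren.
- rewrite all_map -map_comp; congr andb; first by apply: eq_in_all => s hs; exact: IH.
  by congr (_ == u); apply: eq_map => s /=; rewrite ty_ren.
Qed.

Lemma up_Var k : up k (@Var H) = @Var H.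
Proof. by apply: funext => n; rewrite /up /=; case: ltnP => // h; rewrite subnKC. Qed.

Lemma subst_Var s : subst (@Var H) s = s.
Proof.
elim/tm_nested_ind: s => //= [u s IH|s t -> ->|ss IH|u s t IHs ->|u b g ss IH] //.
- by rewrite up_Var IH.
- by congr Tup; rewrite -[RHS]map_id; apply/eq_in_map.
- by rewrite up_Var IHs.
- by congr Op; rewrite -[RHS]map_id; apply/eq_in_map.
Qed.

Lemma eq_in_subst r r' s : {in fv s, r =1 r'} -> subst r s = subst r' s.
Proof.
have hup k l p p' : {in lower k l, p =1 p'} -> {in l, @up H k p =1 up k p'}.
  by move=> h n hn; rewrite /up; case: ltnP => // hk; rewrite h // mem_lower subnKC.
have hfl p p' ss : {in ss, forall s r r', {in fv s, r =1 r'} -> subst r s = subst r' s} ->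
    {in flatten (map fv ss), p =1 p'} -> map (subst p) ss = map (subst p') ss.
  move=> IH h; apply/eq_in_map => x hx; apply: IH => // n hn; apply: h.
  by apply/flatten_mapP; exists x.
elim/tm_nested_ind: s r r' => //= [n|u s IH|s t IHs IHt|ss IH|u s t IHs IHt|u b g ss IH] r r' h.
- by apply: h; rewrite inE.
- by congr Lam; apply: IH; exact: hup.
- by rewrite (IHs _ r') ?(IHt _ r') // => n hn; apply: h; rewrite mem_cat hn ?orbT.
- by congr Tup; exact: hfl.
- rewrite (IHt _ r') => [|n hn]; last by apply: h; rewrite mem_cat hn.
  by congr Let; apply: IHs; apply: hup => n hn; apply: h; rewrite mem_cat hn orbT.
- by congr Op; exact: hfl.
Qed.

Lemma up_comp_upren k r f : @up H k r \o upren k f = up k (r \o f).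
Proof.
apply: funext => n; rewrite /= /up /upren; case: (ltnP n k) => h; first by rewrite h.
by rewrite ltnNge leq_addr /= addKn.
Qed.

Lemma subst_ren r f s : subst r (ren f s) = subst (r \o f) s.
Proof.
elim/tm_nested_ind: s f r => //= [u s IH|s t IHs IHt|ss IH|u s t IHs IHt|u b g ss IH] f r.
- by rewrite IH up_comp_upren.
- by rewrite IHs IHt.
- by rewrite -map_comp; congr Tup; apply/eq_in_map => s hs; exact: IH.
- by rewrite IHs IHt up_comp_upren.
- by rewrite -map_comp; congr Op; apply/eq_in_map => s hs; exact: IH.
Qed.

Lemma renE f s : ren f s = subst (@Var H \o f) s.
Proof.
have hup k g : @up H k (@Var H \o g) = @Var H \o upren k g.
  by apply: funext => n; rewrite /up /upren /=; case: ltnP.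
elim/tm_nested_ind: s f => //= [u s IH|s t IHs IHt|ss IH|u s t IHs IHt|u b g ss IH] f.
- by rewrite IH hup.
- by rewrite IHs IHt.
- by congr Tup; apply/eq_in_map => s hs; exact: IH.
- by rewrite IHs IHt hup.
- by congr Op; apply/eq_in_map => s hs; exact: IH.
Qed.

Lemma ren_comp f g s : ren f (ren g s) = ren (f \o g) s.
Proof. by rewrite renE subst_ren [RHS]renE. Qed.

Lemma ren_subst f r s : ren f (subst r s) = subst (ren f \o r) s.
Proof.
have hup k g p : ren (upren k g) \o @up H k p = up k (ren g \o p).
  apply: funext => n; rewrite /= /up; case: ltnP => h /=; first by rewrite /upren h.
  rewrite !ren_comp; congr ren; apply: funext => m /=.
  by rewrite /upren ltnNge leq_addr /= addKn.
elim/tm_nested_ind: s f r => //= [u s IH|s t IHs IHt|ss IH|u s t IHs IHt|u b g ss IH] f r.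
- by rewrite IH hup.
- by rewrite IHs IHt.
- by rewrite -map_comp; congr Tup; apply/eq_in_map => s hs; exact: IH.
- by rewrite IHs IHt hup.
- by rewrite -map_comp; congr Op; apply/eq_in_map => s hs; exact: IH.
Qed.

Lemma up_comp k r r' : subst (@up H k r) \o up k r' = up k (subst r \o r').
Proof.
apply: funext => n; rewrite /= /up; case: ltnP => h /=; first by rewrite h.
rewrite subst_ren ren_subst; congr subst; apply: funext => m /=.
by rewrite ltnNge leq_addr /= addKn.
Qed.

Lemma subst_subst r r' s : subst r (subst r' s) = subst (subst r \o r') s.
Proof.
elim/tm_nested_ind: s r r' => //= [u s IH|s t IHs IHt|ss IH|u s t IHs IHt|u b g ss IH] r r'.
- by rewrite IH up_comp.
- by rewrite IHs IHt.
- by rewrite -map_comp; congr Tup; apply/eq_in_map => s hs; exact: IH.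
- by rewrite IHs IHt up_comp.
- by rewrite -map_comp; congr Op; apply/eq_in_map => s hs; exact: IH.
Qed.

Lemma lower_up k r l :
  lower k (flatten [seq fv (up k r n) | n <- l]) = flatten [seq fv (r n) | n <- lower k l].
Proof.
elim: l => //= n l IH; rewrite lower_cat IH /up /lower /=; case: ltnP => h /=.
  by rewrite leqNgt h.
by rewrite fv_ren -/(lower _ _) lower_addn.
Qed.

(** [up k r] fixes the bound variables, and its other values are shifted past them, so no occurrence
    of a bound variable is created or lost. *)
Lemma binds_up k r l : binds k (flatten [seq fv (up k r n) | n <- l]) = binds k l.
Proof.
apply: eq_in_all => i; rewrite mem_iota /= => hi; congr (_ == _).
elim: l => //= n l IH; rewrite count_cat IH /up; congr (_ + _).
case: ltnP => h /=; first by rewrite addn0.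
rewrite fv_ren (count_memPn _) ?(gtn_eqF (leq_trans hi h)) //.
by apply/mapP => -[j _ e]; move: hi; rewrite e ltnNge leq_addr.
Qed.

Lemma fv_subst r s : fv (subst r s) = flatten [seq fv (r n) | n <- fv s].
Proof.
have hfl p ss : {in ss, forall s r, fv (subst r s) = flatten [seq fv (r n) | n <- fv s]} ->
    flatten (map fv (map (subst p) ss)) = flatten [seq fv (p n) | n <- flatten (map fv ss)].
  elim: ss => //= x ss IH h; rewrite map_cat flatten_cat h ?mem_head // IH // => t ht.
  by apply: h; rewrite inE ht orbT.
elim/tm_nested_ind: s r => //= [n|u s IH|s t IHs IHt|ss IH|u s t IHs IHt|u b g ss IH] r.
- by rewrite cats0.
- by rewrite IH lower_up.
- by rewrite IHs IHt map_cat flatten_cat.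
- exact: hfl.
- by rewrite IHs IHt map_cat flatten_cat lower_up.
- exact: hfl.
Qed.

Lemma ext_up u rho rho' r l : {in lower (size u) l, forall n, ty_of rho' (r n) = rho n} ->
  {in l, forall n, ty_of (ext u rho') (up (size u) r n) = ext u rho n}.
Proof.
move=> h n hn; rewrite /up; case: ltnP => hk; first by rewrite /= !(ext_lt _ (rho 0) hk).
rewrite ty_ren ext_addn -[in RHS](subnKC hk) ext_ge h // mem_lower subnKC //.
Qed.

Lemma ty_subst rho rho' r s : {in fv s, forall n, ty_of rho' (r n) = rho n} ->
  ty_of rho' (subst r s) = ty_of rho s.
Proof.
elim/tm_nested_ind: s r rho rho' =>
  //= [n|u s IH|s t IHs IHt|ss IH|u s t IHs IHt] r rho rho' h.
- by rewrite h ?inE.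
- by rewrite (IH _ (ext u rho)) //; exact: ext_up.
- by rewrite (IHs _ rho) // => n hn; apply: h; rewrite mem_cat hn.
- rewrite -map_comp; congr Tens; apply/eq_in_map => s hs; apply: IH => // n hn.
  by apply: h; apply/flatten_mapP; exists s.
- by apply: IHs; apply: ext_up => n hn; apply: h; rewrite mem_cat hn orbT.
Qed.

Lemma wt_up u rho r l :
  all (fun n => wt (ext u rho) (up (size u) r n)) l =
  all (fun n => wt rho (r n)) (lower (size u) l).
Proof.
elim: l => //= n l ->; rewrite /lower /= /up; case: ltnP => //= h.
by rewrite wt_ren ext_addn.
Qed.

(** Stated as an equality of booleans, so that the well-typedness of [s] and of the substituted
    terms can also be recovered from that of the result. *)
Lemma wt_subst rho rho' r s : {in fv s, forall n, ty_of rho' (r n) = rho n} ->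
  wt rho' (subst r s) = wt rho s && all (fun n => wt rho' (r n)) (fv s).
Proof.
have hfl p rh rh' ss :
    {in ss, forall s r rho rho', {in fv s, forall n, ty_of rho' (r n) = rho n} ->
      wt rho' (subst r s) = wt rho s && all (fun n => wt rho' (r n)) (fv s)} ->
    {in flatten (map fv ss), forall n, ty_of rh' (p n) = rh n} ->
    all (wt rh') (map (subst p) ss) =
    all (wt rh) ss && all (fun n => wt rh' (p n)) (flatten (map fv ss)).
  elim: ss => //= x ss IH h hr; rewrite (h x _ _ rh) ?mem_head // => [|n hn]; last first.
    by apply: hr; rewrite mem_cat hn.
  rewrite IH ?all_cat; first by rewrite !andbA; congr (_ && _); rewrite -!andbA; do !bool_congr.
    by move=> t ht; apply: h; rewrite inE ht orbT.
  by move=> n hn; apply: hr; rewrite mem_cat hn orbT.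
elim/tm_nested_ind: s r rho rho' =>
  //= [n|u s IH|s t IHs IHt|ss IH|u s t IHs IHt|u b g ss IH] r rho rho' h.
- by rewrite andbT.
- by rewrite (IH _ (ext u rho)); [rewrite fv_subst binds_up wt_up andbA|exact: ext_up].
- have hs : {in fv s, forall n, ty_of rho' (r n) = rho n}.
    by move=> n hn; apply: h; rewrite mem_cat hn.
  have ht : {in fv t, forall n, ty_of rho' (r n) = rho n}.
    by move=> n hn; apply: h; rewrite mem_cat hn orbT.
  rewrite (IHs _ rho) // (IHt _ rho) // (ty_subst hs) (ty_subst ht) all_cat.
  by rewrite -!andbA; do !bool_congr.
- exact: hfl.
- have hs : {in lower (size u) (fv s), forall n, ty_of rho' (r n) = rho n}.
    by move=> n hn; apply: h; rewrite mem_cat hn orbT.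
  have ht : {in fv t, forall n, ty_of rho' (r n) = rho n}.
    by move=> n hn; apply: h; rewrite mem_cat hn.
  rewrite (IHt _ rho) // (IHs _ (ext u rho)); last exact: ext_up.
  rewrite (ty_subst ht) all_cat fv_subst binds_up wt_up.
  by rewrite -!andbA; do !bool_congr.
- rewrite (hfl _ rho) // -map_comp.
  have -> : map (ty_of rho' \o subst r) ss = map (ty_of rho) ss.
    apply/eq_in_map => s hs; apply: ty_subst => n hn; apply: h.
    by apply/flatten_mapP; exists s.
  by rewrite -!andbA; congr (_ && _); rewrite andbC.
Qed.

Lemma eq_in_ty rho rho' s : {in fv s, rho =1 rho'} -> ty_of rho s = ty_of rho' s.
Proof. by move=> h; rewrite -{1}(subst_Var s); apply: ty_subst. Qed.

Lemma eq_in_wt rho rho' s : {in fv s, rho =1 rho'} -> wt rho s = wt rho' s.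
Proof. by move=> h; rewrite -{1}(subst_Var s) (@wt_subst rho' rho (@Var H) s h) all_predT andbT. Qed.

End Syntax.
Arguments fv {H} s.

(** * Typing derivations versus synthesised types and linearity *)

Section Typing.
Variable H : autonomous_signature.
Notation type := (type H).
Notation context := (context H).
Implicit Types (s t : tm H) (ss : seq (tm H)) (u : seq type) (rho : nat -> type).

Definition ctx_on rho (l : seq nat) : context := [seq (n, rho n) | n <- l].

Lemma unzip1_ctx_on rho l : unzip1 (ctx_on rho l) = l.
Proof. by rewrite /unzip1 -map_comp map_id. Qed.

Lemma ctx_on_cat rho l l' : ctx_on rho (l ++ l') = ctx_on rho l ++ ctx_on rho l'.
Proof. exact: map_cat. Qed.

Lemma ctx_of_on rho u : ctx_of u = ctx_on (ext u rho) (iota 0 (size u)).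
Proof.
apply: (@eq_from_nth _ (0, Tens [::])); rewrite ?size_zip ?size_map ?size_iota minnn // => i hi.
rewrite nth_zip ?size_iota // (nth_map 0) ?size_iota // nth_iota //.
by rewrite (ext_lt _ (Tens [::])).
Qed.

Lemma lift_ctx_on rho u l : lift (size u) (ctx_on rho l) = ctx_on (ext u rho) (map (addn (size u)) l).
Proof. by rewrite /lift /ctx_on -!map_comp; apply: eq_map => n /=; rewrite ext_ge. Qed.

Definition agrees rho (c : context) : Prop := c = ctx_on rho (unzip1 c).

Lemma agrees_cat rho c d : agrees rho (c ++ d) <-> agrees rho c /\ agrees rho d.
Proof.
rewrite /agrees {1}/unzip1 map_cat ctx_on_cat; split=> [/eqP|[<- <-]] //.
by rewrite eqseq_cat ?size_map // => /andP[/eqP h1 /eqP h2].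
Qed.

Lemma agrees_perm rho c d : Permutation c d -> agrees rho c -> agrees rho d.
Proof.
rewrite /agrees; elim=> //= [[i a] l l' _ IH|[i a] [j b] l|l l' l'' _ h _ h'].
- by case=> <- /IH {1}->.
- by case=> <- <- {1}->.
- by move/h/h'.
Qed.

Lemma agrees_ext rho u c : agrees rho c -> agrees (ext u rho) (lift (size u) c ++ ctx_of u).
Proof.
move=> h; apply/agrees_cat; split; last by rewrite /agrees unzip1_ctx_of -ctx_of_on.
by rewrite h lift_ctx_on /agrees unzip1_ctx_on.
Qed.

Lemma perm_eq_Permutation (l l' : seq nat) : perm_eq l l' -> Permutation l l'.
Proof.
elim: l l' => [|i l IH] r hr; first by move/perm_size: hr => /esym/size0nil ->.
have ir : i \in r by rewrite -(perm_mem hr) mem_head.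
case/splitPr: ir hr => r1 r2.
rewrite -cat1s perm_sym -cat1s perm_catCA perm_cons perm_sym => /IH h.
exact: Permutation_cons_app.
Qed.

Lemma binds_ctx k (l m : seq nat) : perm_eq l (map (addn k) m ++ iota 0 k) ->
  binds k l /\ perm_eq (lower k l) m.
Proof.
move=> h; split.
  rewrite (binds_perm _ h); apply/allP => i; rewrite mem_iota /= => hi.
  rewrite count_cat (count_uniq_mem _ (iota_uniq 0 k)) mem_iota hi /= addn1 eqSS.
  rewrite (count_memPn _) //; apply/mapP => -[j _ e].
  by move: hi; rewrite e ltnNge leq_addr.
apply: perm_trans (lower_perm k h) _; rewrite lower_cat lower_addn.
have -> : lower k (iota 0 k) = [::]; last by rewrite cats0.
case e: (lower k (iota 0 k)) => [|i r] //.
have: i \in lower k (iota 0 k) by rewrite e mem_head.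
by rewrite mem_lower mem_iota add0n /= ltnNge leq_addr.
Qed.

(** A shuffle enters only through its underlying permutation: the free variables are claimed only up
    to order, and an environment that agrees with a context agrees with every rearrangement of
    it. *)
Lemma typed_sound_mut :
  (forall c s a, typed c s a ->
    [/\ uniq (unzip1 c), perm_eq (fv s) (unzip1 c) &
     forall rho, agrees rho c -> wt rho s /\ ty_of rho s = a]) /\
  (forall cs ss u, typeds cs ss u ->
    perm_eq (flatten (map fv ss)) (unzip1 (flatten cs)) /\
    forall rho, agrees rho (flatten cs) -> all (wt rho) ss /\ map (ty_of rho) ss = u).
Proof.
apply: typed_typeds_ind => /=.
- by move=> x a; split=> // rho; rewrite /agrees /= => -[].
- move=> cs ss u d hu _ [IH1 IH2] /shu_Permutation hs; have hp := Permutation_vars hs.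
  split; first by rewrite -(perm_uniq hp).
    exact: perm_trans hp.
  by move=> rho /(agrees_perm (Permutation_sym hs))/IH2[-> ->].
- move=> c u s b _ [IH1 IH2 IH3].
  move: IH1 IH2; rewrite /unzip1 map_cat -!/(unzip1 _) unzip1_lift unzip1_ctx_of.
  rewrite cat_uniq (map_inj_uniq (@addnI _)) => /and3P[hu _ _] /binds_ctx[h1 h2].
  by split=> // rho /(agrees_ext u)/IH3[hw <-]; rewrite h1.
- move=> c d s t u b e hu _ [_ IHs2 IHs3] _ [_ IHt2 IHt3] /shu_Permutation /=.
  rewrite cats0 => hs; have hp := Permutation_vars hs; split.
  + by rewrite -(perm_uniq hp).
  + by apply: perm_trans hp; rewrite /unzip1 map_cat perm_cat.
  + move=> rho /(agrees_perm (Permutation_sym hs))/agrees_cat[/IHs3[-> ->] /IHt3[-> ->]].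
    by rewrite eqxx.
- move=> c d1 d2 s t u b e hu _ [_ IHs2 IHs3] _ [_ IHt2 IHt3] /shu_Permutation /=.
  rewrite cats0 => hs; have hp := Permutation_vars hs.
  have hq : Permutation (lift (size u) d1 ++ ctx_of u ++ lift (size u) d2)
      (lift (size u) (d1 ++ d2) ++ ctx_of u).
    by rewrite /lift map_cat -catA; apply: Permutation_app_head; exact: Permutation_app_comm.
  have : perm_eq (fv t) (map (addn (size u)) (unzip1 (d1 ++ d2)) ++ iota 0 (size u)).
    apply: perm_trans IHt2 _; apply: perm_trans (Permutation_vars hq) _.
    by rewrite /unzip1 map_cat -!/(unzip1 _) unzip1_lift unzip1_ctx_of.
  case/binds_ctx=> h1 h2; split.
  + by rewrite -(perm_uniq hp).
  + by apply: perm_trans hp; rewrite /unzip1 map_cat perm_cat.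
  + move=> rho /(agrees_perm (Permutation_sym hs))/agrees_cat[/IHs3[-> ->] hd].
    have [|-> ->] := IHt3 (ext u rho); last by rewrite eqxx h1.
    by apply: agrees_perm (Permutation_sym hq) _; exact: agrees_ext.
- move=> u b f cs ss d hu _ [IH1 IH2] /shu_Permutation hs; have hp := Permutation_vars hs.
  split; first by rewrite -(perm_uniq hp).
    exact: perm_trans hp.
  by move=> rho /(agrees_perm (Permutation_sym hs))/IH2[-> ->]; rewrite eqxx.
- by split.
- move=> c s a cs ss u _ [_ IH2 IH3] _ [IHs1 IHs2]; split.
    by rewrite /unzip1 map_cat perm_cat.
  by move=> rho /agrees_cat[/IH3[-> ->] /IHs2[-> ->]].
Qed.

Lemma typed_perm rho l l' s a : typed (ctx_on rho l) s a -> perm_eq l l' ->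
  typed (ctx_on rho l') s a.
Proof. by move=> hs hp; apply: exchange hs (Permutation_map _ _); exact: perm_eq_Permutation. Qed.

(** By exchange the context may be taken in the order of [fv s]; there the contexts of the premises
    are consecutive blocks, and the trivial shuffle is enough. *)
Lemma typed_complete rho s l :
  wt rho s -> uniq l -> perm_eq (fv s) l -> typed (ctx_on rho l) s (ty_of rho s).
Proof.
elim/tm_nested_ind: s rho l => [n|u s IH|s t IHs IHt|ss IH|u s t IHs IHt|u b f ss IH] rho l hw hu hp;
  have hu' := hu; rewrite -(perm_uniq hp) in hu';
  apply: (typed_perm _ hp); move: hw hu' => {hu hp} /=.
- by move=> _ _; exact: T_var.
- case/andP=> hb hw hu; apply: T_lam.
  rewrite lift_ctx_on (ctx_of_on rho) -ctx_on_cat.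
  have hp : perm_eq (fv s) (map (addn (size u)) (lower (size u) (fv s)) ++ iota 0 (size u)).
    by rewrite perm_sym perm_catC perm_lower.
  by apply: IH => //; rewrite -(perm_uniq hp) (uniq_lower hb).
- case/and3P=> hs ht; case e: (ty_of rho s) => [||v b] // /eqP et hu.
  have hu3 : uniq (unzip1 (flatten [:: ctx_on rho (fv s); ctx_on rho (fv t)])).
    by rewrite /= cats0 -ctx_on_cat unzip1_ctx_on.
  have := shu_flatten hu3; rewrite ctx_on_cat /= cats0.
  move: (hu); rewrite cat_uniq => /and3P[hus _ hut].
  apply: (@T_app _ _ _ _ _ v); first by rewrite -ctx_on_cat unzip1_ctx_on.
    by rewrite -e; exact: IHs.
  by rewrite -et; exact: IHt.
- move=> hw hu; have e : ctx_on rho (flatten (map fv ss)) = flatten [seq ctx_on rho (fv s) | s <- ss].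
    by rewrite /ctx_on map_flatten -map_comp.
  have hu' := hu; rewrite -(unzip1_ctx_on rho (flatten _)) e in hu'.
  rewrite e; apply: T_tup (hu') _ (shu_flatten hu').
  elim: ss IH hw hu {e hu'} => [|s ss IHss] IH /=; first by move=> _ _; exact: Ts_nil.
  case/andP=> hs hw; rewrite cat_uniq => /and3P[h1 _ h2]; apply: Ts_cons.
    by apply: IH => //; rewrite mem_head.
  by apply: IHss => // x hx; apply: IH; rewrite inE hx orbT.
- case/and4P=> ht /eqP et hb hs hu.
  (* Of the two contexts that surround the bound variables in [T_let], the right one is taken
     empty. *)
  have hu3 : uniq (unzip1 (flatten [:: ctx_on rho (fv t); ctx_on rho (lower (size u) (fv s)); [::]])).
    by rewrite /= !cats0 -ctx_on_cat unzip1_ctx_on.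
  have := shu_flatten hu3; rewrite ctx_on_cat /= !cats0.
  move: (hu); rewrite cat_uniq => /and3P[hut _ hus].
  apply: T_let.
  + by rewrite cats0 -ctx_on_cat unzip1_ctx_on.
  + by rewrite -et; exact: IHt.
  + rewrite cats0 lift_ctx_on (ctx_of_on rho) -ctx_on_cat.
    have hp : perm_eq (fv s) (map (addn (size u)) (lower (size u) (fv s)) ++ iota 0 (size u)).
      by rewrite perm_sym perm_catC perm_lower.
    by apply: IHs => //; rewrite -(perm_uniq hp) (uniq_lower hb).
- case/andP=> hw /eqP hty hu.
  have e : ctx_on rho (flatten (map fv ss)) = flatten [seq ctx_on rho (fv s) | s <- ss].
    by rewrite /ctx_on map_flatten -map_comp.
  have hu' := hu; rewrite -(unzip1_ctx_on rho (flatten _)) e in hu'.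
  rewrite e; apply: T_op (hu') _ (shu_flatten hu'); rewrite -hty.
  elim: ss IH hw hu {e hu' hty} => [|s ss IHss] IH /=; first by move=> _ _; exact: Ts_nil.
  case/andP=> hs hw; rewrite cat_uniq => /and3P[h1 _ h2]; apply: Ts_cons.
    by apply: IH => //; rewrite mem_head.
  by apply: IHss => // x hx; apply: IH; rewrite inE hx orbT.
Qed.

(** This criterion replaces the inspection of derivations in what follows. *)
Lemma typedP rho l s a : uniq l ->
  typed (ctx_on rho l) s a <-> [/\ perm_eq (fv s) l, wt rho s & ty_of rho s = a].
Proof.
move=> hu; split=> [/(typed_sound_mut.1)[_]|[hp hw <-]]; last exact: typed_complete.
rewrite unzip1_ctx_on => hp /(_ rho)[|hw ht]; last by split.
by rewrite /agrees unzip1_ctx_on.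
Qed.

End Typing.

(** * Interchange laws and the application arrow *)

Section MoreArrows.
Variable S : autonomous_multicategory.
Notation arrow := (arrow S).
Notation aids := (map (@aid S)).
Implicit Types (f g : arrow) (gs : seq arrow).

Lemma src_aids v : flatten (map (@src S) (aids v)) = v.
Proof. by elim: v => //= a v {2}<-. Qed.

Lemma tgt_aids v : map (@tgt S) (aids v) = v.
Proof. by rewrite -map_comp map_id. Qed.

(** Interchange: acting on the first slot before the others amounts to one composition. It is
    associativity with an identity placed below each member of [gs]; [acomp_id_cons] is the law for
    the opposite order. *)
Lemma acomp_cons_ids f g G gs : src f = tgt g :: map (@tgt S) gs -> map (@tgt S) G = src g ->
  acomp (acomp f (g :: aids (map (@tgt S) gs))) (G ++ gs) = acomp f (acomp g G :: gs).
Proof.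
move=> hf hg; pose l := (g, G) :: [seq (aid (tgt x), [:: x]) | x <- gs].
have e1 : map fst l = g :: aids (map (@tgt S) gs) by rewrite /= -!map_comp.
have e2 : flatten (map snd l) = G ++ gs.
  by rewrite /= -map_comp; congr (_ ++ _); elim: (gs) => //= x ys ->.
have e3 : [seq acomp x.1 x.2 | x <- l] = acomp g G :: gs.
  rewrite /= -map_comp; congr (_ :: _); elim: (gs) => //= x ys ->.
  by rewrite aid_acomp.
rewrite -e1 -e2 -e3; apply: acompA => [|x]; first by rewrite (map_comp (@tgt S) fst) e1 /= tgt_aids.
by rewrite inE => /predU1P[->|/mapP[y _ ->]].
Qed.

Lemma acomp_id_cons f a g gs : src f = a :: map (@tgt S) gs -> tgt g = a ->
  acomp (acomp f (aid a :: gs)) (g :: aids (flatten (map (@src S) gs))) = acomp f (g :: gs).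
Proof.
move=> hf e; subst a; pose l := (aid (tgt g), [:: g]) :: [seq (x, aids (src x)) | x <- gs].
have e1 : map fst l = aid (tgt g) :: gs by rewrite /= -map_comp map_id.
have e2 : flatten (map snd l) = g :: aids (flatten (map (@src S) gs)).
  by rewrite /= -map_comp map_flatten -map_comp.
have e3 : [seq acomp x.1 x.2 | x <- l] = g :: gs.
  rewrite /= aid_acomp -map_comp; congr (_ :: _); elim: (gs) => //= x ys ->.
  by rewrite acomp_aid.
rewrite -e1 -e2 -e3; apply: acompA => [|x].
  by rewrite (map_comp (@tgt S) fst) e1 /= hf.
by rewrite inE => /predU1P[->|/mapP[y _ ->]] //=; rewrite tgt_aids.
Qed.

(** The arrow from $u \multimap b$ and $\bigotimes u$ to $b$: [ev] takes the arguments one by one,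
    and representability gathers them into a single one of tensor type. *)
Definition aapp (u : seq (ob S)) b : arrow := unrep [:: limp S u b] u [::] (aev u b).

Lemma aapp_fit u b : src (aapp u b) = [:: limp S u b; tens S u] /\ tgt (aapp u b) = b.
Proof.
by rewrite /aapp; have [|-> -> _] := @unrepP S [:: limp S u b] u [::] (aev u b); rewrite //= cats0.
Qed.

Lemma aapp_re u b g gs : tgt g = limp S u b -> map (@tgt S) gs = u ->
  acomp (aapp u b) [:: g; acomp (are u) gs] = acomp (aev u b) (g :: gs).
Proof.
move=> hg hgs; have [|_ _] := @unrepP S [:: limp S u b] u [::] (aev u b).
  by rewrite /= cats0.
rewrite -/(aapp u b) /= => <-; rewrite -hg.
pose l := [:: (aid (tgt g), [:: g]); (are u, gs)].
have := @acompA S _ (aapp u b) l (fun x => x.1) (fun x => x.2); rewrite /= cats0 aid_acomp.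
rewrite ?cats0 => ->.
- by [].
- by rewrite (aapp_fit u b).1 -hg.
- by move=> x; rewrite !inE => /orP[] /eqP ->.
Qed.

End MoreArrows.

Lemma uniq_map_inj (T1 T2 : eqType) (f : T1 -> T2) (s : seq T1) :
  uniq (map f s) -> {in s &, injective f}.
Proof.
elim: s => //= x s IH /andP[hx hu] a b; rewrite !inE.
case/predU1P=> [->|ha]; case/predU1P=> [->|hb] // e; last exact: IH.
  by case/mapP: hx; exists b.
by case/mapP: hx; exists a.
Qed.

(** * Interpretation of terms *)

Section Semantics.
Variables (H : autonomous_signature) (S : autonomous_multicategory) (i : signature_map H S).
Notation type := (type H).
Notation arrow := (arrow S).
Notation aids := (map (@aid S)).
Implicit Types (s t : tm H) (ss : seq (tm H)) (u : seq type) (rho : nat -> type).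

Definition obs rho (l : seq nat) : seq (ob S) := [seq i (rho n) | n <- l].

(** Closedness abstracts over the last sources, so [Lam] puts the bound variables at the end
    ([last_bound]). [Let] puts them at the front ([first_bound]), so that the tensor they are
    gathered into is the first slot, which receives the bound term. *)
Definition last_bound (k : nat) (l : seq nat) : seq nat := map (addn k) (lower k l) ++ iota 0 k.
Definition first_bound (k : nat) (l : seq nat) : seq nat := iota 0 k ++ map (addn k) (lower k l).

(* The arrow denoted by [s], with sources listed in the order of [fv s] *)
Fixpoint sem rho s : arrow :=
  match s with
  | Var n => aid (i (rho n))
  | Lam u s => curry (obs rho (lower (size u) (fv s))) (map i u)
      (reo (fv s) (last_bound (size u) (fv s)) (sem (ext u rho) s))
  | App s t => if ty_of rho s is Limp u b
      then acomp (aapp (map i u) (i b)) [:: sem rho s; sem rho t] else sem rho s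
  | Tup ss => acomp (are [seq i (ty_of rho s) | s <- ss]) (map (sem rho) ss)
  | Let u s t =>
      let v := obs rho (lower (size u) (fv s)) in
      acomp (unrep [::] (map i u) v
               (reo (fv s) (first_bound (size u) (fv s)) (sem (ext u rho) s)))
            (sem rho t :: aids v)
  | Op u b f ss => acomp (Ar (iarr i f)) (map (sem rho) ss)
  end.

Lemma obs_map rho f l : obs rho (map f l) = obs (rho \o f) l.
Proof. by rewrite /obs -map_comp. Qed.

Lemma obs_iota rho u : obs (ext u rho) (iota 0 (size u)) = map i u.
Proof.
apply: (@eq_from_nth _ (i (Tens [::]))); rewrite !size_map size_iota // => n hn.
rewrite (nth_map 0) ?size_iota // (nth_map (Tens [::])) // nth_iota //.
by rewrite (ext_lt _ (Tens [::])).
Qed.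

Lemma obs_last rho u l : obs (ext u rho) (last_bound (size u) l) =
  obs rho (lower (size u) l) ++ map i u.
Proof. by rewrite -(obs_iota rho u) {1}/obs map_cat -!/(obs _ _) obs_map ext_addn. Qed.

Lemma obs_first rho u l : obs (ext u rho) (first_bound (size u) l) =
  map i u ++ obs rho (lower (size u) l).
Proof. by rewrite -(obs_iota rho u) {1}/obs map_cat -!/(obs _ _) obs_map ext_addn. Qed.

Lemma perm_first k l : binds k l -> perm_eq l (first_bound k l).
Proof. by move=> h; rewrite perm_sym perm_lower. Qed.

Lemma perm_last k l : binds k l -> perm_eq l (last_bound k l).
Proof. by move=> h; rewrite perm_sym perm_catC perm_lower. Qed.

Lemma sem_fit rho s : wt rho s -> uniq (fv s) ->
  src (sem rho s) = obs rho (fv s) /\ tgt (sem rho s) = i (ty_of rho s).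
Proof.
have hl ss rh : {in ss, forall s rho, wt rho s -> uniq (fv s) ->
    src (sem rho s) = obs rho (fv s) /\ tgt (sem rho s) = i (ty_of rho s)} ->
    all (wt rh) ss -> uniq (flatten (map fv ss)) ->
    flatten (map (@src S) (map (sem rh) ss)) = obs rh (flatten (map fv ss)) /\
    map (@tgt S) (map (sem rh) ss) = [seq i (ty_of rh x) | x <- ss].
  elim: ss => //= x ss IH h /andP[hx hw]; rewrite cat_uniq => /and3P[h1 _ h2].
  have [-> ->] := h x (mem_head _ _) _ hx h1; have [|-> ->] := IH _ hw h2.
    by move=> y hy; apply: h; rewrite inE hy orbT.
  by rewrite /obs map_cat.
elim/tm_nested_ind: s rho => [n|u s IH|s t IHs IHt|ss IH|u s t IHs IHt|u b f ss IH] rho //=.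
- case/andP=> hb hw hu; have hu' := uniq_lower hb hu; have [h1 h2] := IH _ hw hu'.
  have [|-> -> _] := @curryP S (obs rho (lower (size u) (fv s))) (map i u)
      (reo (fv s) (last_bound (size u) (fv s)) (sem (ext u rho) s)).
    by rewrite (src_reo hu' (perm_last hb) h1) -/(obs _ _) obs_last.
  by rewrite tgt_reo h2 i_limp.
- case/and3P=> hs ht; case e: (ty_of rho s) => [||v b] // /eqP et.
  rewrite cat_uniq => /and3P[h1 _ h2].
  have [s1 s2] := IHs _ hs h1; have [t1 t2] := IHt _ ht h2; have [a1 a2] := aapp_fit (map i v) (i b).
  rewrite tgt_acomp src_acomp /= ?a1 ?a2 ?s2 ?t2 ?e ?et ?i_limp ?i_tens //.
  by rewrite s1 t1 cats0 /obs map_cat.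
- move=> hw hu; have [h1 h2] := hl _ _ IH hw hu.
  rewrite tgt_acomp src_acomp; last exact: h2.
  by split; [exact: h1|rewrite i_tens -map_comp].
- case/and4P=> ht /eqP et hb hs; rewrite cat_uniq => /and3P[h1 _ h2].
  have hu' := uniq_lower hb h2; have [s1 s2] := IHs _ hs hu'; have [t1 t2] := IHt _ ht h1.
  have [|e1 e2 _] := @unrepP S [::] (map i u) (obs rho (lower (size u) (fv s)))
      (reo (fv s) (first_bound (size u) (fv s)) (sem (ext u rho) s)).
    by rewrite (src_reo hu' (perm_first hb) s1) -/(obs _ _) obs_first.
  rewrite tgt_acomp src_acomp /= ?e1 ?e2 ?tgt_reo ?tgt_aids ?t2 ?et ?i_tens //.
  by rewrite src_aids t1 s2 /obs map_cat.
- case/andP=> hw /eqP hty hu; have [h1 h2] := hl _ _ IH hw hu.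
  rewrite tgt_acomp src_acomp; last by apply: (etrans h2); rewrite /src /= -hty -map_comp.
  by split; [exact: h1|].
Qed.

Lemma src_sem rho s : wt rho s -> uniq (fv s) -> src (sem rho s) = obs rho (fv s).
Proof. by move=> hw /(sem_fit hw)[]. Qed.

Lemma tgt_sem rho s : wt rho s -> uniq (fv s) -> tgt (sem rho s) = i (ty_of rho s).
Proof. by move=> hw /(sem_fit hw)[]. Qed.

Lemma size_src_sem rho s : wt rho s -> uniq (fv s) -> size (src (sem rho s)) = size (fv s).
Proof. by move=> hw hu; rewrite src_sem // size_map. Qed.

Lemma last_bound_upren k f l : last_bound k (map (upren k f) l) = map (upren k f) (last_bound k l).
Proof.
rewrite /last_bound lower_upren map_cat -!map_comp; congr (_ ++ _).
  by apply: eq_map => n /=; rewrite /upren ltnNge leq_addr /= addKn.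
by rewrite -[LHS]map_id; apply/eq_in_map => n; rewrite mem_iota /upren /= => ->.
Qed.

Lemma first_bound_upren k f l : first_bound k (map (upren k f) l) = map (upren k f) (first_bound k l).
Proof.
rewrite /first_bound lower_upren map_cat -!map_comp; congr (_ ++ _).
  by rewrite -[LHS]map_id; apply/eq_in_map => n; rewrite mem_iota /upren /= => ->.
by apply: eq_map => n /=; rewrite /upren ltnNge leq_addr /= addKn.
Qed.

(** Renaming keeps the order of occurrences, so the arrow is the same without any reordering.
    Distinctness of the new names lets the reorderings below binders be renamed too. *)
Lemma sem_ren rho f s : wt (rho \o f) s -> uniq (map f (fv s)) ->
  sem rho (ren f s) = sem (rho \o f) s.
Proof.
have hl ss g rh : {in ss, forall s f rho, wt (rho \o f) s -> uniq (map f (fv s)) ->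
    sem rho (ren f s) = sem (rho \o f) s} ->
    all (wt (rh \o g)) ss -> uniq (map g (flatten (map fv ss))) ->
    map (sem rh) (map (ren g) ss) = map (sem (rh \o g)) ss.
  elim: ss => //= x ss IH h /andP[hx hw]; rewrite map_cat cat_uniq => /and3P[h1 _ h2].
  rewrite h ?mem_head // IH // => y hy; by apply: h; rewrite inE hy orbT.
elim/tm_nested_ind: s f rho => [n|u s IH|s t IHs IHt|ss IH|u s t IHs IHt|u b g ss IH] f rho //=.
- case/andP=> hb hw hu; rewrite -ext_upren in hw.
  have hu' : uniq (map (upren (size u) f) (fv s)).
    by apply: (@uniq_lower (size u)); rewrite ?binds_upren // lower_upren.
  rewrite IH // fv_ren lower_upren last_bound_upren reo_map ?obs_map ?ext_upren //.
    exact: uniq_map_inj.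
  by move=> x; rewrite (perm_mem (perm_last hb)).
- case/and3P=> hs ht; rewrite ty_ren; case e: (ty_of _ s) => [||v b] // /eqP et.
  by rewrite map_cat cat_uniq => /and3P[h1 _ h2]; rewrite IHs // IHt.
- move=> hw hu; rewrite hl // -map_comp; congr (acomp (are _) _).
  by apply: eq_map => x /=; rewrite ty_ren.
- case/and4P=> ht /eqP et hb hw; rewrite map_cat cat_uniq => /and3P[h1 _ hu].
  rewrite -ext_upren in hw.
  have hu' : uniq (map (upren (size u) f) (fv s)).
    by apply: (@uniq_lower (size u)); rewrite ?binds_upren // lower_upren.
  rewrite IHs // IHt // fv_ren lower_upren first_bound_upren reo_map ?obs_map ?ext_upren //.
    exact: uniq_map_inj.
  by move=> x; rewrite (perm_mem (perm_first hb)).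
- by case/andP=> hw _ hu; rewrite hl.
Qed.

End Semantics.

(** * Substitution is interpreted as composition *)

Section SemSubst.
Variables (H : autonomous_signature) (S : autonomous_multicategory) (i : signature_map H S).
Notation type := (type H).
Notation arrow := (arrow S).
Notation aids := (map (@aid S)).
Notation sem := (sem i).
Implicit Types (s t : tm H) (ss : seq (tm H)) (u : seq type) (rho : nat -> type)
  (r : nat -> tm H).

Lemma last_bound_up k r l : flatten [seq fv (up k r n) | n <- last_bound k l] =
  last_bound k (flatten [seq fv (up k r n) | n <- l]).
Proof.
rewrite /last_bound lower_up map_cat flatten_cat -map_comp map_flatten -map_comp; congr (_ ++ _).
  congr flatten; apply: eq_map => n /=.
  by rewrite /up ltnNge leq_addr /= addKn fv_ren.
rewrite -[RHS]flatten_singles; congr flatten; apply/eq_in_map => n.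
by rewrite mem_iota /up /= => ->.
Qed.

Lemma first_bound_up k r l : flatten [seq fv (up k r n) | n <- first_bound k l] =
  first_bound k (flatten [seq fv (up k r n) | n <- l]).
Proof.
have := last_bound_up k r l.
rewrite /last_bound /first_bound !map_cat !flatten_cat => /eqP.
rewrite eqseq_cat => [/andP[/eqP-> /eqP->] //|].
rewrite lower_up -map_comp size_flatten size_map size_flatten /shape -!map_comp.
congr sumn; apply: eq_map => n /=.
by rewrite /up ltnNge leq_addr /= addKn fv_ren size_map.
Qed.

(** What makes the arrows [sem rho' (r n)] composable with an arrow whose sources are named by [l],
    and the composite the meaning of a linear term. *)
Definition fits rho rho' r (l : seq nat) : Prop :=
  [/\ {in l, forall n, ty_of rho' (r n) = rho n}, all (fun n => wt rho' (r n)) l &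
      uniq (flatten [seq fv (r n) | n <- l])].

Lemma fits_cat rho rho' r l l' : fits rho rho' r (l ++ l') ->
  fits rho rho' r l /\ fits rho rho' r l'.
Proof.
case=> h1; rewrite all_cat map_cat flatten_cat cat_uniq => /andP[h2 h3] /and3P[h4 _ h5].
by split; split=> // n hn; apply: h1; rewrite mem_cat hn ?orbT.
Qed.

Lemma fits_flatten (T : eqType) rho rho' r (F : T -> seq nat) (l : seq T) :
  fits rho rho' r (flatten (map F l)) -> {in l, forall x, fits rho rho' r (F x)}.
Proof.
elim: l => //= x l IH h; have [h1 h2] := fits_cat h => y.
by rewrite inE => /predU1P[->|]; [exact: h1|exact: IH].
Qed.

Lemma fits_up rho rho' r u l : fits rho rho' r (lower (size u) l) -> binds (size u) l ->
  fits (ext u rho) (ext u rho') (up (size u) r) l.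
Proof.
case=> h1 h2 h3 hb; split; [exact: ext_up|by rewrite wt_up|].
by apply: (@uniq_lower (size u)); rewrite ?binds_up ?lower_up.
Qed.

Lemma fits1 rho rho' r l n : fits rho rho' r l -> n \in l ->
  [/\ ty_of rho' (r n) = rho n, wt rho' (r n) & uniq (fv (r n))].
Proof.
case=> h1 h2 h3 hn; split; [exact: h1|exact: (allP h2)|].
elim: l hn h3 {h1 h2} => //= m l IH; rewrite inE cat_uniq.
by case/predU1P=> [->|/IH h] /and3P[h1 _ /=]; [|exact: h].
Qed.

Lemma fits_tgt rho rho' r l : fits rho rho' r l ->
  map (@tgt S) [seq sem rho' (r n) | n <- l] = obs i rho l.
Proof.
move=> h; rewrite -map_comp; apply/eq_in_map => n /(fits1 h)[h1 h2 h3] /=.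
by rewrite tgt_sem // h1.
Qed.

Lemma fits_src rho rho' r l : fits rho rho' r l ->
  flatten (map (@src S) [seq sem rho' (r n) | n <- l]) =
  obs i rho' (flatten [seq fv (r n) | n <- l]).
Proof.
move=> h; rewrite {1}/obs map_flatten -!map_comp; congr flatten.
by apply/eq_in_map => n /(fits1 h)[h1 h2 h3] /=; rewrite src_sem.
Qed.

Lemma sem_up_addn rho rho' r u l : fits rho rho' r (lower (size u) l) ->
  [seq sem (ext u rho') (up (size u) r n) | n <- map (addn (size u)) (lower (size u) l)] =
  [seq sem rho' (r n) | n <- lower (size u) l].
Proof.
move=> h; rewrite -map_comp; apply/eq_in_map => n /(fits1 h)[_ h2 h3] /=.
rewrite /up ltnNge leq_addr /= addKn sem_ren; rewrite ?ext_addn //.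
by rewrite (map_inj_uniq (@addnI _)).
Qed.

Lemma sem_up_iota rho r u :
  [seq sem (ext u rho) (up (size u) r n) | n <- iota 0 (size u)] = aids (map i u).
Proof.
rewrite -(obs_iota i rho u) -map_comp; apply/eq_in_map => n.
by rewrite mem_iota /up /= => ->.
Qed.

(** By [fv_subst] the sources of both sides come in the same order. At a binder the body is composed
    with identities on the bound variables, the reordering is moved through this composite by
    [acomp_reol], and interchange shows that the right-hand side solves the universal problem that
    defines the left-hand side. *)
Lemma sem_subst rho rho' r s : wt rho s -> uniq (fv s) -> fits rho rho' r (fv s) ->
  sem rho' (subst r s) = acomp (sem rho s) [seq sem rho' (r n) | n <- fv s].
Proof.
have hl ss F rh rh' p : {in ss, forall s rho rho' r, wt rho s -> uniq (fv s) ->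
      fits rho rho' r (fv s) ->
      sem rho' (subst r s) = acomp (sem rho s) [seq sem rho' (r n) | n <- fv s]} ->
    all (wt rh) ss -> uniq (flatten (map fv ss)) -> fits rh rh' p (flatten (map fv ss)) ->
    src F = [seq i (ty_of rh x) | x <- ss] ->
    acomp F (map (sem rh') (map (subst p) ss)) =
    acomp (acomp F (map (sem rh) ss)) [seq sem rh' (p n) | n <- flatten (map fv ss)].
  move=> IH /allP hw hu hf hF; rewrite map_flatten -(map_comp _ fv).
  have hux : {in ss, forall x, uniq (fv x)}.
    elim: (ss) hu => //= x l IHl; rewrite cat_uniq => /and3P[h1 _ h2] y.
    by rewrite inE => /predU1P[->|]; [|exact: IHl].
  rewrite acompA.
  - congr acomp; rewrite -map_comp; apply/eq_in_map => x hx /=.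
    by apply: IH; [|exact: hw|exact: hux|exact: (fits_flatten hf hx)].
  - rewrite hF; apply/eq_in_map => x hx; apply: tgt_sem; [exact: hw|exact: hux].
  - move=> x hx /=; rewrite src_sem; [|exact: hw|exact: hux].
    exact: fits_tgt (fits_flatten hf hx).
elim/tm_nested_ind: s rho rho' r =>
  [n|u s IH|s t IHs IHt|ss IH|u s t IHs IHt|u b f ss IH] rho rho' r /=.
- move=> _ _ /fits1/(_ (mem_head _ _))[h1 h2 h3].
  by rewrite -h1 -tgt_sem // aid_acomp.
- case/andP=> hb hw hu hf; have hu' := uniq_lower hb hu; have hf' := fits_up hf hb.
  set b := reo (fv s) _ _.
  have sb : src b = obs i rho (lower (size u) (fv s)) ++ map i u.
    by rewrite (src_reo (h := i \o ext u rho) hu' (perm_last hb)) ?src_sem // -obs_last.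
  have [c1 c2 c3] := curryP sb.
  (* The arrow to be curried on the substituted side is the original one, composed with the values
     of [r] on the outer variables and with identities on the bound ones. *)
  have e' : reo (fv (subst (up (size u) r) s)) (last_bound (size u) (fv (subst (up (size u) r) s)))
        (sem (ext u rho') (subst (up (size u) r) s)) =
      acomp b ([seq sem rho' (r n) | n <- lower (size u) (fv s)] ++ aids (map i u)).
    rewrite (IH (ext u rho)) // fv_subst -last_bound_up -acomp_reol //.
    + by rewrite map_cat (sem_up_addn hf) sem_up_iota.
    + exact: perm_last.
    + by case: hf'.
    + by move=> n /(fits1 hf')[h1 h2 h3]; rewrite size_src_sem.
    + have := fits_tgt hf'; rewrite -map_comp => ->; by rewrite src_sem.
  have tu : map (@tgt S) (aids (map i u)) = map i u by exact: tgt_aids.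
  have fs : map (@tgt S) [seq sem rho' (r n) | n <- lower (size u) (fv s)] =
      src (curry (obs i rho (lower (size u) (fv s))) (map i u) b) by rewrite (fits_tgt hf) // c1.
  have te : tgt (acomp b ([seq sem rho' (r n) | n <- lower (size u) (fv s)] ++ aids (map i u))) = tgt b.
    by rewrite tgt_acomp.
  rewrite e' fv_subst lower_up; apply: curry_uniq.
  + rewrite src_acomp; first by rewrite map_cat flatten_cat src_aids (fits_src hf).
    by rewrite map_cat tu (fits_tgt hf) // sb.
  + by rewrite src_acomp // (fits_src hf).
  + by rewrite tgt_acomp c2 te.
  + rewrite te.
    have := @acomp_cons_ids S (aev (map i u) (tgt b)) (curry _ _ b) _ (aids (map i u)) _ fs.
    by rewrite tu c3 => -> //; rewrite c2.
- case/and3P=> hs ht; case e: (ty_of rho s) => [||v b] // /eqP et hu hf.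
  have [hfs hft] := fits_cat hf.
  rewrite (ty_subst (rho := rho)); last by case: hfs.
  rewrite e; have := hl [:: s; t] (aapp (map i v) (i b)) rho rho' r; rewrite /= cats0; apply=> //.
  + by move=> x; rewrite !inE => /orP[]/eqP->; [exact: IHs|exact: IHt].
  + by rewrite hs ht.
  + by rewrite (aapp_fit _ _).1 e et i_limp i_tens.
- move=> hw hu hf.
  have -> : [seq i (ty_of rho' x) | x <- map (subst r) ss] = [seq i (ty_of rho x) | x <- ss].
    rewrite -map_comp; apply/eq_in_map => x hx /=; congr (i _); apply: ty_subst.
    by case: (fits_flatten hf hx).
  exact: hl.
- case/and4P=> ht /eqP et hb hw; rewrite cat_uniq => /and3P[h1 _ h2] /fits_cat[hft hf].
  have hu' := uniq_lower hb h2; have hf' := fits_up hf hb.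
  set b := reo (fv s) _ _; set G := [seq sem rho' (r n) | n <- lower (size u) (fv s)].
  have sb : src b = [::] ++ map i u ++ obs i rho (lower (size u) (fv s)).
    by rewrite (src_reo (h := i \o ext u rho) hu' (perm_first hb)) ?src_sem // -obs_first.
  have [c1 c2 c3] := unrepP sb; rewrite /= in c1 c3.
  have tG : map (@tgt S) G = obs i rho (lower (size u) (fv s)) by rewrite (fits_tgt hf).
  have e' : reo (fv (subst (up (size u) r) s)) (first_bound (size u) (fv (subst (up (size u) r) s)))
        (sem (ext u rho') (subst (up (size u) r) s)) =
      acomp b (aids (map i u) ++ G).
    rewrite (IHs (ext u rho)) // fv_subst -first_bound_up -acomp_reol //.
    + by rewrite map_cat (sem_up_addn hf) sem_up_iota.
    + exact: perm_first.
    + by case: hf'.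
    + by move=> n /(fits1 hf')[h3 h4 h5]; rewrite size_src_sem.
    + have := fits_tgt hf'; rewrite -map_comp => ->; by rewrite src_sem.
  have sG : flatten (map (@src S) G) = obs i rho' (flatten [seq fv (r n) | n <- lower (size u) (fv s)]).
    by rewrite (fits_src hf).
  (* [unrep] is natural in the other sources: composing them with [G] commutes with gathering the
     bound variables. *)
  have uE : unrep [::] (map i u) (flatten (map (@src S) G)) (acomp b (aids (map i u) ++ G)) =
      acomp (unrep [::] (map i u) (obs i rho (lower (size u) (fv s))) b)
        (aid (tens S (map i u)) :: G).
    apply: unrep_uniq.
    + by rewrite src_acomp ?map_cat ?flatten_cat ?src_aids // tgt_aids tG sb.
    + by rewrite src_acomp //= tG c1.
    + by rewrite !tgt_acomp c2.
    + rewrite /= acomp_id_cons ?tG ?c1 //.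
      have := @acomp_cons_ids S (unrep [::] (map i u) (obs i rho (lower (size u) (fv s))) b)
        (are (map i u)) (aids (map i u)) G.
      rewrite tG c3 => -> //; last exact: tgt_aids.
      by congr (acomp _ (_ :: _)); rewrite -[LHS](acomp_aid (are (map i u))).
  rewrite e' fv_subst lower_up -sG uE map_cat (IHt rho) //.
  rewrite acomp_id_cons ?tG ?c1 //; last by rewrite tgt_acomp tgt_sem // et i_tens.
  have := @acomp_cons_ids S (unrep [::] (map i u) (obs i rho (lower (size u) (fv s))) b)
    (sem rho t) [seq sem rho' (r n) | n <- fv t] G.
  rewrite tG => -> //; first by rewrite c1 tgt_sem // et i_tens.
  by rewrite (fits_tgt hft) src_sem.
- case/andP=> hw /eqP hty hu hf; apply: hl => //.
  by rewrite /src /= -hty -map_comp.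
Qed.

End SemSubst.

HB.instance Definition _ (S : autonomous_data) := gen_eqMixin (ob S).

(** * Comparison of denotations and its congruence rules *)

Section Congruence.
Variables (H : autonomous_signature) (S : autonomous_multicategory) (i : signature_map H S).
Notation type := (type H).
Notation arrow := (arrow S).
Notation aids := (map (@aid S)).
Notation sem := (sem i).
Implicit Types (s t : tm H) (ss : seq (tm H)) (u : seq type) (rho : nat -> type).

(** [t] may replace [s] wherever [s] is well typed and linear, with the denotations related by
    reordering the sources from their order of occurrence in [s] to that in [t]. The relation is
    directed, because undoing a contraction needs typing information that the contractum may not
    contain ([ge_let_tup]). *)
Definition le rho s t : Prop := wt rho s -> uniq (fv s) ->
  [/\ wt rho t, ty_of rho t = ty_of rho s, perm_eq (fv s) (fv t) &
      reo (fv s) (fv t) (sem rho s) = sem rho t].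

Lemma le_refl rho s : le rho s s.
Proof. by move=> hw hu; split=> //; rewrite reo_id // size_src_sem. Qed.

Lemma le_trans rho s t p : le rho s t -> le rho t p -> le rho s p.
Proof.
move=> h1 h2 hw hu; have [w1 t1 p1 e1] := h1 hw hu.
have hu' : uniq (fv t) by rewrite -(perm_uniq p1).
have [w2 t2 p2 e2] := h2 w1 hu'; split=> //; first by rewrite t2.
  exact: perm_trans p2.
by rewrite -e2 -e1 reo_comp // size_src_sem.
Qed.

Lemma acomp_reo_ids L L' M v (f g : arrow) :
  uniq (L ++ M) -> perm_eq L L' -> size (src g) = size L -> size M = size v ->
  src f = tgt g :: v ->
  acomp f (reo L L' g :: aids v) = reo (L ++ M) (L' ++ M) (acomp f (g :: aids v)).
Proof.
move=> hu hp hg hM hf.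
pose l := (L, L', g) :: [seq ([:: x.1], [:: x.1], aid x.2) | x <- zip M v].
have := @acomp_reor S _ l (fun x => x.1.1) (fun x => x.1.2) (fun x => x.2) f.
rewrite /= -!map_comp.
have eM : flatten [seq [:: x.1] | x <- zip M v] = M by rewrite flatten_map1 -/(unzip1 _) unzip1_zip ?hM.
have ev : [seq aid x.2 | x <- zip M v] = aids v.
  by rewrite (map_comp (@aid S) snd) -/(unzip2 _) unzip2_zip ?hM.
have er : [seq reo [:: x.1] [:: x.1] (aid x.2) | x <- zip M v] = aids v.
  by rewrite -ev; apply: eq_map => x; rewrite reo_id.
rewrite /comp /= in eM ev er *; rewrite eM ev er; apply=> //.
- by move=> x; rewrite inE => /predU1P[->|/mapP[y _ ->]].
- by move=> x; rewrite inE => /predU1P[->|/mapP[y _ ->]].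
- by rewrite hf; congr (_ :: _); rewrite -/(unzip2 _) unzip2_zip ?hM.
Qed.

Lemma le_list rho (ps : seq (tm H * tm H)) :
  {in ps, forall p, le rho p.1 p.2} ->
  all (wt rho) (map fst ps) -> uniq (flatten (map fv (map fst ps))) ->
  [/\ all (wt rho) (map snd ps), map (ty_of rho) (map snd ps) = map (ty_of rho) (map fst ps),
   perm_eq (flatten (map fv (map fst ps))) (flatten (map fv (map snd ps))) &
   forall F : arrow, src F = [seq i (ty_of rho x) | x <- map fst ps] ->
     reo (flatten (map fv (map fst ps))) (flatten (map fv (map snd ps)))
       (acomp F (map (sem rho) (map fst ps))) = acomp F (map (sem rho) (map snd ps))].
Proof.
move=> hl hw hu.
have h : {in ps, forall p, [/\ wt rho p.2, ty_of rho p.2 = ty_of rho p.1,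
    perm_eq (fv p.1) (fv p.2) & reo (fv p.1) (fv p.2) (sem rho p.1) = sem rho p.2] /\
    (wt rho p.1 /\ uniq (fv p.1))}.
  elim: ps hl hw hu => //= p ps IH hl /andP[hw1 hw2]; rewrite cat_uniq => /and3P[h1 _ h2] q.
  rewrite inE => /predU1P[->|]; first by split=> //; apply: hl; rewrite ?mem_head.
  by apply: IH => // x hx; apply: hl; rewrite inE hx orbT.
split.
- by apply/allP => _ /mapP[p /h[[]] ? ? ? ? _ ->].
- by rewrite -!map_comp; apply/eq_in_map => p /h[[]].
- rewrite -!map_comp; elim: (ps) h => //= p l IH h; apply: perm_cat.
    by case: (h p (mem_head _ _)) => -[].
  by apply: IH => x hx; apply: h; rewrite inE hx orbT.
- move=> F hF; rewrite -!map_comp -acomp_reor.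
  + by congr acomp; apply/eq_in_map => p /h[[]].
  + by move: hu; rewrite -map_comp.
  + by move=> p /h[[]].
  + by move=> p /h[_ [h1 h2]] /=; rewrite size_src_sem.
  + rewrite hF -map_comp; apply/eq_in_map => p /h[_ [h1 h2]] /=.
    by rewrite tgt_sem.
Qed.

Lemma le_Tup rho l s t r : le rho s t -> le rho (Tup (l ++ s :: r)) (Tup (l ++ t :: r)).
Proof.
move=> h; pose ps := [seq (x, x) | x <- l] ++ (s, t) :: [seq (x, x) | x <- r].
have e1 : map fst ps = l ++ s :: r by rewrite map_cat /= -!map_comp !map_id.
have e2 : map snd ps = l ++ t :: r by rewrite map_cat /= -!map_comp !map_id.
rewrite -e1 -e2 => hw hu; have [|h1 h2 h3 h4] := le_list _ hw hu.
  move=> x; rewrite mem_cat inE => /or3P[/mapP[y _ ->]|/eqP->|/mapP[y _ ->]] //;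
    exact: le_refl.
split=> //=; first by rewrite h2.
have -> : [seq i (ty_of rho x) | x <- map snd ps] = [seq i (ty_of rho x) | x <- map fst ps].
  by rewrite (map_comp i (ty_of rho)) h2 -map_comp.
exact: h4.
Qed.

Lemma le_Op rho u b (f : arr H u b) l s t r : le rho s t ->
  le rho (Op f (l ++ s :: r)) (Op f (l ++ t :: r)).
Proof.
move=> h; pose ps := [seq (x, x) | x <- l] ++ (s, t) :: [seq (x, x) | x <- r].
have e1 : map fst ps = l ++ s :: r by rewrite map_cat /= -!map_comp !map_id.
have e2 : map snd ps = l ++ t :: r by rewrite map_cat /= -!map_comp !map_id.
rewrite -e1 -e2 /le /= => /andP[hw /eqP hty] hu; have [|h1 h2 h3 h4] := le_list _ hw hu.
  move=> x; rewrite mem_cat inE => /or3P[/mapP[y _ ->]|/eqP->|/mapP[y _ ->]] //;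
    exact: le_refl.
split=> //=; first by rewrite h1 h2 hty eqxx.
by apply: h4; rewrite /src /= -hty -map_comp.
Qed.

Lemma le_App rho s s' t t' : le rho s s' -> le rho t t' -> le rho (App s t) (App s' t').
Proof.
move=> hs ht; pose ps := [:: (s, s'); (t, t')]; rewrite /le /=.
case/and3P=> ws wt'; case e: (ty_of rho s) => [||v b] // /eqP et hu.
have [|||h1 h2 h3 h4] := @le_list rho ps.
- by move=> x; rewrite !inE => /orP[]/eqP->.
- by rewrite /= ws wt'.
- by rewrite /= cats0.
case: h2 => [e1 e2]; move: h1 h3; rewrite /= !cats0 => /and3P[-> -> _] h3.
rewrite e1 e2 e et eqxx; split=> //.
have := h4 (aapp (map i v) (i b)); rewrite /= !cats0; apply.
by rewrite (aapp_fit _ _).1 e et i_limp i_tens.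
Qed.

(** The reordering from [s] to [t] leaves the bound variables in place at the end, so it passes
    through [curry] by uniqueness. *)
Lemma le_Lam rho u s t : le (ext u rho) s t -> le rho (Lam u s) (Lam u t).
Proof.
move=> h; rewrite /le /= => /andP[hb hw] hu; have hu' := uniq_lower hb hu.
have [wt' et hp hr] := h hw hu'; have hb' : binds (size u) (fv t) by rewrite -(binds_perm _ hp).
have hpl := lower_perm (size u) hp; split=> //; [by rewrite hb' wt'|by rewrite et|].
set k := size u; set b := reo (fv s) (last_bound k (fv s)) (sem (ext u rho) s).
have sb : src b = obs i rho (lower k (fv s)) ++ map i u.
  by rewrite (src_reo (h := i \o ext u rho) hu' (perm_last hb)) ?src_sem // -obs_last.
have [c1 c2 c3] := curryP sb.
have hlast : perm_eq (last_bound k (fv s)) (last_bound k (fv t)).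
  by rewrite perm_cat // perm_map.
have ulast : uniq (last_bound k (fv s)) by rewrite -(perm_uniq (perm_last hb)).
have eb : reo (fv t) (last_bound k (fv t)) (sem (ext u rho) t) =
    reo (last_bound k (fv s)) (last_bound k (fv t)) b.
  rewrite -hr !reo_comp ?size_src_sem //; first exact: perm_last.
  exact: perm_last.
have tb : tgt (reo (last_bound k (fv s)) (last_bound k (fv t)) b) = tgt b by rewrite tgt_reo.
rewrite eb; apply/esym/curry_uniq.
- rewrite (src_reo (h := i \o ext u rho) ulast hlast) -?/(obs _ _ _) ?obs_last //.
- by rewrite (src_reo (h := i \o rho) hu hpl) // c1.
- by rewrite tgt_reo c2 tb.
- rewrite tb -[in RHS]c3 -(reo_map (r := addn k)); last 2 first.
  + by move=> x y _ _; exact: addnI.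
  + by move=> x; rewrite (perm_mem hpl).
  apply: acomp_reo_ids.
  + exact: ulast.
  + by rewrite perm_map.
  + by rewrite c1 !size_map.
  + by rewrite size_iota size_map.
  + by rewrite c2.
Qed.

(** The two changes are made separately, with [Let u s' t] in between. Changing the bound term
    reorders the sources of the arrow in the first slot; changing the body reorders the other
    sources of the arrow given by [unrep]. *)
Lemma le_Let rho u s s' t t' : le (ext u rho) s s' -> le rho t t' ->
  le rho (Let u s t) (Let u s' t').
Proof.
move=> h1 h2; apply: (@le_trans _ _ (Let u s' t)); last first.
- rewrite /le /= => /and4P[ht /eqP et hb hw]; rewrite cat_uniq => /and3P[u1 u12 u2].
  have [wt' et' hp hr] := h2 ht u1.
  have hu' := uniq_lower hb u2.
  split=> //=; [by rewrite wt' et' et eqxx hb hw|by rewrite perm_cat|].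
  rewrite -hr (acomp_reo_ids (M := lower (size u) (fv s'))) //.
  - by rewrite cat_uniq u1 u12.
  - by rewrite size_src_sem.
  - by rewrite [RHS]size_map.
  set b := reo (fv s') _ _.
  have [|-> _ _] := @unrepP S [::] (map i u) (obs i rho (lower (size u) (fv s'))) b.
    by rewrite (src_reo (h := i \o ext u rho) hu' (perm_first hb)) ?src_sem // -obs_first.
  by rewrite tgt_sem // et i_tens.
- rewrite /le /= => /and4P[ht /eqP et hb hw]; rewrite cat_uniq => /and3P[u1 u12 u2].
  have hu' := uniq_lower hb u2.
  have [wt' es hp hr] := h1 hw hu'; have hb' : binds (size u) (fv s') by rewrite -(binds_perm _ hp).
  have hpl := lower_perm (size u) hp; split=> //; first by rewrite ht et eqxx hb' wt'.
    by rewrite perm_cat.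
  set k := size u; set b := reo (fv s) (first_bound k (fv s)) (sem (ext u rho) s).
  have sb : src b = [::] ++ map i u ++ obs i rho (lower k (fv s)).
    by rewrite (src_reo (h := i \o ext u rho) hu' (perm_first hb)) ?src_sem // -obs_first.
  have [c1 c2 c3] := unrepP sb; rewrite /= in c1 c3.
  set T := unrep _ _ _ b in c1 c2 c3.
  have hfirst : perm_eq (first_bound k (fv s)) (first_bound k (fv s')).
    by rewrite perm_cat // perm_map.
  have ufirst : uniq (first_bound k (fv s)) by rewrite -(perm_uniq (perm_first hb)).
  have eb : reo (fv s') (first_bound k (fv s')) (sem (ext u rho) s') =
      reo (first_bound k (fv s)) (first_bound k (fv s')) b.
    rewrite -hr !reo_comp ?size_src_sem //; first exact: perm_first.
    exact: perm_first.
  (* Names for the sources of [T]: [0] is the tensor that gathers the bound variables, and [n.+1] is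
     the free variable [n]. *)
  pose L := 0 :: map succn (lower k (fv s)); pose L' := 0 :: map succn (lower k (fv s')).
  have uL : uniq L by rewrite /= (map_inj_uniq succn_inj) u2 andbT; apply/mapP => -[].
  have hL : perm_eq L L' by rewrite perm_cons perm_map.
  have red g x l : map (fun n => if n is m.+1 then aid (i (rho m)) else g) (x :: map succn l) =
      (if x is m.+1 then aid (i (rho m)) else g) :: aids (obs i rho l).
    by rewrite /= -!map_comp.
  have redN (F : nat -> nat) M l :
      flatten (map (fun n => if n is m.+1 then [:: F m] else M) (0 :: map succn l)) = M ++ map F l.
    by rewrite /=; congr (_ ++ _); elim: l => //= x l ->.
  (* This is used twice: with [g] the arrow [are], to verify the universal property, and with [g]
     the denotation of [t], for the conclusion. *)
  have key (F : nat -> nat) M g : uniq (M ++ map F (lower k (fv s))) ->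
      size (src g) = size M -> tgt g = tens S (map i u) ->
      acomp (reo L L' T) (g :: aids (obs i rho (lower k (fv s')))) =
      reo (M ++ map F (lower k (fv s))) (M ++ map F (lower k (fv s')))
        (acomp T (g :: aids (obs i rho (lower k (fv s))))).
    move=> hu hg tg.
    have := @acomp_reol S L L' (fun n => if n is m.+1 then [:: F m] else M)
      (fun n => if n is m.+1 then aid (i (rho m)) else g) T uL hL.
    rewrite !red !redN; apply=> //; first by case.
    by rewrite c1 /= tg -map_comp.
  have tb : tgt (reo (first_bound k (fv s)) (first_bound k (fv s')) b) = tgt b by rewrite tgt_reo.
  have -> : unrep [::] (map i u) (obs i rho (lower k (fv s')))
      (reo (fv s') (first_bound k (fv s')) (sem (ext u rho) s')) = reo L L' T.
    rewrite eb; apply: unrep_uniq.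
    - by rewrite (src_reo (h := i \o ext u rho) ufirst hfirst) -?/(obs _ _ _) ?obs_first.
    - rewrite (src_reo (h := fun n => if n is m.+1 then i (rho m) else tens S (map i u)) uL hL) //.
        by rewrite /= -map_comp.
      by rewrite c1 /= -map_comp.
    - by rewrite tgt_reo c2 tb.
    - rewrite -[in RHS]c3 /=; apply: key => //; first by rewrite size_map size_iota.
  have := key id (fv t) (sem rho t); rewrite !map_id => -> //.
  - by rewrite cat_uniq u1 u12.
  - by rewrite size_src_sem.
  - by rewrite tgt_sem // et i_tens.
Qed.

Fixpoint cext (C : ctx H) rho : nat -> type :=
  match C with
  | Hole => rho
  | CLam u C | CLetL u C _ => cext C (ext u rho)
  | CAppL C _ | CAppR _ C | CTup _ C _ | CLetR _ _ C | COp _ _ _ _ C _ => cext C rho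
  end.

Lemma le_plug C rho s t : le (cext C rho) s t -> le rho (plug C s) (plug C t).
Proof.
elim: C rho s t => [|u C IH|C IH p|p C IH|l C IH r|u C IH p|u p C IH|u b f l C IH r] rho s t //= h.
- by apply: le_Lam; exact: IH.
- by apply: le_App (@le_refl _ _); exact: IH.
- by apply: le_App (@le_refl _ _) _; exact: IH.
- by apply: le_Tup; exact: IH.
- by apply: le_Let (@le_refl _ _); exact: IH.
- by apply: le_Let (@le_refl _ _) _; exact: IH.
- by apply: le_Op; exact: IH.
Qed.

Lemma wt_plug C rho s : wt rho (plug C s) -> wt (cext C rho) s.
Proof.
elim: C rho s => [|u C IH|C IH p|p C IH|l C IH r|u C IH p|u p C IH|u b f l C IH r] rho s //=.
- by case/andP=> _ /IH.
- by case/and3P=> /IH.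
- by case/and3P=> _ /IH.
- by rewrite all_cat /= => /and3P[_ /IH].
- by case/and4P=> _ _ _ /IH.
- by case/and4P=> /IH.
- by rewrite all_cat /= => /andP[/and3P[_ /IH]].
Qed.

End Congruence.

(** * Instantiation of the outermost bound variables *)

Section Instances.
Variable H : autonomous_signature.
Notation type := (type H).
Implicit Types (s t : tm H) (ts : seq (tm H)) (u : seq type) (rho : nat -> type)
  (r : nat -> tm H).

(** The common value of [inst_in] and [inst_out] at depth [0]. The default of [nth] lowers the
    variables that lie past the instantiated ones. *)
Definition inst ts (n : nat) : tm H := nth (Var (n - size ts)) ts n.

Lemma ren_id s : ren id s = s.
Proof. by rewrite renE -[RHS]subst_Var. Qed.

Lemma inst_inE ts : inst_in 0 ts = inst ts.
Proof.
apply: funext => n; rewrite /inst_in /inst; case: ltnP => h; first exact: set_nth_default.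
by rewrite nth_default.
Qed.

Lemma inst_outE ts : inst_out 0 ts = inst ts.
Proof.
apply: funext => n; rewrite /inst_out /inst; case: ltnP => h; last by rewrite nth_default.
rewrite (_ : addn 0 = id) ?ren_id; first exact: set_nth_default.
by apply: funext.
Qed.

Lemma inst_ge ts n : inst ts (size ts + n) = Var n.
Proof. by rewrite /inst nth_default ?leq_addr // addKn. Qed.

Lemma map_inst_iota T (f : tm H -> T) ts : [seq f (inst ts n) | n <- iota 0 (size ts)] = map f ts.
Proof.
apply: (@eq_from_nth _ (f (Var 0))); rewrite !size_map size_iota // => n hn.
rewrite (nth_map 0) ?size_iota // (nth_map (Var 0)) // nth_iota //; congr f.
exact: set_nth_default.
Qed.

Lemma map_inst_addn T (f : tm H -> T) ts l :
  [seq f (inst ts n) | n <- map (addn (size ts)) l] = [seq f (Var n) | n <- l].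
Proof. by rewrite -map_comp; apply: eq_map => n /=; rewrite inst_ge. Qed.

Lemma ty_inst rho ts n : ty_of rho (inst ts n) = ext (map (ty_of rho) ts) rho n.
Proof.
case: (ltnP n (size ts)) => h; last by rewrite -(subnKC h) inst_ge -(size_map (ty_of rho)) ext_ge.
rewrite (ext_lt _ (ty_of rho (Var 0))) ?size_map // (nth_map (Var 0)) //; congr ty_of.
exact: set_nth_default.
Qed.

Lemma fv_inst_first ts l : flatten [seq fv (inst ts n) | n <- first_bound (size ts) l] =
  flatten (map fv ts) ++ lower (size ts) l.
Proof. by rewrite map_cat flatten_cat map_inst_iota map_inst_addn (flatten_map1 id) map_id. Qed.

Lemma fv_inst_last ts l : flatten [seq fv (inst ts n) | n <- last_bound (size ts) l] =
  lower (size ts) l ++ flatten (map fv ts).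
Proof. by rewrite map_cat flatten_cat map_inst_iota map_inst_addn (flatten_map1 id) map_id. Qed.

Lemma perm_fv_inst ts s : binds (size ts) (fv s) ->
  perm_eq (fv (subst (inst ts) s)) (flatten (map fv ts) ++ lower (size ts) (fv s)).
Proof.
move=> hb; rewrite fv_subst -fv_inst_first.
exact: perm_flatten (perm_map _ (perm_first hb)).
Qed.

Lemma wt_inst rho ts s : wt rho (subst (inst ts) s) =
  wt (ext (map (ty_of rho) ts) rho) s && all (fun n => wt rho (inst ts n)) (fv s).
Proof. by apply: wt_subst => n _; exact: ty_inst. Qed.

Lemma all_wt_inst rho ts s : binds (size ts) (fv s) ->
  all (fun n => wt rho (inst ts n)) (fv s) = all (wt rho) ts.
Proof.
move=> hb; rewrite (perm_all _ (perm_first hb)) all_cat.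
have -> : all (fun n => wt rho (inst ts n)) (iota 0 (size ts)) = all (wt rho) ts.
  by rewrite -[in RHS](map_id ts) -(map_inst_iota id) all_map.
rewrite [X in _ && X](_ : _ = true) ?andbT //; apply/allP => _ /mapP[n _ ->].
by rewrite inst_ge.
Qed.

Lemma fits_inst rho ts l : all (wt rho) ts -> binds (size ts) l ->
  uniq (flatten (map fv ts) ++ lower (size ts) l) ->
  fits (ext (map (ty_of rho) ts) rho) rho (inst ts) l.
Proof.
move=> hw hb hu; split.
- by move=> n _; exact: ty_inst.
(* The list [l] is presented as the free variables of a term, because [all_wt_inst] speaks about
   terms. *)
- have -> : l = fv (Tup (map (@Var H) l)).
    by rewrite /= -map_comp (flatten_map1 id) map_id.
  by rewrite all_wt_inst //= -map_comp (flatten_map1 id) map_id.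
- by rewrite (perm_uniq (perm_flatten (perm_map _ (perm_first hb)))) fv_inst_first.
Qed.

Lemma ren_vars f j k : map (ren f) (vars H j k) = [seq Var (f n) | n <- iota j k].
Proof. by rewrite /vars -map_comp. Qed.

Lemma map_ty_vars rho j k : map (ty_of rho) (vars H j k) = map rho (iota j k).
Proof. by rewrite /vars -map_comp. Qed.

Lemma map_ext_iota u rho : map (ext u rho) (iota 0 (size u)) = u.
Proof.
apply: (@eq_from_nth _ (Tens [::])); rewrite ?size_map ?size_iota // => n hn.
by rewrite (nth_map 0) ?size_iota // nth_iota // (ext_lt _ (Tens [::])).
Qed.

Lemma fv_vars j k : flatten (map fv (vars H j k)) = iota j k.
Proof. by rewrite /vars -map_comp (flatten_map1 id) map_id. Qed.

Lemma lower_iota k : lower k (iota 0 k) = [::].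
Proof.
case e: (lower k (iota 0 k)) => [|i r] //.
have: i \in lower k (iota 0 k) by rewrite e mem_head.
by rewrite mem_lower mem_iota add0n /= ltnNge leq_addr.
Qed.

End Instances.

(** * Soundness of the two contractions at an empty context [L] *)

Section Beta.
Variables (H : autonomous_signature) (S : autonomous_multicategory) (i : signature_map H S).
Notation type := (type H).
Notation arrow := (arrow S).
Notation aids := (map (@aid S)).
Notation sem := (sem i).
Notation le := (le i).
Implicit Types (s t : tm H) (ts : seq (tm H)) (u : seq type) (rho : nat -> type)
  (r : nat -> tm H).

(** By [sem_subst] both sides are composites with the same family of arrows, and reordering the
    outer arrow moves the blocks of their sources. *)
Lemma le_subst rho rho' r s t : le rho s t -> uniq (fv s) ->
  {in fv s, forall n, ty_of rho' (r n) = rho n} -> le rho' (subst r s) (subst r t).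
Proof.
move=> h hus hty; rewrite /le (wt_subst hty) fv_subst => /andP[hw hr] hu.
have [wt' et hp he] := h hw hus.
have hty' : {in fv t, forall n, ty_of rho' (r n) = rho n}.
  by move=> n; rewrite -(perm_mem hp); exact: hty.
have hf : fits rho rho' r (fv s) by split.
have hpf := perm_flatten (perm_map (fun n => fv (r n)) hp).
have hut : uniq (fv t) by rewrite -(perm_uniq hp).
have hf' : fits rho rho' r (fv t).
  by split=> //; [rewrite -(perm_all _ hp)|rewrite -(perm_uniq hpf)].
rewrite (wt_subst hty') wt' -(perm_all _ hp) hr !fv_subst; split=> //.
  by rewrite (ty_subst hty) (ty_subst hty').
rewrite (sem_subst i hw hus hf) (sem_subst i wt' hut hf') -he (acomp_reol (N := fun n => fv (r n))) //.
- by move=> n /(fits1 hf)[h1 h2 h3]; rewrite size_src_sem.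
- by have := fits_tgt i hf; rewrite -map_comp => ->; rewrite src_sem.
Qed.

(** A tuple ends in [re], and the arrow given by [unrep] precomposed with [re] is the denotation of
    the body; what is left is the composite that [sem_subst] computes. *)
Lemma sem_let_tup rho u s ts : wt rho (Let u s (Tup ts)) -> uniq (fv (Let u s (Tup ts))) ->
  reo (fv (subst (inst ts) s)) (fv (Let u s (Tup ts))) (sem rho (subst (inst ts) s)) =
  sem rho (Let u s (Tup ts)).
Proof.
move=> /= /and4P[hts /eqP[eu] hb hw] hu.
have k_ts : size ts = size u by rewrite -eu size_map.
rewrite -k_ts -?eu in hb hw hu *; rewrite eu in hw *; have hf := fits_inst hts hb hu; rewrite eu in hf.
move: (hu); rewrite cat_uniq => /and3P[u1 _ u2]; have hus := uniq_lower hb u2.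
rewrite (sem_subst i hw hus hf) fv_subst -fv_inst_first -acomp_reol //.
- set b := reo (fv s) _ _.
  have sb : src b = [::] ++ map i u ++ obs i rho (lower (size ts) (fv s)).
    rewrite (src_reo (h := i \o ext u rho) hus (perm_first hb)) ?src_sem // k_ts.
    by rewrite -obs_first.
  have [c1 c2 c3] := unrepP sb; rewrite /= in c1 c3.
  rewrite -[in LHS]c3 map_cat map_inst_iota map_inst_addn.
  have tG : map (@tgt S) [seq sem rho (Var n) | n <- lower (size ts) (fv s)] =
      obs i rho (lower (size ts) (fv s)) by rewrite -map_comp.
  have := @acomp_cons_ids S (unrep [::] (map i u) (obs i rho (lower (size ts) (fv s))) b)
    (are (map i u)) (map (sem rho) ts) [seq sem rho (Var n) | n <- lower (size ts) (fv s)].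
  rewrite tG => ->.
  + by rewrite -eu -!map_comp.
  + by rewrite c1.
  + have := fits_tgt i (@fits_inst _ rho ts (iota 0 (size ts)) hts _ _).
    rewrite map_inst_iota => ->.
    * by rewrite eu k_ts obs_iota.
    * by apply/allP => j hj; rewrite count_uniq_mem ?iota_uniq // hj.
    * by rewrite lower_iota cats0.
- exact: perm_first.
- by case: hf.
- by move=> n /(fits1 hf)[h1 h2 h3]; rewrite size_src_sem.
- by have := fits_tgt i hf; rewrite -map_comp => ->; rewrite src_sem.
Qed.

Lemma le_let_tup rho u s ts : le rho (Let u s (Tup ts)) (subst (inst ts) s).
Proof.
move=> hw hu; have he := sem_let_tup hw hu; move: hw hu he => /= /and4P[hts /eqP[eu] hb hw] hu he.
have k_ts : size ts = size u by rewrite -eu size_map.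
rewrite -k_ts in hb hu he *.
have hp := perm_fv_inst hb; split.
- by rewrite wt_inst eu hw all_wt_inst.
- by apply: ty_subst => n _; rewrite ty_inst eu.
- by rewrite perm_sym.
have hw' : wt rho (subst (inst ts) s) by rewrite wt_inst eu hw all_wt_inst.
have hu' : uniq (fv (subst (inst ts) s)) by rewrite (perm_uniq hp).
rewrite -he reo_comp ?reo_id ?size_src_sem //.
by rewrite perm_sym.
Qed.

(** The hypotheses supply what the contractum does not record: that each bound variable is used
    exactly once, and that the annotation matches the types of [ts]. *)
Lemma ge_let_tup rho u s ts : binds (size ts) (fv s) -> map (ty_of rho) ts = u ->
  le rho (subst (inst ts) s) (Let u s (Tup ts)).
Proof.
move=> hb eu hw hu; have hp := perm_fv_inst hb.
have k_ts : size ts = size u by rewrite -eu size_map.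
have hw' : wt rho (Let u s (Tup ts)).
  by move: hw; rewrite wt_inst all_wt_inst // eu => /andP[h1 h2]; rewrite /= h1 h2 eu eqxx -k_ts hb.
have hp' : perm_eq (fv (subst (inst ts) s)) (fv (Let u s (Tup ts))) by rewrite /= -k_ts.
split=> //; last by apply: sem_let_tup => //; rewrite -(perm_uniq hp').
by rewrite /= -eu; apply/esym/ty_subst => n _; exact: ty_inst.
Qed.

(** On a tuple the application arrow becomes [ev] applied to the components ([aapp_re]), and [ev]
    undoes [curry]. *)
Lemma le_app_lam rho u s ts : le rho (App (Lam u s) (Tup ts)) (subst (inst ts) s).
Proof.
rewrite /le /= => /and3P[/andP[hb hw] hts /eqP[eu]] hu.
have k_ts : size ts = size u by rewrite -eu size_map.
rewrite -k_ts in hb hu *; have hp := perm_fv_inst hb.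
have hu' : uniq (flatten (map fv ts) ++ lower (size ts) (fv s)) by rewrite uniq_catC.
have hf := fits_inst hts hb hu'; rewrite eu in hf.
move: (hu); rewrite cat_uniq => /and3P[u2 _ u1]; have hus := uniq_lower hb u2.
have hws : wt rho (subst (inst ts) s) by rewrite wt_inst eu hw all_wt_inst.
split=> //.
- by apply: ty_subst => n _; rewrite ty_inst eu.
- by rewrite perm_catC perm_sym.
set b := reo (fv s) _ _.
have sb : src b = obs i rho (lower (size ts) (fv s)) ++ map i u.
  rewrite (src_reo (h := i \o ext u rho) hus (perm_last hb)) ?src_sem // k_ts.
  by rewrite -obs_last.
have [c1 c2 c3] := curryP sb.
have tb : tgt b = i (ty_of (ext u rho) s) by rewrite tgt_reo tgt_sem.
have tts : map (@tgt S) (map (sem rho) ts) = map i u.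
  have := fits_tgt i (@fits_inst _ rho ts (iota 0 (size ts)) hts _ _).
  rewrite map_inst_iota => ->.
  - by rewrite eu k_ts obs_iota.
  - by apply/allP => j hj; rewrite count_uniq_mem ?iota_uniq // hj.
  - by rewrite lower_iota cats0.
have -> : [seq i (ty_of rho t) | t <- ts] = map i u by rewrite -eu -map_comp.
rewrite aapp_re ?c2 ?tb //.
have -> : acomp (aev (map i u) (i (ty_of (ext u rho) s)))
    (curry (obs i rho (lower (size ts) (fv s))) (map i u) b :: map (sem rho) ts) =
    acomp b (aids (obs i rho (lower (size ts) (fv s))) ++ map (sem rho) ts).
  have := @acomp_cons_ids S (aev (map i u) (tgt b))
    (curry (obs i rho (lower (size ts) (fv s))) (map i u) b)
    (aids (obs i rho (lower (size ts) (fv s)))) (map (sem rho) ts).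
  rewrite tts c3 -tb => ->; last by rewrite tgt_aids c1.
    by rewrite -[in LHS](acomp_aid (curry _ _ b)) c1.
  by rewrite c2.
have -> : aids (obs i rho (lower (size ts) (fv s))) ++ map (sem rho) ts =
    [seq sem rho (inst ts n) | n <- last_bound (size ts) (fv s)].
  by rewrite map_cat map_inst_iota map_inst_addn /obs -map_comp.
have hu'' : uniq (fv (subst (inst ts) s)) by rewrite (perm_uniq hp).
have hp' : perm_eq (fv (subst (inst ts) s)) (lower (size ts) (fv s) ++ flatten (map fv ts)).
  by apply: perm_trans hp _; rewrite perm_catC.
rewrite (acomp_reol (N := fun n => fv (inst ts n))) ?fv_inst_last -?fv_subst -?(sem_subst i hw hus hf).
- by rewrite reo_comp ?reo_id ?size_src_sem // perm_sym.
- by [].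
- exact: perm_last.
- by [].
- by move=> n /(fits1 hf)[h1 h2 h3]; rewrite size_src_sem.
- by have := fits_tgt i hf; rewrite -map_comp => ->; rewrite src_sem.
Qed.

End Beta.

(** * Contexts with hole under renaming and substitution *)

Section Plug.
Variable H : autonomous_signature.
Notation type := (type H).
Implicit Types (s t p : tm H) (ts : seq (tm H)) (u : seq type) (rho : nat -> type)
  (r : nat -> tm H) (C : ctx H).

Lemma upren_add d k f : upren d (upren k f) = upren (d + k) f.
Proof.
apply: funext => n; rewrite /upren; case: (ltnP n d) => h1; first by rewrite (ltn_addr _ h1).
rewrite -ltn_subLR //; case: ltnP => h2; first by rewrite subnKC.
by rewrite addnA subnDA.
Qed.

Lemma up_add d k r : up d (up k r) = up (d + k) r.
Proof.
apply: funext => n; rewrite /up; case: (ltnP n d) => h1; first by rewrite (ltn_addr _ h1).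
rewrite -ltn_subLR //; case: ltnP => h2 /=; first by rewrite subnKC.
by rewrite ren_comp subnDA; congr ren; apply: funext => m /=; rewrite addnA.
Qed.

Lemma up_Var_comp k f : up k (@Var H \o f) = @Var H \o upren k f.
Proof. by apply: funext => n; rewrite /up /upren /=; case: ltnP. Qed.

Lemma depth_ren f C : depth (ren_ctx f C) = depth C.
Proof. by elim: C f => //= [u C IH|u C IH t] f; rewrite IH. Qed.

(** The hypothesis says that on the variables [f n], the only free ones of the renamed context, [r]
    is the renaming [g]; so only the term in the hole undergoes a proper substitution. *)
Lemma subst_plug r f g C p : r \o f = @Var H \o g ->
  subst r (plug (ren_ctx f C) p) = plug (ren_ctx g C) (subst (up (depth C) r) p).
Proof.
have hs r' f' g' t : r' \o f' = @Var H \o g' -> subst r' (ren f' t) = ren g' t.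
  by move=> e; rewrite subst_ren e -renE.
have hm r' f' g' l : r' \o f' = @Var H \o g' -> map (subst r') (map (ren f') l) = map (ren g') l.
  by move=> e; rewrite -map_comp; apply: eq_map => t; exact: hs.
have hu r' f' g' k : r' \o f' = @Var H \o g' -> up k r' \o upren k f' = @Var H \o upren k g'.
  by move=> e; rewrite up_comp_upren e up_Var_comp.
elim: C r f g p => [|u C IH|C IH t|t C IH|l C IH l'|u C IH t|u t C IH|u b c l C IH l'] r f g p e /=.
- by rewrite (_ : up 0 r = r) //; apply: funext => n; rewrite /up /= subn0 (_ : addn 0 = id) ?ren_id //; apply: funext.
- by rewrite (IH _ _ _ _ (hu _ _ _ _ e)) up_add.
- by rewrite (IH _ _ g) // (hs _ _ g).
- by rewrite (IH _ _ g) // (hs _ _ g).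
- by rewrite map_cat /= (IH _ _ g) // !(hm _ _ g).
- by rewrite (IH _ _ _ _ (hu _ _ _ _ e)) up_add (hs _ _ g).
- by rewrite (IH _ _ g) // (hs _ _ _ _ (hu _ _ _ _ e)).
- by rewrite map_cat /= (IH _ _ g) // !(hm _ _ g).
Qed.

Lemma ren_ctx_id C : ren_ctx id C = C.
Proof.
have hu k : upren k id = id.
  by apply: funext => n; rewrite /upren; case: ltnP => // h; rewrite subnKC.
have hm (l : seq (tm H)) : map (ren id) l = l.
  by rewrite -[RHS]map_id; apply: eq_map => t; exact: ren_id.
by elim: C => //= *; rewrite ?hu ?hm ?ren_id; congruence.
Qed.

Lemma ren_plug f C p : ren f (plug C p) = plug (ren_ctx f C) (ren (upren (depth C) f) p).
Proof.
rewrite renE -{1}(ren_ctx_id C) (@subst_plug _ id f) //.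
by rewrite up_Var_comp -renE.
Qed.

(** Filling the hole with the closed term [Tup [::]] isolates the occurrences that belong to the
    context itself. *)
Lemma perm_fv_plug C p :
  perm_eq (fv (plug C p)) (fv (plug C (Tup [::])) ++ lower (depth C) (fv p)).
Proof.
have low d k l : lower k (lower d l) = lower (d + k) l.
  elim: l => //= n l IH; rewrite /lower /=; case: (leqP d n) => h /=; last first.
    by rewrite leqNgt (ltn_addr _ h) /=.
  by rewrite leq_subRL //; case: ifP => //= _; rewrite subnDA; congr (_ :: _).
have cat3 (l1 l2 l3 m : seq nat) : perm_eq l2 (l3 ++ m) -> perm_eq (l1 ++ l2) ((l1 ++ l3) ++ m).
  by move=> h; rewrite -catA perm_cat2l.
have cat4 (l1 l2 l3 m : seq nat) : perm_eq l1 (l3 ++ m) -> perm_eq (l1 ++ l2) ((l3 ++ l2) ++ m).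
  by move=> h; apply: perm_trans (perm_cat h (perm_refl l2)) _; rewrite perm_catAC.
have lowc k l l' m d : perm_eq l (l' ++ lower d m) ->
    perm_eq (lower k l) (lower k l' ++ lower (d + k) m).
  by move=> h; rewrite -low -lower_cat lower_perm.
elim: C => [|u C IH|C IH t|t C IH|l C IH l'|u C IH t|u t C IH|u b c l C IH l'] /=.
- by rewrite /lower filter_predT; under eq_map do rewrite subn0; rewrite map_id.
- exact: lowc.
- exact: cat4.
- exact: cat3.
- by rewrite !map_cat !flatten_cat /=; apply: cat3; exact: cat4.
- by apply: cat3; exact: lowc.
- exact: cat4.
- by rewrite !map_cat !flatten_cat /=; apply: cat3; exact: cat4.
Qed.

Lemma cext_ge C rho n : cext C rho (depth C + n) = rho n.
Proof.
elim: C rho n => //= [u C IH|u C IH t] rho n; by rewrite -addnA IH ext_ge.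
Qed.

End Plug.

(** * Replacing a variable of tensor type by a tuple of variables *)

Section LetContext.
Variables (H : autonomous_signature) (S : autonomous_multicategory) (i : signature_map H S).
Notation type := (type H).
Notation arrow := (arrow S).
Notation aids := (map (@aid S)).
Notation sem := (sem i).
Notation le := (le i).
Implicit Types (s t : tm H) (ts : seq (tm H)) (u : seq type) (rho : nat -> type)
  (r : nat -> tm H) (C : ctx H).

Definition untup k (n : nat) : tm H := if n is m.+1 then Var (k + m) else Tup (vars H 0 k).

Lemma untup_succ k : untup k \o succn = @Var H \o addn k.
Proof. by []. Qed.

Lemma ty_untup rho u n : ty_of (ext u rho) (untup (size u) n) = ext [:: Tens u] rho n.
Proof.
case: n => [|n] /=; first by rewrite map_ty_vars map_ext_iota.
by rewrite ext_ge -[n.+1]add1n (ext_ge [:: _]).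
Qed.

Lemma all_wt_untup rho k l : all (fun n => wt rho (untup k n)) l.
Proof. by apply/allP => -[|n] _ //=; rewrite /vars all_map; apply/allP. Qed.

Lemma fv_untup k l : flatten [seq fv (untup k n) | n <- first_bound 1 l] = first_bound k (map (addn k) (lower 1 l)).
Proof.
rewrite /first_bound lower_addn map_cat flatten_cat /= cats0 fv_vars; congr (_ ++ _).
by rewrite -map_comp; exact: flatten_map1.
Qed.

(* By representability a variable of tensor type may be replaced by a tuple of
   fresh variables when two terms are compared. *)
Lemma le_untup rho u s t : binds 1 (fv s) -> binds 1 (fv t) ->
  le (ext u rho) (subst (untup (size u)) s) (subst (untup (size u)) t) ->
  le (ext [:: Tens u] rho) s t.
Proof.
set k := size u; set rho1 := ext [:: _] rho; set rho2 := ext u rho => hbs hbt h hw hu.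
have hty (l : seq nat) : {in l, forall n, ty_of rho2 (untup k n) = rho1 n}.
  by move=> n _; exact: ty_untup.
have hwE p : wt rho2 (subst (untup k) p) = wt rho1 p.
  by rewrite (wt_subst (hty _)) all_wt_untup andbT.
have pfv p : binds 1 (fv p) -> perm_eq (fv (subst (untup k) p))
    (iota 0 k ++ map (addn k) (lower 1 (fv p))).
  move=> hb; rewrite fv_subst (perm_trans (perm_flatten (perm_map _ (perm_first hb)))) //.
  by rewrite fv_untup /first_bound lower_addn.
have ul : uniq (lower 1 (fv s)) by rewrite (map_inj_in_uniq) ?filter_uniq // => x y; rewrite !mem_filter => /andP[hx _] /andP[hy _] e; rewrite -(subnKC hx) e subnKC.
have us : uniq (fv (subst (untup k) s)).
  rewrite (perm_uniq (pfv _ hbs)) cat_uniq iota_uniq (map_inj_uniq (@addnI k)) ul andbT /=.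
  by apply/hasPn => j /mapP[m _ ->]; rewrite mem_iota add0n /= -leqNgt leq_addr.
have [] := h _ us; first by rewrite hwE.
rewrite hwE => wt' ht hp he.
have ut : uniq (fv (subst (untup k) t)) by rewrite -(perm_uniq hp).
have hpl : perm_eq (lower 1 (fv s)) (lower 1 (fv t)).
  have := perm_trans hp (pfv _ hbt); rewrite (permPl (pfv _ hbs)) perm_cat2l.
  exact: perm_map_inj (@addnI k) _ _.
have hpst : perm_eq (fv s) (fv t).
  rewrite (perm_trans (perm_first hbs)) // perm_sym (perm_trans (perm_first hbt)) //.
  by rewrite perm_cat // perm_map // perm_sym.
have hut : uniq (fv t) by rewrite -(perm_uniq hpst).
split=> //; first by rewrite -(ty_subst (hty _)) ht (ty_subst (hty _)).
set F := first_bound 1 (fv s).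
have hFs : perm_eq (fv s) F by exact: perm_first.
have hFt : perm_eq (fv t) F by rewrite perm_sym in hpst; exact: perm_trans hpst _.
(* The interpretation of the substitution [untup] is the family of arrows in the representability
   bijection: [re] in the slot of the tensor, identities elsewhere. *)
pose G := [seq sem rho2 (untup k n) | n <- F].
have eG : G = are (map i u) :: aids (obs i rho (lower 1 (fv s))).
  rewrite /G /F /first_bound map_cat -map_comp /=; congr (_ :: _).
    rewrite (map_comp i (ty_of rho2)) map_ty_vars map_ext_iota.
    rewrite -[RHS](acomp_aid (are (map i u))); congr acomp.
    by rewrite -(obs_iota i rho u) /vars /obs -!map_comp.
  by rewrite /obs -!map_comp; apply: eq_map => n /=; rewrite /rho2 ext_ge.
have fs p (hwp : wt rho1 p) (hup : uniq (fv p)) (hF : perm_eq (fv p) F)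
    (hu2 : uniq (fv (subst (untup k) p))) :
    [/\ src (reo (fv p) F (sem rho1 p)) = tens S (map i u) :: obs i rho (lower 1 (fv s)),
        tgt (reo (fv p) F (sem rho1 p)) = i (ty_of rho1 p) &
        acomp (reo (fv p) F (sem rho1 p)) G =
        reo (fv (subst (untup k) p)) (flatten [seq fv (untup k n) | n <- F])
          (sem rho2 (subst (untup k) p))].
  have hf : fits rho1 rho2 (untup k) (fv p).
    by split; [exact: hty|exact: all_wt_untup|rewrite -fv_subst].
  split.
  - rewrite (src_reo (h := i \o rho1) hup hF) ?src_sem // -/(obs i rho1 _).
    by rewrite (obs_first i rho [:: Tens u]) /= i_tens.
  - by rewrite tgt_reo tgt_sem.
  - rewrite /G (acomp_reol (N := fun n => fv (untup k n))) //.
    + by rewrite (sem_subst i hwp hup hf) fv_subst.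
    + by case: hf.
    + by move=> n /(fits1 hf)[h1 h2 h3]; rewrite size_src_sem.
    + by have := fits_tgt i hf; rewrite -map_comp => ->; rewrite src_sem.
have [a1 a2 a3] := fs s hw hu hFs us; have [b1 b2 b3] := fs t wt' hut hFt ut.
(* After reordering to [F], both denotations have the same composite with [G], so representability
   identifies them. *)
have e : reo (fv s) F (sem rho1 s) = reo (fv t) F (sem rho1 t).
  apply: (@rep_inj S [::] (map i u) (obs i rho (lower 1 (fv s)))) => //.
    by rewrite a2 b2 -(ty_subst (hty _)) -ht (ty_subst (hty _)).
  rewrite /= -eG a3 b3 -he reo_comp ?size_src_sem ?hwE //.
  rewrite fv_subst; apply: perm_flatten; exact: perm_map.
rewrite -(reo_id hut (f := sem rho1 t)) ?size_src_sem //.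
rewrite -[in RHS](@reo_comp S _ F) ?size_src_sem //; last by rewrite perm_sym.
by rewrite -e reo_comp ?size_src_sem // perm_sym.
Qed.
End LetContext.

(** * Soundness of structural equivalence and of all reductions *)

Section Soundness.
Variables (H : autonomous_signature) (S : autonomous_multicategory) (i : signature_map H S).
Notation type := (type H).
Notation arrow := (arrow S).
Notation aids := (map (@aid S)).
Notation sem := (sem i).
Notation le := (le i).
Implicit Types (s t : tm H) (ts : seq (tm H)) (u : seq type) (rho : nat -> type)
  (r : nat -> tm H) (C : ctx H).

Lemma le_inst1 rho a s t p : binds 1 (fv s) -> ty_of rho p = a ->
  le (ext [:: a] rho) s t -> le rho (subst (inst [:: p]) s) (subst (inst [:: p]) t).
Proof.
move=> hb ep h hw hu; apply: (le_subst h) => // [|n _]; last by rewrite ty_inst /= ep.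
have hp : perm_eq _ _ := @perm_fv_inst _ [:: p] s hb.
by move: hu; rewrite (perm_uniq hp) cat_uniq => /and3P[_ _ /(uniq_lower hb)].
Qed.

(** The variables of the context itself are shifted past the bound ones, so these occur only in [s],
    where [swap] moves them above the binders of [C] and [lower] brings them back. *)
Lemma binds_swap C u s :
  binds (size u) (fv (plug (ren_ctx (addn (size u)) C) (ren (swap (size u) (depth C)) s))) =
  binds (size u) (fv s).
Proof.
rewrite (binds_perm _ (perm_fv_plug _ _)) depth_ren.
have -> : plug (ren_ctx (addn (size u)) C) (Tup [::]) = ren (addn (size u)) (plug C (Tup [::])).
  by rewrite ren_plug.
rewrite !fv_ren; apply: eq_in_all => j; rewrite mem_iota /= => hj; congr (_ == _).
rewrite count_cat (count_memPn _) ?add0n; last first.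
  by apply/mapP => -[m _ e]; move: hj; rewrite e ltnNge leq_addr.
elim: (fv s) => //= n l IH; rewrite /lower /= {1}/swap; case: (ltnP n (size u)) => h1.
  by rewrite leq_addr /= /swap h1 addKn -IH.
rewrite (gtn_eqF (leq_trans hj h1)) add0n -IH; case: (ltnP n (size u + depth C)) => h2.
  by rewrite leqNgt ltn_subLR // h2.
rewrite (leq_trans _ h2) ?leq_addl //= /swap ltnNge h1 /= ltnNge h2 /=.
by rewrite gtn_eqF // (leq_trans hj) // leq_subRL ?(leq_trans (leq_addl _ _) h2) // addnC.
Qed.

(** Presents the renaming in [SE_let] as the contraction of a [Let] over a tuple of variables. *)
Lemma subst_inst_swap d k s :
  subst (inst (vars H d k)) (ren (upren k (upren d (addn k))) s) = ren (swap k d) s.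
Proof.
rewrite subst_ren renE; congr subst; apply: funext => n /=.
have ige m : inst (vars H d k) (k + m) = Var m.
  by rewrite -[in RHS](inst_ge (vars H d k)) size_map size_iota.
rewrite /upren /swap; case: (ltnP n k) => h1.
  by rewrite /inst (nth_map 0) ?size_iota // nth_iota.
rewrite ige; congr Var; rewrite ltn_subLR //; case: ltnP => // h2.
by rewrite -subnDA addnA [d + k]addnC subnKC.
Qed.

(** Presents any term as the contractum of a redex whose arguments are the bound variables
    themselves. *)
Lemma subst_inst_upren k s :
  subst (inst (vars H 0 k)) (ren (upren k (addn k)) s) = s.
Proof.
rewrite -[RHS]subst_Var subst_ren; congr subst; apply: funext => n /=.
have ige m : inst (vars H 0 k) (k + m) = Var m.
  by rewrite -[in RHS](inst_ge (vars H 0 k)) size_map size_iota.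
rewrite /upren; case: (ltnP n k) => h1.
  by rewrite /inst (nth_map 0) ?size_iota // nth_iota.
by rewrite ige subnKC.
Qed.

Lemma ren_vars_addn d k : map (ren (addn d)) (vars H 0 k) = vars H d k.
Proof. by rewrite ren_vars /vars -{2}(addn0 d) iotaDl -map_comp. Qed.

Section LetOut.
Variables (C : ctx H) (u : seq type) (s : tm H).
Let k := size u.
Let d := depth C.
(** [X] and [Y] are the two sides of [SE_let] with the bound term generalised to the variable [0],
    which is [d] below the binders of [C]. When [0] is replaced by a tuple of fresh variables, both
    contract to [B]. *)
Let B := plug (ren_ctx (addn k) C) (ren (swap k d) s).
Let X := plug (ren_ctx succn C) (Let u (ren (upren k (upren d succn)) s) (Var d)).
Let Y := Let u (ren (upren k succn) B) (Var 0).

Lemma binds_X : binds 1 (fv X).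
Proof.
rewrite (binds_perm _ (perm_fv_plug _ _)) depth_ren.
have -> : plug (ren_ctx succn C) (Tup [::]) = ren succn (plug C (Tup [::])) by rewrite ren_plug.
rewrite [fv (Let _ _ _)]/= !fv_ren lower_upren -cat1s lower_cat lower_upren.
have -> : lower d [:: d] = [:: 0] by rewrite /lower /= leqnn /= subnn.
rewrite /binds /= count_cat /= (count_memPn _); last by apply/mapP => -[].
by rewrite (count_memPn _) //; apply/mapP => -[].
Qed.

Lemma binds_Y : binds 1 (fv Y).
Proof.
by rewrite /binds /Y [fv _]/= fv_ren lower_upren /= (count_memPn _) //; apply/mapP => -[].
Qed.

Lemma inst_X p : subst (inst [:: p]) X = plug C (Let u s (ren (addn d) p)).
Proof.
rewrite (@subst_plug _ _ _ id) //; last by apply: funext => n; rewrite /= (@inst_ge _ [:: p]).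
rewrite ren_ctx_id /= subst_ren !up_comp_upren; congr (plug C (Let u _ _)).
  rewrite (_ : inst [:: p] \o succn = @Var H) ?up_Var ?subst_Var //.
  by apply: funext => n; rewrite /= (@inst_ge _ [:: p]).
by rewrite /up ltnn subnn.
Qed.

Lemma inst_Y p : subst (inst [:: p]) Y = Let u B p.
Proof.
rewrite /= subst_ren up_comp_upren (_ : inst [:: p] \o succn = @Var H) ?up_Var ?subst_Var //.
by apply: funext => n; rewrite /= (@inst_ge _ [:: p]).
Qed.

Lemma untup_X : subst (untup H k) X =
  plug (ren_ctx (addn k) C) (Let u (ren (upren k (upren d (addn k))) s) (Tup (vars H d k))).
Proof.
rewrite (@subst_plug _ _ _ (addn k)) //= subst_ren !up_comp_upren untup_succ !up_Var_comp -renE.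
by rewrite /up ltnn subnn /= ren_vars_addn.
Qed.

Lemma untup_Y : subst (untup H k) Y = Let u (ren (upren k (addn k)) B) (Tup (vars H 0 k)).
Proof. by rewrite /= subst_ren up_comp_upren untup_succ up_Var_comp -renE. Qed.

Lemma le_untup_X rho : le (ext u rho) (subst (untup H k) X) B.
Proof.
by rewrite untup_X /B -subst_inst_swap; apply: le_plug; exact: le_let_tup.
Qed.

Lemma ge_untup_X rho : binds k (fv s) -> le (ext u rho) B (subst (untup H k) X).
Proof.
move=> hb; rewrite untup_X /B -subst_inst_swap; apply: le_plug; apply: ge_let_tup.
  by rewrite size_map size_iota fv_ren binds_upren.
rewrite map_ty_vars -[RHS](map_ext_iota u rho) -[X in iota X](addn0 d) iotaDl -map_comp.
by apply: eq_map => n /=; rewrite /d -(depth_ren (addn k) C) cext_ge.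
Qed.

Lemma le_untup_Y rho : le (ext u rho) (subst (untup H k) Y) B.
Proof. by rewrite untup_Y -{2}(subst_inst_upren k B); exact: le_let_tup. Qed.

Lemma ge_untup_Y rho : binds k (fv B) -> le (ext u rho) B (subst (untup H k) Y).
Proof.
move=> hb; rewrite untup_Y -{1}(subst_inst_upren k B); apply: ge_let_tup.
  by rewrite size_map size_iota fv_ren binds_upren.
by rewrite map_ty_vars map_ext_iota.
Qed.

(** By substitutivity it suffices to compare [X] with [Y], and by [le_untup] to do so with a tuple
    for the variable: there [X] contracts to [B], which expands to [Y]. [le_let_in] follows the same
    path backwards. *)
Lemma le_let_out rho t : le rho (plug C (Let u s (ren (addn d) t))) (Let u B t).
Proof.
suff h : ty_of rho t = Tens u -> binds k (fv s) ->
    le rho (plug C (Let u s (ren (addn d) t))) (Let u B t).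
  (* The well-typed [Let] at the hole yields the type of [t], since its renaming by [addn d] skips
     the variables bound by [C]. *)
  move=> hw; have := wt_plug hw => /= /and4P[_ /eqP et hb _]; apply: h => //.
  rewrite -et ty_ren; congr ty_of; apply: funext => n /=; by rewrite cext_ge.
move=> et hb; rewrite -inst_X -inst_Y.
apply: (le_inst1 binds_X et); apply: (le_untup binds_X binds_Y).
by apply: le_trans; [exact: le_untup_X|apply: ge_untup_Y; rewrite /B binds_swap].
Qed.

Lemma le_let_in rho t : le rho (Let u B t) (plug C (Let u s (ren (addn d) t))).
Proof.
suff h : ty_of rho t = Tens u -> binds k (fv B) ->
    le rho (Let u B t) (plug C (Let u s (ren (addn d) t))).
  by move=> hw; have := hw => /= /and4P[_ /eqP et hb _]; apply: h.
move=> et hb; rewrite -inst_X -inst_Y.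
apply: (le_inst1 binds_Y et); apply: (le_untup binds_Y binds_X).
by apply: le_trans; [exact: le_untup_Y|apply: ge_untup_X; rewrite -(binds_swap C)].
Qed.

End LetOut.

Lemma struct_eq_sound s t : struct_eq s t -> forall rho, le rho s t /\ le rho t s.
Proof.
elim=> {s t} [s|s t _ IH|s t p _ IH1 _ IH2|C s t _ IH|C u s t] rho.
- by split; exact: le_refl.
- by have [] := IH rho.
- have [h1 h2] := IH1 rho; have [h3 h4] := IH2 rho; split; apply: le_trans; eassumption.
- by have [h1 h2] := IH (cext C rho); split; exact: le_plug.
- by split; [exact: le_let_out|exact: le_let_in].
Qed.

Lemma swap0 k s : ren (swap k 0) s = s.
Proof.
rewrite -[RHS]ren_id; congr ren; apply: funext => n.
by rewrite /swap addn0; case: ltnP.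
Qed.

(** Induction on [L]: its outermost binding is moved out of the bound term by the structural
    equivalence, and the contraction takes place below it. *)
Lemma le_beta1 L rho u s ts : is_L L -> size u = size ts ->
  le rho (Let u s (plug L (Tup ts))) (plug L (subst (inst_in (depth L) ts) s)).
Proof.
elim: L rho s => // [|v L IH t] rho s hL hu; first by rewrite inst_inE; exact: le_let_tup.
(* The hole lies outside the scope of the binder [u], so the depth is [0], and the shift by the
   depth and [swap] are identities. *)
have := @le_let_out (CLetR u s Hole) v (plug L (Tup ts)) rho t.
rewrite /= (_ : addn 0 = id) ?ren_id ?swap0; last exact: funext.
move/le_trans; apply; apply: le_Let; last exact: le_refl.
have := IH (ext v rho) (ren (upren (size u) (addn (size v))) s) hL hu.
rewrite subst_ren (_ : _ \o _ = inst_in (depth L + size v) ts) //.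
apply: funext => n; rewrite /inst_in /upren /= hu; case: (ltnP n (size ts)) => h1.
  by rewrite h1.
by rewrite ltnNge leq_addr /= addKn addnA.
Qed.

Lemma le_beta2 L rho u s ts : is_L L -> size u = size ts ->
  le rho (App (plug L (Lam u s)) (Tup ts)) (plug L (subst (inst_out (depth L) ts) s)).
Proof.
elim: L rho ts => // [|v L IH t] rho ts hL hu; first by rewrite inst_outE; exact: le_app_lam.
have := @le_let_out (CAppL Hole (Tup ts)) v (plug L (Lam u s)) rho t.
rewrite /= (_ : addn 0 = id) ?ren_id ?swap0; last exact: funext.
move/le_trans; apply; apply: le_Let; last exact: le_refl.
have := IH (ext v rho) (map (ren (addn (size v))) ts) hL; rewrite size_map => /(_ hu).
rewrite (_ : inst_out _ _ = inst_out (depth L + size v) ts) //.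
apply: funext => n; rewrite /inst_out size_map; case: (ltnP n (size ts)) => h1 //.
rewrite (nth_map (Var n)) // ren_comp; congr ren; apply: funext => m /=; exact: addnA.
Qed.

Lemma subst_up_vars r k : map (subst (up k r)) (vars H 0 k) = vars H 0 k.
Proof. by rewrite /vars -map_comp; apply/eq_in_map => n; rewrite mem_iota /up /= => ->. Qed.

Lemma binds_iota k : binds k (iota 0 k).
Proof. by apply/allP => n hn; rewrite count_uniq_mem ?iota_uniq // hn. Qed.

(** By [le_untup] the term may be taken to be a tuple of variables, and then the expansion is a
    contraction read backwards. *)
Lemma le_eta1 rho u s : ty_of rho s = Tens u -> le rho s (Let u (Tup (vars H 0 (size u))) s).
Proof.
move=> es.
have := @le_inst1 rho (Tens u) (Var 0) (Let u (Tup (vars H 0 (size u))) (Var 0)) s isT es.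
rewrite /= subst_up_vars; apply; apply: le_untup => //.
  by rewrite /= fv_vars lower_iota.
rewrite /= subst_up_vars.
set V := vars H 0 (size u).
have sz : size V = size u by rewrite size_map size_iota.
have hv : map (subst (inst V)) V = V.
  by rewrite -[RHS]map_id -(map_inst_iota id) sz {2}/V /vars -map_comp.
have := @ge_let_tup _ _ i (ext u rho) u (Tup V) V; rewrite /= hv; apply.
  by rewrite sz fv_vars binds_iota.
by rewrite map_ty_vars map_ext_iota.
Qed.

(** Uniqueness in closedness: the arrow to be curried on the right is [ev] applied to the denotation
    of [s], whose currying is that denotation. *)
Lemma le_eta2 rho u a s : ty_of rho s = Limp u a ->
  le rho s (Lam u (App (ren (addn (size u)) s) (Tup (vars H 0 (size u))))).
Proof.
move=> es hw hu; rewrite /= fv_ren fv_vars.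
have hl : lower (size u) (map (addn (size u)) (fv s) ++ iota 0 (size u)) = fv s.
  by rewrite lower_cat lower_addn lower_iota cats0.
have hb : binds (size u) (map (addn (size u)) (fv s) ++ iota 0 (size u)).
  by case: (@binds_ctx (size u) (map (addn (size u)) (fv s) ++ iota 0 (size u)) (fv s)).
have huu := uniq_lower hb; rewrite hl in huu.
rewrite hl ty_ren ext_addn es hb wt_ren ext_addn hw /vars all_map -map_comp /= map_ext_iota eqxx.
split=> //; first by rewrite andbT; apply/allP.
rewrite reo_id ?size_src_sem //.
rewrite /last_bound hl sem_ren ?ext_addn //; last by rewrite (map_inj_uniq (@addnI _)).
have eu : [seq i (ty_of (ext u rho) x) | x <- vars H 0 (size u)] = map i u.
  by rewrite (map_comp i (ty_of _)) map_ty_vars map_ext_iota.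
have ea : map (sem (ext u rho)) (vars H 0 (size u)) = aids (map i u).
  by rewrite -(obs_iota i rho u) /vars /obs -!map_comp.
rewrite -[map (@Var H) _]/(vars H 0 (size u)) eu ea aapp_re ?tgt_aids ?tgt_sem ?es ?i_limp //.
set b := acomp _ _.
have tb : tgt b = i a by rewrite tgt_acomp.
have sb : src b = obs i rho (fv s) ++ map i u.
  by rewrite src_acomp /= ?src_aids ?src_sem // tgt_aids tgt_sem // es i_limp.
rewrite reo_id; last first.
- by rewrite sb !size_cat !size_map size_iota.
- exact: huu.
by apply/esym/curry_uniq; rewrite ?src_sem ?tgt_sem ?tb ?es ?i_limp.
Qed.

(** For expansions, [has_type] does not relate the type of the expanded term to [rho];
    well-typedness of [t] does, through the annotation that the expansion introduces. *)
Lemma red_aut_sound s t rho : red_aut s t -> wt rho t -> le rho s t.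
Proof.
case=> C {}s {}t.
- by case=> L u p ts hL hu _; apply: le_plug; exact: le_beta1.
- by case=> L u p ts hL hu _; apply: le_plug; exact: le_beta2.
- by move=> _ [u p _ _ /wt_plug /= /and4P[_ /eqP hp _ _]]; apply: le_plug; exact: le_eta1.
- move=> _ [u a p _ _ /wt_plug /= /andP[_ /and3P[_ _]]].
  rewrite ty_ren ext_addn map_ty_vars map_ext_iota.
  case e: (ty_of _ p) => [||v b] // /eqP[ev]; subst v.
  by apply: le_plug; exact: le_eta2 e.
Qed.

Lemma tm_eq_sound rho l a s t : uniq l -> tm_eq (ctx_on rho l) a s t ->
  reo (fv s) l (sem rho s) = reo (fv t) l (sem rho t).
Proof.
move=> hl; elim=> {s t} [s t|//|s t _ -> //|s t p _ -> _ -> //].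
case=> /(typedP _ _ _ hl)[ps ws es] /(typedP _ _ _ hl)[pt wt' et] h.
have hus : uniq (fv s) by rewrite (perm_uniq ps).
have [_ _ hp <-] : [/\ wt rho t, ty_of rho t = ty_of rho s, perm_eq (fv s) (fv t) &
      reo (fv s) (fv t) (sem rho s) = sem rho t].
  by case: h => [/struct_eq_sound/(_ rho)[h _]|/red_aut_sound/(_ wt') h]; exact: h.
by rewrite reo_comp // size_src_sem.
Qed.

End Soundness.

(** * Environments of contexts and equality of classes *)

Section Environment.
Variable H : autonomous_signature.
Notation type := (type H).
Implicit Types (s t : tm H) (u : seq type).

(** The value beyond the end of [u] is arbitrary: the variables of a term typed in [ctx_of u] are
    below [size u]. *)
Definition env u : nat -> type := ext u (fun=> Tens [::]).

Lemma typed_ctx_ofP u s a : typed (ctx_of u) s a <->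
  [/\ perm_eq (fv s) (iota 0 (size u)), wt (env u) s & ty_of (env u) s = a].
Proof. by rewrite (ctx_of_on (fun=> Tens [::])); apply: typedP; exact: iota_uniq. Qed.

Lemma env_cat u v n : n < size u -> env (u ++ v) n = env u n.
Proof.
move=> h; rewrite /env !(ext_lt _ (Tens [::])) ?size_cat ?(ltn_addr _ h) //.
by rewrite nth_cat h.
Qed.

Lemma env_addn u v n : env (u ++ v) (size u + n) = env v n.
Proof.
rewrite /env; case: (ltnP n (size v)) => h.
  by rewrite !(ext_lt _ (Tens [::])) ?size_cat ?ltn_add2l // nth_cat ltnNge leq_addr /= addKn.
by rewrite -(subnKC h) addnA -size_cat !ext_ge.
Qed.

Lemma map_env u : map (env u) (iota 0 (size u)) = u.
Proof. exact: map_ext_iota. Qed.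

Lemma tm_eq_repr u a s (hs : typed (ctx_of u) s a) : tm_eq (ctx_of u) a s (repr (class hs)).
Proof.
have /(congr1 sval) /= e := reprK (class hs); rewrite -e; exact: rst_refl.
Qed.

Lemma class_eq u a s t (hs : typed (ctx_of u) s a) (ht : typed (ctx_of u) t a) :
  tm_eq (ctx_of u) a s t -> class hs = class ht.
Proof.
move=> h; have e : tm_eq (ctx_of u) a s = tm_eq (ctx_of u) a t.
  apply: funext => p; apply: propext; split; first exact: rst_trans (rst_sym _ _ _ _ h).
  exact: rst_trans h.
rewrite /class; move: (ex_intro2 _ _ s hs _) (ex_intro2 _ _ t ht _); rewrite e => h1 h2.
by congr exist; exact: Prop_irrelevance.
Qed.

End Environment.

(** * The functor induced by the interpretation *)

Section Functor.
Variables (H : autonomous_signature) (S : autonomous_multicategory) (i : signature_map H S).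
Notation type := (type H).
Notation aids := (map (@aid S)).
Notation sem := (sem i).
Implicit Types (s t : tm H) (ts : seq (tm H)) (u : seq type) (rho : nat -> type).

(** The case of [sem_subst] where each variable is replaced by itself, read in the other
    environment. *)
Lemma eq_in_sem rho rho' s : wt rho s -> uniq (fv s) -> {in fv s, rho =1 rho'} ->
  sem rho s = sem rho' s.
Proof.
move=> hw hu h; have hw' : wt rho' s by rewrite -(eq_in_wt h).
rewrite -{1}(subst_Var s) (@sem_subst _ _ i rho' rho) //.
  rewrite -[RHS]acomp_aid src_sem // /obs -map_comp; congr acomp.
  by apply/eq_in_map => n hn /=; rewrite h.
split=> //; first by rewrite all_predT.
by rewrite (flatten_map1 id) map_id.
Qed.

Definition den u s : arrow S := reo (fv s) (iota 0 (size u)) (sem (env u) s).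

Lemma den_fit u s a : typed (ctx_of u) s a -> src (den u s) = map i u /\ tgt (den u s) = i a.
Proof.
case/typed_ctx_ofP => hp hw <-; have hu : uniq (fv s) by rewrite (perm_uniq hp) iota_uniq.
split; last by rewrite tgt_reo tgt_sem.
rewrite (src_reo (h := i \o env u) hu hp) ?src_sem //.
by rewrite (map_comp i) map_env.
Qed.

Lemma den_tm_eq u a s t : tm_eq (ctx_of u) a s t -> den u s = den u t.
Proof. by rewrite (ctx_of_on (fun=> Tens [::])); apply: tm_eq_sound; exact: iota_uniq. Qed.

Definition Fhom u a (m : mor u a) : hom S (map i u) (i a) :=
  cast (proj1 (den_fit (repr_typed m))) (proj2 (den_fit (repr_typed m)))
    (projT2 (projT2 (den u (repr m)))).

Lemma Ar_Fhom u a (m : mor u a) : Ar (Fhom m) = den u (repr m).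
Proof. by rewrite Ar_cast; case: (den _ _) => ? [? ?]. Qed.

(** By soundness any term of the class computes the same arrow as the chosen representative. *)
Lemma Ar_Fhom_class u a s (hs : typed (ctx_of u) s a) : Ar (Fhom (class hs)) = den u s.
Proof. by rewrite Ar_Fhom; apply/esym; exact: den_tm_eq (tm_eq_repr hs). Qed.

Definition Farrow (m : arrow (F_aut H)) : arrow S := Ar (Fhom (projT2 (projT2 m))).

Lemma harrows_Fhom us v (fs : hlist (@mor H) us v) :
  harrows (hmap Fhom fs) = map Farrow (@harrows (seq type) type (@mor H) us v fs).
Proof. by elim: fs => //= u a us' v' f fs ->. Qed.

Lemma den_Var a : den [:: a] (Var 0) = aid (i a).
Proof. by rewrite /den /= reo_id. Qed.

Lemma sem_vars rho j k : map (sem rho) (vars H j k) = aids (obs i rho (iota j k)).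
Proof. by rewrite /vars /obs -!map_comp. Qed.

Lemma ty_vars rho j k : [seq i (ty_of rho x) | x <- vars H j k] = obs i rho (iota j k).
Proof. by rewrite (map_comp i) map_ty_vars /obs -map_comp. Qed.

Lemma obs_env u : obs i (env u) (iota 0 (size u)) = map i u.
Proof. exact: obs_iota. Qed.

Lemma den_re u : den u (Tup (vars H 0 (size u))) = are (map i u).
Proof.
rewrite /den /= fv_vars ty_vars sem_vars obs_env (acomp_aid (are (map i u))) reo_id ?iota_uniq //.
by rewrite size_iota size_map.
Qed.

Lemma den_gen u b (f : arr H u b) : den u (Op f (vars H 0 (size u))) = Ar (iarr i f).
Proof.
rewrite /den /= fv_vars sem_vars obs_env (acomp_aid (Ar (iarr i f))) reo_id ?iota_uniq //.
by rewrite size_iota size_map.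
Qed.

Lemma den_ev u a : den (Limp u a :: u) (App (Var 0) (Tup (vars H 1 (size u)))) =
  aev (map i u) (i a).
Proof.
have e : obs i (env (Limp u a :: u)) (iota 1 (size u)) = map i u.
  by have := obs_env (Limp u a :: u); rewrite /obs /= => -[].
rewrite /den /= fv_vars ty_vars sem_vars e aapp_re ?tgt_aids //; last by rewrite /tgt /= i_limp.
rewrite -[env _ 0]/(Limp u a) i_limp (acomp_aid (aev (map i u) (i a))) reo_id //.
  by rewrite -[_ :: _]/(iota 0 (size u).+1) iota_uniq.
by rewrite /= size_iota size_map.
Qed.

Lemma den_act u a p (m : mor u a) : is_perm (size u) p ->
  den (permute u p) (act_tm p m) = aact (den u (repr m)) p.
Proof.
move=> hp; have [hq hw ht] := (typed_ctx_ofP _ _ _).1 (repr_typed m).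
have hu : uniq (fv (repr m)) by rewrite (perm_uniq hq) iota_uniq.
have hup : uniq p by rewrite (perm_uniq hp) iota_uniq.
(* The permutation [p] is itself an order of the names [0, ..., size u - 1], so acting by [p] is
   reordering to [p]; the renaming [index^~ p] then numbers these names consecutively. *)
have ep : perm_to (iota 0 (size u)) p = p.
  rewrite -[RHS]map_id; apply/eq_in_map => x; rewrite (perm_mem hp) mem_iota /= => hx.
  have ex : nth 0 (iota 0 (size u)) x = x by rewrite nth_iota.
  by rewrite -{1}ex index_uniq ?size_iota ?iota_uniq.
have eu : permute u p = map (env u) p.
  by rewrite -{1}(map_env u) -{1}ep permute_to // => x; rewrite (perm_mem hp).
have szp : size p = size u by rewrite (perm_size hp) size_iota.
have ip x y : x \in p -> y \in p -> index x p = index y p -> x = y.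
  by move=> hx hy e; rewrite -(nth_index 0 hx) e nth_index.
have mp x : x \in fv (repr m) -> x \in p by rewrite (perm_mem hq) (perm_mem hp).
have henv : {in fv (repr m), env u =1 env (permute u p) \o index^~ p}.
  move=> x /mp hx /=; rewrite eu [RHS](ext_lt _ (Tens [::])) ?size_map ?index_mem //.
  by rewrite (nth_map 0) ?index_mem // nth_index.
have hqp : perm_eq (iota 0 (size u)) p by rewrite perm_sym.
have -> : aact (den u (repr m)) p = reo (fv (repr m)) p (sem (env u) (repr m)).
  by rewrite -{1}ep -/(reo (iota 0 (size u)) p _) /den reo_comp ?size_src_sem.
rewrite /den /act_tm fv_ren size_permute // sem_ren; last 2 first.
- by rewrite -(eq_in_wt henv).
- by rewrite map_inj_in_uniq // => x y hx hy; apply: ip; exact: mp.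
rewrite -(eq_in_sem hw hu henv) -szp -(perm_toE hup) /perm_to reo_map //.
- by move=> x y hx hy; apply: ip; exact: mp.
- by move=> x; rewrite (perm_mem hp) (perm_mem hq).
Qed.

(** Each representative is shifted to its own block of variables, so its denotation has its sources
    named by that block, the list [l] of the statement. *)
Lemma den_reprs us v (fs : hlist (@mor H) us v) k rho c p :
  (forall j, j < size (flatten us) -> rho (k + j) = env (flatten us) j) ->
  forall x, x < size v ->
  let q := nth p (reprs k fs) x in
  let l := nth [::] (reshape (shape us) (iota k (sumn (shape us)))) x in
  [/\ nth c (map Farrow (@harrows (seq type) type (@mor H) us v fs)) x = reo (fv q) l (sem rho q),
     perm_eq (fv q) l, wt rho q & ty_of rho q = env v x].
Proof.
elim: fs k rho => [|u a us' v' f fs IH] k rho hrho [|x] // hx.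
  rewrite /= iotaD take_size_cat ?size_iota // -[k in iota k _]addn0 iotaDl.
  have [hq hw ht] := (typed_ctx_ofP _ _ _).1 (repr_typed f).
  have hu : uniq (fv (repr f)) by rewrite (perm_uniq hq) iota_uniq.
  have he : {in fv (repr f), env u =1 rho \o addn k}.
    move=> n; rewrite (perm_mem hq) mem_iota /= => hn.
    by rewrite hrho ?env_cat // size_cat ltn_addr.
  rewrite fv_ren wt_ren ty_ren -(eq_in_wt he) -(eq_in_ty he) perm_map //; split=> //.
  rewrite sem_ren ?(map_inj_uniq (@addnI k)) -?(eq_in_wt he) //.
  rewrite -(eq_in_sem hw hu he) /Farrow /= Ar_Fhom reo_map // => [y z _ _|y]; first exact: addnI.
  by rewrite (perm_mem hq).
rewrite /= iotaD drop_size_cat ?size_iota //.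
have [|//|h1 h2 h3 h4] := IH (k + size u) rho _ x.
  by move=> j hj; rewrite -addnA hrho ?env_addn // size_cat ltn_add2l.
by split=> //; rewrite h4 -[x.+1]add1n -(env_addn [:: a]).
Qed.

Lemma size_hlist A B (R : A -> B -> Type) v w (h : hlist R v w) : size v = size w.
Proof. by elim: h => //= a b u' v' _ _ ->. Qed.

Lemma size_harrows A B (R : A -> B -> Type) v w (h : hlist R v w) : size (harrows h) = size w.
Proof. by elim: h => //= a b u' v' _ _ ->. Qed.

(** [sem_subst] with the sources put into the order of the contexts. [N x] is the block of variables
    of the representative plugged in at [x], and these blocks in order make up the context of the
    composite. *)
Lemma den_comp us v b (g : mor v b) (fs : hlist (@mor H) us v) :
  den (flatten us) (comp_tm g fs) =
  acomp (den v (repr g)) (map Farrow (@harrows (seq type) type (@mor H) us v fs)).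
Proof.
have [hq hw ht] := (typed_ctx_ofP _ _ _).1 (repr_typed g).
have hu : uniq (fv (repr g)) by rewrite (perm_uniq hq) iota_uniq.
pose rho := env (flatten us); pose r n := nth (Var n) (reprs 0 fs) n.
pose Bs := reshape (shape us) (iota 0 (sumn (shape us))); pose N x := nth [::] Bs x.
set Gs := map Farrow _; pose c := aid (i (Tens [::])); pose G x := nth c Gs x.
have hx x : x \in fv (repr g) -> [/\ G x = reo (fv (r x)) (N x) (sem rho (r x)),
    perm_eq (fv (r x)) (N x), wt rho (r x) & ty_of rho (r x) = env v x].
  by rewrite (perm_mem hq) mem_iota /= => h; apply: den_reprs.
have eG : map G (iota 0 (size v)) = Gs.
  by rewrite -(size_harrows fs) -(size_map Farrow) map_nth_iota0 // take_size.
have eB : flatten (map N (iota 0 (size v))) = iota 0 (size (flatten us)).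
  have sB : size Bs = size v by rewrite size_reshape size_map (size_hlist fs).
  by rewrite -sB map_nth_iota0 // take_size reshapeKr ?size_flatten ?size_iota.
have pN : perm_eq (flatten (map N (fv (repr g)))) (iota 0 (size (flatten us))).
  by rewrite -eB; exact: perm_flatten (perm_map _ hq).
have uN : uniq (flatten (map N (fv (repr g)))) by rewrite (perm_uniq pN) iota_uniq.
have pfN : perm_eq (fv (subst r (repr g))) (flatten (map N (fv (repr g)))).
  rewrite fv_subst; elim: (fv (repr g)) hx => //= x l IH hx; apply: perm_cat.
    by case: (hx x (mem_head _ _)).
  by apply: IH => y hy; apply: hx; rewrite inE hy orbT.
have ufN : uniq (fv (subst r (repr g))) by rewrite (perm_uniq pfN).
have hf : fits (env v) rho r (fv (repr g)).
  split; [by move=> x /hx[]|by apply/allP => x /hx[]|by rewrite -fv_subst].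
have tG : [seq tgt (G x) | x <- fv (repr g)] = src (sem (env v) (repr g)).
  rewrite src_sem //; apply/eq_in_map => x hxx; have [-> _ h3 h4] := hx x hxx.
  by rewrite tgt_reo tgt_sem ?h4 //; have [] := fits1 hf hxx.
have sr : {in fv (repr g), forall x, size (src (sem rho (r x))) = size (fv (r x))}.
  by move=> x hxx; have [_ h2 h3] := fits1 hf hxx; rewrite size_src_sem.
have sG : {in fv (repr g), forall x, size (src (G x)) = size (N x)}.
  move=> x hxx; have [-> h2 h3 h4] := hx x hxx; have [_ _ h5] := fits1 hf hxx.
  by rewrite (src_reo (h := i \o rho) h5 h2) ?size_map // src_sem.
have es : acomp (sem (env v) (repr g)) (map G (fv (repr g))) =
    reo (fv (subst r (repr g))) (flatten (map N (fv (repr g)))) (sem rho (subst r (repr g))).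
  rewrite (sem_subst i hw hu hf) fv_subst -acomp_reor //.
  - by congr acomp; apply/eq_in_map => x /hx[].
  - by rewrite -fv_subst.
  - by move=> x /hx[].
  - by have := fits_tgt i hf; rewrite -map_comp => ->; rewrite src_sem.
have ws : wt rho (subst r (repr g)).
  by case: hf => h1 h2 _; rewrite (wt_subst h1) hw.
rewrite -eG /den (acomp_reol (N := N)) // es eB reo_comp ?size_src_sem //.
Qed.

Definition free_functor : autonomous_functor (F_aut H) S.
Proof.
refine (@AutonomousFunctor (F_aut H) S i Fhom _ _ _ (i_tens i) (i_limp i) _ _).
- move=> a; apply: Ar_inj; apply: etrans (Ar_Fhom_class (typed_idm a)) _; exact: den_Var.
- move=> us v b g fs e; apply: Ar_inj; rewrite Ar_cast -acompE harrows_Fhom.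
  apply: etrans (Ar_Fhom_class (typed_comp g fs)) _; rewrite Ar_Fhom; exact: den_comp.
- move=> u a m p hp hp' e; apply: Ar_inj; rewrite Ar_cast -aactE.
  apply: etrans (Ar_Fhom_class (typed_act m hp)) _; rewrite Ar_Fhom; exact: den_act.
- move=> u e; apply: Ar_inj; rewrite Ar_cast.
  apply: etrans (Ar_Fhom_class (typed_re u)) _; exact: den_re.
- move=> u a e; apply: Ar_inj; rewrite Ar_cast.
  apply: etrans (Ar_Fhom_class (typed_ev u a)) _; exact: den_ev.
Defined.

Lemma free_functor_gen u b (f : arr H u b) : fhom free_functor (gen_mor f) = iarr i f.
Proof.
apply: Ar_inj; apply: etrans (Ar_Fhom_class (typed_gen f)) _; exact: den_gen.
Qed.

End Functor.

(** * Equivalence of terms is compatible with substitution *)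

Section Compatibility.
Variable H : autonomous_signature.
Notation type := (type H).
Implicit Types (s t g : tm H) (ts : seq (tm H)) (u : seq type) (rho : nat -> type) (C : ctx H).

Lemma typing_plug C rho s t : wt (cext C rho) t -> ty_of (cext C rho) t = ty_of (cext C rho) s ->
  perm_eq (fv s) (fv t) -> wt rho (plug C s) ->
  [/\ wt rho (plug C t), ty_of rho (plug C t) = ty_of rho (plug C s) &
      perm_eq (fv (plug C s)) (fv (plug C t))].
Proof.
elim: C rho => [|u C IH|C IH p|p C IH|l C IH r|u C IH p|u p C IH|u b f l C IH r] rho hw ht hp //=.
- case/andP=> hb /(IH _ hw ht hp)[h1 h2 h3].
  by rewrite h1 h2 -(binds_perm _ h3) hb lower_perm.
- by case/and3P=> /(IH _ hw ht hp)[-> -> h3] -> ->; rewrite perm_cat.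
- by case/and3P=> -> /(IH _ hw ht hp)[-> -> h3] ->; rewrite perm_cat2l.
- rewrite !all_cat !map_cat /= => /and3P[-> /(IH _ hw ht hp)[-> -> h3] ->]; split=> //.
  by rewrite !flatten_cat /= perm_cat2l perm_cat2r.
- case/and4P=> -> -> hb /(IH _ hw ht hp)[h1 h2 h3].
  by rewrite h1 h2 -(binds_perm _ h3) hb perm_cat2l lower_perm.
- by case/and4P=> /(IH _ hw ht hp)[-> -> h3] -> -> ->; rewrite perm_cat2r.
- rewrite !all_cat !map_cat /= => /andP[/and3P[-> /(IH _ hw ht hp)[-> -> h3] ->] ->]; split=> //.
  by rewrite !flatten_cat /= perm_cat2l perm_cat2r.
Qed.

Lemma tm_eq_typed c a s t : tm_eq c a s t -> typed c s a <-> typed c t a.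
Proof. by elim=> {s t} [s t [hs ht _]|s|s t _ ->|s t p _ -> _ ->]. Qed.

(** Expansions are not closed under all contexts, so the contexts used for congruence must be ones
    that preserve [is_E] and [is_D]. In the two below the hole is shielded from the head of the
    application by a [Lam], or lies inside a tuple in argument position. *)
Definition red_closed C := forall s t, red_aut s t -> red_aut (plug C s) (plug C t).

Lemma red_closed_AppLam u t : red_closed (CAppL (CLam u Hole) t).
Proof.
move=> _ _ [] C s p => [h|h|hC h|hC h].
- exact: (Red_beta1 (CAppL (CLam u C) t) h).
- exact: (Red_beta2 (CAppL (CLam u C) t) h).
- exact: (@Red_eta1 _ (CAppL (CLam u C) t) _ _ hC h).
- exact: (@Red_eta2 _ (CAppL (CLam u C) t) _ _ hC h).
Qed.

Lemma red_closed_AppTup s l r : red_closed (CAppR s (CTup l Hole r)).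
Proof.
move=> _ _ [] C p q => [h|h|hC h|hC h].
- exact: (Red_beta1 (CAppR s (CTup l C r)) h).
- exact: (Red_beta2 (CAppR s (CTup l C r)) h).
- exact: (@Red_eta1 _ (CAppR s (CTup l C r)) _ _ hC h).
- exact: (@Red_eta2 _ (CAppR s (CTup l C r)) _ _ hC h).
Qed.

Lemma tm_eq_plug C rho l m a b s t : red_closed C -> uniq l -> uniq m ->
  tm_eq (ctx_on (cext C rho) m) a s t -> typed (ctx_on (cext C rho) m) s a ->
  typed (ctx_on rho l) (plug C s) b ->
  tm_eq (ctx_on rho l) b (plug C s) (plug C t) /\ typed (ctx_on rho l) (plug C t) b.
Proof.
move=> hC hl hm.
have rep p q : typed (ctx_on (cext C rho) m) p a -> typed (ctx_on (cext C rho) m) q a ->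
    typed (ctx_on rho l) (plug C p) b -> typed (ctx_on rho l) (plug C q) b.
  move=> /(typedP _ _ _ hm)[p1 p2 p3] /(typedP _ _ _ hm)[q1 q2 q3] /(typedP _ _ _ hl)[h1 h2 h3].
  have [||||k1 k2 k3] // := @typing_plug C rho p q; first by rewrite q3.
    by rewrite (permPl p1) perm_sym.
  by apply/(typedP _ _ _ hl); rewrite k1 k2; split=> //; rewrite -(permPl k3).
elim=> {s t} [s t [hs ht h] _ hp|s|s t h IH ht hp|s t p h1 IH1 h2 IH2 hs hp].
- have hq := rep _ _ hs ht hp; split=> //; apply: rst_step; split=> //.
  by case: h => [h|h]; [left; exact: SE_ctx|right; exact: hC].
- by split=> //; exact: rst_refl.
- have hs := (tm_eq_typed h).2 ht; have hq := rep _ _ ht hs hp.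
  by have [k1 _] := IH hs hq; split=> //; exact: rst_sym.
- have ht := (tm_eq_typed h1).1 hs; have [k1 k2] := IH1 hs hp; have [k3 k4] := IH2 ht k2.
  by split=> //; exact: rst_trans k1 k3.
Qed.

Lemma lower_perm_iota k (l : seq nat) : perm_eq l (iota 0 k) -> lower k l = [::].
Proof. by move/(lower_perm k); rewrite lower_iota => /perm_nilP. Qed.

Lemma ext_env u rho s : perm_eq (fv s) (iota 0 (size u)) -> {in fv s, ext u rho =1 env u}.
Proof.
by move=> hp n; rewrite (perm_mem hp) mem_iota /= => hn; rewrite /env !(ext_lt _ (Tens [::]) hn).
Qed.

Lemma typed_app_lam rho l u b g ts : uniq l -> typed (ctx_of u) g b ->
  all (wt rho) ts -> map (ty_of rho) ts = u -> perm_eq (flatten (map fv ts)) l ->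
  typed (ctx_on rho l) (App (Lam u g) (Tup ts)) b.
Proof.
move=> hl /typed_ctx_ofP[hp hw <-] hts et hf; apply/(typedP _ _ _ hl); split=> /=.
- by rewrite lower_perm_iota.
- rewrite hts et eqxx (eq_in_wt (ext_env rho hp)) hw !andbT.
  by rewrite (binds_perm _ hp) binds_iota.
- by rewrite (eq_in_ty (ext_env rho hp)).
Qed.

(** Used mostly from right to left: in the expanded form [g] and the [ts] sit in the holes of
    contexts that are closed under reduction, so equivalences apply to them directly. *)
Lemma tm_eq_beta rho l u b g ts : uniq l -> typed (ctx_of u) g b ->
  all (wt rho) ts -> map (ty_of rho) ts = u -> perm_eq (flatten (map fv ts)) l ->
  tm_eq (ctx_on rho l) b (App (Lam u g) (Tup ts)) (subst (inst ts) g).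
Proof.
move=> hl hg hts et hf; apply: rst_step; split; first exact: typed_app_lam.
  have [hp hw <-] := (typed_ctx_ofP _ _ _).1 hg; apply/(typedP _ _ _ hl).
  have hb : binds (size ts) (fv g) by rewrite (binds_perm _ hp) -et size_map binds_iota.
  split.
  - rewrite (permPl (perm_fv_inst hb)) lower_perm_iota ?cats0 //.
    by rewrite -(size_map (ty_of rho)) et.
  - by rewrite wt_inst all_wt_inst // hts et (eq_in_wt (ext_env rho hp)) hw.
  - by apply: ty_subst => n hn; rewrite ty_inst et (ext_env rho hp).
right; rewrite -inst_outE; apply: (Red_beta2 Hole).
by apply: (@Beta2 _ Hole) => //; rewrite -et size_map.
Qed.

(** A renaming is an instantiation by variables, so it can be written as a redex with the renamed
    term below the abstraction. *)
Lemma tm_eq_ren rho u a f s t : uniq (map f (iota 0 (size u))) ->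
  {in iota 0 (size u), forall n, rho (f n) = env u n} -> typed (ctx_of u) s a ->
  tm_eq (ctx_of u) a s t ->
  tm_eq (ctx_on rho (map f (iota 0 (size u)))) a (ren f s) (ren f t).
Proof.
move=> hu hrho hs h; have ht := (tm_eq_typed h).1 hs.
pose ts := map (@Var H \o f) (iota 0 (size u)).
have sts : size ts = size u by rewrite size_map size_iota.
have hw : all (wt rho) ts by rewrite all_map; apply/allP.
have et : map (ty_of rho) ts = u.
  by rewrite -[RHS]map_env -map_comp; apply/eq_in_map => n /hrho.
have hf : perm_eq (flatten (map fv ts)) (map f (iota 0 (size u))).
  by rewrite -map_comp (flatten_map1 f).
have e p : typed (ctx_of u) p a -> subst (inst ts) p = ren f p.
  case/typed_ctx_ofP => hp _ _; rewrite renE; apply: eq_in_subst => n.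
  rewrite (perm_mem hp) mem_iota /= => hn.
  by rewrite /inst (nth_map 0) ?size_iota // nth_iota.
have b1 := tm_eq_beta hu hs hw et hf; have b2 := tm_eq_beta hu ht hw et hf.
(* Expand, change the body of the abstraction, and contract again. *)
rewrite -(e _ hs) -(e _ ht); apply: rst_trans (rst_sym _ _ _ _ b1) _; apply: rst_trans b2.
have := @tm_eq_plug (CAppL (CLam u Hole) (Tup ts)) rho (map f (iota 0 (size u)))
  (iota 0 (size u)) a a s t (@red_closed_AppLam _ _) hu (iota_uniq _ _).
rewrite /= -ctx_of_on => /(_ h hs)[] //; exact: typed_app_lam.
Qed.

(** The counterpart of [reprs] for representatives other than the chosen ones. *)
Fixpoint shift_terms k (us : seq (seq type)) (qs : seq (tm H)) : seq (tm H) :=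
  match us, qs with
  | u :: us, q :: qs => ren (addn k) q :: shift_terms (k + size u) us qs
  | _, _ => [::]
  end.

Fixpoint represent us v (fs : hlist (@mor H) us v) (qs : seq (tm H)) : Prop :=
  match fs, qs with
  | hnil, [::] => True
  | hcons u a _ _ f fs, q :: qs => tm_eq (ctx_of u) a (repr f) q /\ represent fs qs
  | _, _ => False
  end.

Lemma reprs_typing rho us v (fs : hlist (@mor H) us v) k :
  (forall j, j < size (flatten us) -> rho (k + j) = env (flatten us) j) ->
  [/\ all (wt rho) (reprs k fs), map (ty_of rho) (reprs k fs) = v &
      perm_eq (flatten (map fv (reprs k fs))) (iota k (size (flatten us)))].
Proof.
elim: fs k => [|u a us' v' f fs IH] k hrho //=.
have [hq hw ht] := (typed_ctx_ofP _ _ _).1 (repr_typed f).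
have he : {in fv (repr f), env u =1 rho \o addn k}.
  move=> n; rewrite (perm_mem hq) mem_iota /= => hn.
  by rewrite hrho ?env_cat // size_cat ltn_addr.
have [|h1 h2 h3] := IH (k + size u).
  by move=> j hj; rewrite -addnA hrho ?env_addn // size_cat ltn_add2l.
rewrite h1 h2 wt_ren ty_ren -(eq_in_wt he) -(eq_in_ty he) hw ht fv_ren; split=> //.
by rewrite size_cat iotaD perm_cat // -{2}(addn0 k) iotaDl perm_map.
Qed.

(** The components of the tuple are exchanged one at a time; [ts] collects those already dealt
    with. *)
Lemma tm_eq_reprs rho l b us v s (fs : hlist (@mor H) us v) qs k ts :
  represent fs qs -> uniq l ->
  (forall j, j < size (flatten us) -> rho (k + j) = env (flatten us) j) ->
  typed (ctx_on rho l) (App s (Tup (ts ++ reprs k fs))) b ->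
  tm_eq (ctx_on rho l) b (App s (Tup (ts ++ reprs k fs)))
    (App s (Tup (ts ++ shift_terms k us qs))).
Proof.
elim: fs qs k ts => [|u a us' v' f fs IH] [|q qs] k ts //= => [_ _ _ _|].
  exact: rst_refl.
case=> hq hqs hl hrho ht.
have hk : {in iota 0 (size u), forall n, rho (k + n) = env u n}.
  by move=> n; rewrite mem_iota /= => hn; rewrite hrho ?env_cat // size_cat ltn_addr.
have hu : uniq (map (addn k) (iota 0 (size u))) by rewrite (map_inj_uniq (@addnI k)) iota_uniq.
have h := tm_eq_ren hu hk (repr_typed f) hq.
have hr : typed (ctx_on rho (map (addn k) (iota 0 (size u)))) (ren (addn k) (repr f)) a.
  have [hp hw ea] := (typed_ctx_ofP _ _ _).1 (repr_typed f).
  have he : {in fv (repr f), env u =1 rho \o addn k}.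
    by move=> n; rewrite (perm_mem hp) => /hk <-.
  apply/(typedP _ _ _ hu); rewrite fv_ren wt_ren ty_ren -(eq_in_wt he) -(eq_in_ty he).
  by rewrite perm_map.
have := @tm_eq_plug (CAppR s (CTup ts Hole (reprs (k + size u) fs))) rho l _ a b _ _
  (@red_closed_AppTup _ _ _) hl hu h hr ht.
case=> /= h1 h2; apply: rst_trans h1 _.
have := IH qs (k + size u) (rcons ts (ren (addn k) q)) hqs hl; rewrite !cat_rcons; apply=> //.
by move=> j hj; rewrite -addnA hrho ?env_addn // size_cat ltn_add2l.
Qed.

(** Composites of classes may be computed on any representatives. The composite is expanded to an
    abstraction applied to a tuple, the body and then the components are replaced, and the redex is
    contracted; reductions never have to be commuted with substitution. *)
Lemma tm_eq_comp us v b (g : mor v b) (fs : hlist (@mor H) us v) p qs :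
  tm_eq (ctx_of v) b (repr g) p -> represent fs qs ->
  tm_eq (ctx_of (flatten us)) b (comp_tm g fs) (subst (inst (shift_terms 0 us qs)) p).
Proof.
move=> hg hfs; pose rho := env (flatten us); pose l := iota 0 (size (flatten us)).
have hl : uniq l by exact: iota_uniq.
have [|h1 h2 h3] := @reprs_typing rho us v fs 0; first by [].
have [hq hw hb] := (typed_ctx_ofP _ _ _).1 (repr_typed g).
have -> : comp_tm g fs = subst (inst (reprs 0 fs)) (repr g).
  apply: eq_in_subst => n; rewrite (perm_mem hq) mem_iota /= => hn.
  by apply: set_nth_default; rewrite -(size_map (ty_of rho)) h2.
rewrite (ctx_of_on (fun=> Tens [::])) -/(env _) -/rho -/l.
have b1 := tm_eq_beta hl (repr_typed g) h1 h2 h3.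
have t1 : typed (ctx_on rho l) (App (Lam v (repr g)) (Tup (reprs 0 fs))) b.
  exact: typed_app_lam (repr_typed g) h1 h2 h3.
apply: rst_trans (rst_sym _ _ _ _ b1) _.
have [] := @tm_eq_plug (CAppL (CLam v Hole) (Tup (reprs 0 fs))) rho l (iota 0 (size v)) b b (repr g) p
  (@red_closed_AppLam _ _) hl (iota_uniq _ _).
- by rewrite /= -ctx_of_on.
- by rewrite /= -ctx_of_on; exact: repr_typed.
- exact: t1.
rewrite /= => b2 t2; apply: rst_trans b2 _.
have b3 := @tm_eq_reprs rho l b us v (Lam v p) fs qs 0 [::] hfs hl _ t2.
apply: rst_trans (b3 _) _ => //.
have t3 := (tm_eq_typed (b3 (fun j _ => erefl))).1 t2.
have /(typedP _ _ _ hl) /= [k1 /and3P[_ k2 /eqP[k3]] _] := t3.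
have hp := (tm_eq_typed hg).1 (repr_typed g).
apply: tm_eq_beta => //.
have [hpp _ _] := (typed_ctx_ofP _ _ _).1 hp.
by move: k1; rewrite lower_perm_iota.
Qed.

End Compatibility.

(** * The free multicategory with named sources *)

Section NamedClasses.
Variable H : autonomous_signature.
Notation type := (type H).
Notation FH := (F_aut H).
Implicit Types (s t g : tm H) (ts : seq (tm H)) (u : seq type) (rho : nat -> type)
  (r : nat -> tm H).

(** Total, with an arbitrary identity for ill-typed terms, so that equations between classes do not
    mention typing proofs. *)
Definition cl u a s : arrow FH :=
  match pselect (typed (ctx_of u) s a) with
  | left h => @Ar FH u a (class h)
  | right _ => @aid FH (Tens [::])
  end.

Lemma clE u a s (h : typed (ctx_of u) s a) : cl u a s = @Ar FH u a (class h).
Proof. by rewrite /cl; case: pselect => // h'; rewrite (Prop_irrelevance h h'). Qed.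

Lemma cl_eq u a s t : typed (ctx_of u) s a -> tm_eq (ctx_of u) a s t -> cl u a s = cl u a t.
Proof.
move=> hs h; have ht := (tm_eq_typed h).1 hs.
by rewrite (clE hs) (clE ht) (class_eq hs ht h).
Qed.

Lemma tm_eq_exchange c d a s t : Permutation c d -> tm_eq c a s t -> tm_eq d a s t.
Proof.
move=> hp; elim=> {s t} [s t [hs ht h]|s|s t _ h|s t p _ h1 _ h2].
- by apply: rst_step; split=> //; apply: exchange hp.
- exact: rst_refl.
- exact: rst_sym.
- exact: rst_trans h1 h2.
Qed.

Lemma eq_in_ren f f' s : {in fv s, f =1 f'} -> ren f s = ren f' s.
Proof. by move=> h; rewrite !renE; apply: eq_in_subst => n /h /= ->. Qed.

(* The class of [s] with its free variables, named by [l], as sources. *)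
Definition nm (l : seq nat) rho s : arrow FH := cl (map rho l) (ty_of rho s) (ren (index^~ l) s).

Definition named (l : seq nat) rho s : Prop := [/\ wt rho s, uniq l & perm_eq (fv s) l].

Lemma env_index (l : seq nat) rho : {in l, env (map rho l) \o index^~ l =1 rho}.
Proof.
move=> n hn; rewrite /= /env (ext_lt _ (Tens [::])) ?size_map ?index_mem //.
by rewrite (nth_map 0) ?index_mem // nth_index.
Qed.

Lemma map_index_perm (l l' : seq nat) : uniq l -> perm_eq l' l ->
  perm_eq [seq index y l | y <- l'] (iota 0 (size l)).
Proof. by move=> hu hp; rewrite -(perm_toE hu); exact: perm_map. Qed.

Lemma nm_typed l rho s : named l rho s ->
  typed (ctx_of (map rho l)) (ren (index^~ l) s) (ty_of rho s).
Proof.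
case=> hw hu hp; have he : {in fv s, rho =1 env (map rho l) \o index^~ l}.
  by move=> n; rewrite (perm_mem hp) => /env_index ->.
apply/typed_ctx_ofP; rewrite fv_ren size_map wt_ren ty_ren -(eq_in_wt he) -(eq_in_ty he).
by split=> //; exact: map_index_perm.
Qed.

Lemma nm_src l rho s : named l rho s -> src (nm l rho s) = map rho l.
Proof. by move=> h; rewrite /nm (clE (nm_typed h)). Qed.

Lemma nm_tgt l rho s : named l rho s -> tgt (nm l rho s) = ty_of rho s.
Proof. by move=> h; rewrite /nm (clE (nm_typed h)). Qed.

Lemma nm_fv rho s : wt rho s -> uniq (fv s) -> named (fv s) rho s.
Proof. by split. Qed.

Lemma nth_shift_terms k (X : nat -> seq nat) (rho : nat -> type) r (xs : seq nat) p :
  uniq (flatten (map X xs)) -> {in xs, forall x, {subset fv (r x) <= X x}} ->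
  {in xs, forall x, nth p (shift_terms k [seq map rho (X x) | x <- xs]
     [seq ren (index^~ (X x)) (r x) | x <- xs]) (index x xs) =
    ren (fun y => k + index y (flatten (map X xs))) (r x)}.
Proof.
elim: xs k => //= x xs IH k; rewrite cat_uniq => /and3P[h1 /hasPn h2 h3] hs y.
have hs' : {in xs, forall x, {subset fv (r x) <= X x}}.
  by move=> z hz; apply: hs; rewrite inE hz orbT.
rewrite inE; case: (eqVneq y x) => [-> _|nyx /= hy].
  rewrite /= ren_comp; apply: eq_in_ren => n hn /=.
  by rewrite index_cat hs ?mem_head.
rewrite /= IH // size_map; apply: eq_in_ren => n /(hs' _ hy) hn.
have hnF : n \in flatten (map X xs) by apply/flatten_mapP; exists y.
by rewrite index_cat (negbTE (h2 _ hnF)) addnA.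
Qed.

(** The syntactic counterpart of [sem_subst]. [comp] substitutes terms over consecutive blocks of
    variables, and numbering the names in [flatten (map X xs)] produces exactly these blocks. *)
Lemma nm_comp xs rho g (X : nat -> seq nat) rho' r :
  named xs rho g ->
  {in xs, forall x, named (X x) rho' (r x) /\ ty_of rho' (r x) = rho x} ->
  uniq (flatten (map X xs)) ->
  acomp (nm xs rho g) [seq nm (X x) rho' (r x) | x <- xs] =
  nm (flatten (map X xs)) rho' (subst r g).
Proof.
move=> hg hX hF; have [hw hu hp] := hg.
have [us [v [fs [v_e us_e fs_e fs_r]]]] : exists us v (fs : hlist (@mor H) us v),
    [/\ v = map rho xs, us = [seq map rho' (X x) | x <- xs],
      [seq nm (X x) rho' (r x) | x <- xs] = @harrows (seq type) type (@mor H) us v fs &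
      represent fs [seq ren (index^~ (X x)) (r x) | x <- xs]].
  elim: (xs) hX => [|x l IH] hX /=; first by exists [::], [::], hnil.
  have [|us [v [fs [e1 e2 e3 e4]]]] := IH; first by move=> y hy; apply: hX; rewrite inE hy orbT.
  have [hn et] := hX _ (mem_head _ _); have ht := nm_typed hn.
  exists (map rho' (X x) :: us), (ty_of rho' (r x) :: v), (hcons (class ht) fs); split=> /=.
  - by rewrite e1 et.
  - by rewrite e2.
  - by rewrite e3 /nm (clE ht).
  - by split=> //; exact: rst_sym (tm_eq_repr ht).
subst v; have ht := nm_typed hg.
rewrite fs_e {1}/nm (clE ht) (@acompE FH us (map rho xs)).
rewrite -[comp _ _]/(class (typed_comp (class ht) fs)) -clE /nm.
have hty : {in fv g, forall n, ty_of rho' (r n) = rho n}.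
  by move=> n; rewrite (perm_mem hp) => /hX[].
rewrite (ty_subst hty).
have -> : map rho' (flatten (map X xs)) = flatten us by rewrite us_e map_flatten -map_comp.
rewrite (cl_eq (typed_comp (class ht) fs) (tm_eq_comp (rst_sym _ _ _ _ (tm_eq_repr ht)) fs_r)).
congr cl; rewrite subst_ren ren_subst; apply: eq_in_subst => n; rewrite (perm_mem hp) => hn /=.
(* The default passed here is the one that [inst] gives to [nth]. *)
rewrite us_e; have := @nth_shift_terms 0 X rho' r xs (Var (index n xs - size (shift_terms 0 us [seq ren (index^~ (X x)) (r x) | x <- xs]))) hF _ n hn.
rewrite us_e /inst => -> // x /hX[[_ _ hpx] _] y.
by rewrite (perm_mem hpx).
Qed.

(** Renumbering by [l] and then by the permutation is renumbering by [l']; the action on classes may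
    be computed on this representative by [tm_eq_ren]. *)
Lemma nm_reo l l' rho s : named l rho s -> perm_eq l l' ->
  nm l' rho s = aact (nm l rho s) (perm_to l l').
Proof.
move=> hn hll; have [hw hu hp] := hn; have ht := nm_typed hn.
have hn' : named l' rho s.
  by split=> //; [rewrite -(perm_uniq hll)|exact: perm_trans hp hll].
have hpp : is_perm (size (map rho l)) (perm_to l l') by rewrite size_map is_perm_to.
rewrite {2}/nm (clE ht) (@aactE FH _ _ _ hpp).
rewrite -[act _ _]/(class (typed_act (class ht) hpp)) -clE /nm /act_tm.
have sub : {subset l' <= l} by move=> x; rewrite (perm_mem hll).
have eu : permute (map rho l) (perm_to l l') = map rho l' by rewrite permute_to.
have et : ren (index^~ (perm_to l l')) (ren (index^~ l) s) = ren (index^~ l') s.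
  rewrite ren_comp; apply: eq_in_ren => n hn1 /=; apply: index_in_map.
    move=> x y /sub hx /sub hy e; rewrite -(nth_index 0 hx) e nth_index //.
  by rewrite -(perm_mem hll) -(perm_mem hp).
rewrite eu -et; apply/esym; apply: cl_eq.
  by rewrite -eu; exact: typed_act.
have upl : uniq (perm_to l l') by rewrite (perm_uniq hpp) iota_uniq.
have hrho : {in iota 0 (size (map rho l)), forall n,
    env (map rho l') (index n (perm_to l l')) = env (map rho l) n}.
  move=> n; rewrite -(perm_mem hpp) => hm; have hm' := hm; case/mapP: hm' => y hy e.
  have hi : index n (perm_to l l') < size l' by rewrite -(size_map (index^~ l)) index_mem.
  rewrite {1}/env (ext_lt _ (Tens [::])) ?size_map // (nth_map 0) //.
  rewrite e /perm_to (@index_in_map _ _ (index^~ l)) //; last by move=> x z /sub hx /sub hz e'; rewrite -(nth_index 0 hx) e' nth_index.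
  by rewrite nth_index // -(env_index rho (sub _ hy)).
have hmu : uniq (map (index^~ (perm_to l l')) (iota 0 (size (map rho l)))).
  rewrite map_inj_in_uniq ?iota_uniq // => x y; rewrite -!(perm_mem hpp) => hx hy e.
  by rewrite -(nth_index 0 hx) e nth_index.
have := tm_eq_ren hmu hrho (repr_typed (class ht)) (rst_sym _ _ _ _ (tm_eq_repr ht)).
apply: tm_eq_exchange; rewrite [ctx_of (map rho l')](ctx_of_on (fun=> Tens [::])).
apply: Permutation_map; apply: perm_eq_Permutation.
have -> : size (map rho l') = size (perm_to l l') by rewrite !size_map.
rewrite -(perm_toE upl); apply: perm_map; by rewrite perm_sym.
Qed.

Lemma nm_ren l rho f s : named l (rho \o f) s -> {in l &, injective f} ->
  nm (map f l) rho (ren f s) = nm l (rho \o f) s.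
Proof.
case=> hw hu hp hf; rewrite /nm ty_ren -map_comp ren_comp; congr cl.
by apply: eq_in_ren => n; rewrite (perm_mem hp) => hn /=; exact: index_in_map.
Qed.

Lemma eq_in_nm l rho rho' s : perm_eq (fv s) l -> {in l, rho =1 rho'} -> nm l rho s = nm l rho' s.
Proof.
move=> hp h; rewrite /nm; congr cl; first exact/eq_in_map.
by apply: eq_in_ty => n; rewrite (perm_mem hp) => /h.
Qed.

Lemma nm_red l rho s t : named l rho s -> named l rho t -> ty_of rho t = ty_of rho s ->
  red_aut (ren (index^~ l) s) (ren (index^~ l) t) -> nm l rho s = nm l rho t.
Proof.
move=> hs ht e hr; rewrite /nm e; apply: cl_eq; first exact: nm_typed.
apply: rst_step; split; [exact: nm_typed| |by right].
by rewrite -e; exact: nm_typed.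
Qed.

Lemma ren_inst f ts s : ren f (subst (inst ts) s) =
  subst (inst (map (ren f) ts)) (ren (upren (size ts) f) s).
Proof.
rewrite ren_subst subst_ren; congr subst; apply: funext => n /=.
rewrite /upren; case: ltnP => h.
  rewrite /inst (nth_map (Var (n - size ts))) //.
by rewrite -{1}(size_map (ren f)) inst_ge /inst nth_default.
Qed.

Lemma nm_Var n rho : nm [:: n] rho (Var n) = @aid FH (rho n).
Proof. by rewrite /nm /= eqxx (clE (typed_idm (rho n))). Qed.

Lemma index_iota0 k n : n < k -> index n (iota 0 k) = n.
Proof. by move=> h; rewrite -{1}[n](nth_iota 0 0 h) index_uniq ?iota_uniq ?size_iota. Qed.

Lemma nm_iota u s a : typed (ctx_of u) s a -> nm (iota 0 (size u)) (env u) s = cl u a s.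
Proof.
case/typed_ctx_ofP => hp _ ht; rewrite /nm map_env ht; congr cl.
rewrite -[RHS]ren_id; apply: eq_in_ren => n; rewrite (perm_mem hp) mem_iota /= => hn.
exact: index_iota0.
Qed.

Lemma nm_re u : nm (iota 0 (size u)) (env u) (Tup (vars H 0 (size u))) = @are FH u.
Proof. by rewrite (nm_iota (typed_re u)) (clE (typed_re u)). Qed.

Lemma nm_ev u a : nm (iota 0 (size u).+1) (env (Limp u a :: u))
  (App (Var 0) (Tup (vars H 1 (size u)))) = @aev FH u a.
Proof. by have := nm_iota (typed_ev u a) => /= ->; rewrite (clE (typed_ev u a)). Qed.

Lemma nm_gen u b (f : arr H u b) : nm (iota 0 (size u)) (env u) (Op f (vars H 0 (size u))) =
  @Ar FH u b (gen_mor f).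
Proof. by rewrite (nm_iota (typed_gen f)) (clE (typed_gen f)). Qed.

Lemma named_typed u s a : typed (ctx_of u) s a -> named (iota 0 (size u)) (env u) s.
Proof. by case/typed_ctx_ofP => hp hw _; split=> //; exact: iota_uniq. Qed.

Lemma named_vars rho j k : named (iota j k) rho (Tup (vars H j k)).
Proof.
split; [|exact: iota_uniq|by rewrite /= fv_vars].
by rewrite /= /vars all_map; apply/allP.
Qed.

Lemma nm_vars rho j u : map rho (iota j (size u)) = u ->
  nm (iota j (size u)) rho (Tup (vars H j (size u))) = @are FH u.
Proof.
move=> e; rewrite -nm_re -{1}(addn0 j) iotaDl -ren_vars_addn -/(ren _ (Tup _)).
rewrite nm_ren => [|//|x y _ _]; last exact: addnI.
  apply: eq_in_nm; first by rewrite /= fv_vars.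
  move=> n hn; have hn' := hn; rewrite mem_iota /= in hn'.
  rewrite /env (ext_lt _ (Tens [::]) hn') /= -[in RHS]e (nth_map 0) ?size_iota //.
  by rewrite nth_iota.
exact: named_vars.
Qed.

(** Writes an instance as a composite, which reduces a term former to its generic case with
    variables as arguments. *)
Lemma nm_args rho u b g ts : typed (ctx_of u) g b -> map (ty_of rho) ts = u ->
  all (wt rho) ts -> uniq (flatten (map fv ts)) ->
  acomp (cl u b g) [seq nm (fv t) rho t | t <- ts] =
  nm (flatten (map fv ts)) rho (subst (inst ts) g).
Proof.
move=> hg et hts hu; rewrite -(nm_iota hg).
have sz : size ts = size u by rewrite -et size_map.
have := @nm_comp (iota 0 (size u)) (env u) g (fun n => fv (inst ts n)) rho (inst ts) (named_typed hg).
rewrite -sz (map_inst_iota fv) (map_inst_iota (fun t => nm (fv t) rho t)); apply=> // n hn.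
have hf := @fits_inst _ rho ts (iota 0 (size ts)) hts (binds_iota _).
rewrite lower_iota cats0 in hf; have [h1 h2 h3] := fits1 (hf hu) hn.
rewrite mem_iota /= in hn; split; first by split.
by rewrite h1 et /env !(ext_lt _ (Tens [::])) // -sz.
Qed.

End NamedClasses.

(** The remaining fields are proofs of equations, equal by proof irrelevance. *)
Lemma functor_eq (S T : autonomous_data) (F G : autonomous_functor S T) :
  fob F = fob G -> (forall u a (f : hom S u a), Ar (fhom F f) = Ar (fhom G f)) -> F = G.
Proof.
case: F G => [f0 f1 f2 f3 f4 f5 f6 f7 f8] [g0 g1 g2 g3 g4 g5 g6 g7 g8] /= e; subst g0 => h.
have e : f1 = g1 by do 3! apply: functional_extensionality_dep => ?; exact: Ar_inj.
by subst g1; congr AutonomousFunctor; exact: Prop_irrelevance.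
Qed.

(** * Any structure-preserving extension agrees with the interpretation *)

Section Uniqueness.
Variables (H : autonomous_signature) (S : autonomous_multicategory) (i : signature_map H S).
Variable F : autonomous_functor (F_aut H) S.
Hypothesis Fob : fob F = i.
Hypothesis Fgen : forall u b (f : arr H u b), Ar (fhom F (gen_mor f)) = Ar (iarr i f).
Notation type := (type H).
Notation FH := (F_aut H).
Notation aids := (map (@aid S)).
Notation sem := (sem i).
Implicit Types (s t g : tm H) (ts : seq (tm H)) (u : seq type) (rho : nat -> type)
  (r : nat -> tm H).

Definition image (m : arrow FH) : arrow S := Ar (fhom F (projT2 (projT2 m))).

Lemma src_image m : src (image m) = map i (src m).
Proof. by rewrite -Fob. Qed.

Lemma tgt_image m : tgt (image m) = i (tgt m).
Proof. by rewrite -Fob. Qed.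

Lemma image_acomp m ms : map (@tgt FH) ms = src m ->
  image (acomp m ms) = acomp (image m) (map image ms).
Proof.
have [us [v [fs [-> _ _]]]] := harrowsP ms; rewrite tgt_harrows.
have [v' [b [g ->]]] := arrowP m; rewrite /src /= => e; subst v'; rewrite acompE.
have -> : map image (harrows fs) = harrows (hmap (@fhom _ _ F) fs).
  by elim: {g} fs => //= u a us' w f fs <-.
rewrite /image /= acompE.
have e : map (fob F) (flatten us) = flatten (map (map (fob F)) us) by rewrite map_flatten.
by rewrite -(f_comp g fs e) Ar_cast.
Qed.

Lemma image_aact m p : is_perm (size (src m)) p -> image (aact m p) = aact (image m) p.
Proof.
have [u [a [g ->]]] := arrowP m; rewrite /src /= => hp; rewrite (@aactE FH u a p hp g) /image /=.
have hp' : is_perm (size (map (fob F) u)) p by rewrite size_map.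
have e : map (fob F) (permute u p) = permute (map (fob F) u) p by rewrite permute_map.
by rewrite (aactE hp') -(@f_act FH S F u a g p hp hp' e) Ar_cast.
Qed.

Lemma image_aid a : image (@aid FH a) = aid (i a).
Proof. by rewrite /image /= f_idm -Fob. Qed.

Lemma image_are u : image (@are FH u) = are (map i u).
Proof. by rewrite /image /= -Fob /are -(@f_re FH S F u (f_tens F u)) Ar_cast. Qed.

Lemma image_aev u a : image (@aev FH u a) = aev (map i u) (i a).
Proof.
have e : map (fob F) (limp FH u a :: u) = limp S (map (fob F) u) (fob F a) :: map (fob F) u.
  by rewrite /= (f_limp F u a).
by rewrite /image /= -Fob /aev -(@f_ev FH S F u a e) Ar_cast.
Qed.

Lemma image_nm_reo l l' rho s : named l rho s -> perm_eq l l' ->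
  image (nm l' rho s) = reo l l' (image (nm l rho s)).
Proof.
move=> h hp; rewrite (nm_reo h hp) image_aact // nm_src // size_map.
by case: h => _ hu _; exact: is_perm_to.
Qed.

(** In the free multicategory, the generic application precomposed with [re] in its second slot is
    [ev]. The functor preserves this equation, and [aapp] is its unique solution in [S]. *)
Lemma image_app u b : image (cl [:: Limp u b; Tens u] b (App (Var 0) (Var 1))) =
  aapp (map i u) (i b).
Proof.
have h : typed (ctx_of [:: Limp u b; Tens u]) (App (Var 0) (Var 1)) b.
  by apply/typed_ctx_ofP; rewrite /= eqxx.
pose rho := env (Limp u b :: u).
have e : map rho (iota 1 (size u)) = u by have := map_env (Limp u b :: u) => -[].
have hf : flatten (map fv [:: Var 0; Tup (vars H 1 (size u))]) = iota 0 (size u).+1.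
  by rewrite /= fv_vars cats0.
have hty : map (ty_of rho) [:: Var 0; Tup (vars H 1 (size u))] = [:: Limp u b; Tens u].
  by rewrite /= map_ty_vars e.
have hall : all (wt rho) [:: Var 0; Tup (vars H 1 (size u))].
  by have [hw _ _] := named_vars rho 1 (size u); apply/andP; split=> //; apply/andP; split.
have := nm_args h hty hall; rewrite hf iota_uniq => /(_ isT).
rewrite [map _ _]/= nm_Var fv_vars nm_vars // [subst _ _]/= nm_ev => /(congr1 image).
have [s1 t1] : src (cl [:: Limp u b; Tens u] b (App (Var 0) (Var 1))) = [:: Limp u b; Tens u] /\
    tgt (cl [:: Limp u b; Tens u] b (App (Var 0) (Var 1))) = b by rewrite (clE h).
rewrite image_acomp ?s1 // [map image _]/= image_aid image_are image_aev i_limp => h3.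
apply/esym/unrep_uniq => //.
- by rewrite /src /= cats0.
- by rewrite src_image s1 /= i_limp i_tens.
- by rewrite tgt_image t1.
Qed.

Lemma red_beta2_ren f u s ts : size u = size ts ->
  red_aut (ren f (App (Lam u s) (Tup ts))) (ren f (subst (inst ts) s)).
Proof.
move=> hu; rewrite ren_inst -inst_outE -hu; apply: (Red_beta2 Hole).
by apply: (@Beta2 _ Hole) => //; rewrite size_map.
Qed.

Lemma red_beta1_ren f u s ts : size u = size ts ->
  red_aut (ren f (Let u s (Tup ts))) (ren f (subst (inst ts) s)).
Proof.
move=> hu; rewrite ren_inst -inst_inE -hu; apply: (Red_beta1 Hole).
by apply: (@Beta1 _ Hole) => //; rewrite size_map.
Qed.

Lemma map_cons_succ T (f : nat -> T) x (l : seq nat) :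
  map (fun n => if n is m.+1 then f m else x) (0 :: map succn l) = x :: map f l.
Proof. by rewrite /= -map_comp. Qed.

Lemma flatten_cons_succ (f : nat -> nat) l' (l : seq nat) :
  flatten (map (fun n => if n is m.+1 then [:: f m] else l') (0 :: map succn l)) = l' ++ map f l.
Proof. by rewrite map_cons_succ /= flatten_map1. Qed.

(** Composed with [ev], the class of the abstraction is that of a redex which contracts to [s]. The
    image under [F] therefore solves the equation that defines [curry]. *)
Lemma image_nm_Lam rho u s : wt rho (Lam u s) -> uniq (fv (Lam u s)) ->
  image (nm (fv s) (ext u rho) s) = sem (ext u rho) s ->
  image (nm (fv (Lam u s)) rho (Lam u s)) = sem rho (Lam u s).
Proof.
move=> hwl hul IH; have := hwl => /= /andP[hb hw]; have hu' := uniq_lower hb hul.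
set k := size u; set L := lower k (fv s); set b := ty_of (ext u rho) s.
have ulast : uniq (last_bound k (fv s)) by rewrite -(perm_uniq (perm_last hb)).
have nL : named L rho (Lam u s) by split.
have nL' : named L (ext u rho \o addn k) (Lam u s) by rewrite ext_addn.
have nk : named (map (addn k) L) (ext u rho) (ren (addn k) (Lam u s)).
  by split; rewrite ?fv_ren ?wt_ren ?ext_addn // (map_inj_uniq (@addnI k)).
have sv : size (vars H 0 k) = k by rewrite size_map size_iota.
pose g := ren (upren k (addn k)) s.
have nA : named (last_bound k (fv s)) (ext u rho) (App (Lam u g) (Tup (vars H 0 k))).
  split=> //; last by rewrite /= fv_vars fv_ren lower_upren.
  have [hwv _ _] := named_vars (ext u rho) 0 k; have [hwk _ _] := nk.
  rewrite -[wt _ _]/[&& wt (ext u rho) (ren (addn k) (Lam u s)),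
    wt (ext u rho) (Tup (vars H 0 k)) & Tens (map (ty_of (ext u rho)) (vars H 0 k)) == Tens u].
  by rewrite hwk hwv map_ty_vars map_ext_iota eqxx.
have ns : named (last_bound k (fv s)) (ext u rho) s by split=> //; exact: perm_last.
have tA : ty_of (ext u rho) (App (Lam u g) (Tup (vars H 0 k))) = b.
  by rewrite /= /g ty_ren ext_upren ext_addn.
have eA : nm (last_bound k (fv s)) (ext u rho) (App (Lam u g) (Tup (vars H 0 k))) =
    nm (last_bound k (fv s)) (ext u rho) s.
  apply: nm_red => //.
  by rewrite -[X in red_aut _ (ren _ X)](subst_inst_upren k s); apply: red_beta2_ren; rewrite sv.
(* Among the sources of [ev], [0] is the function and [m.+1] is the argument that becomes the bound
   variable [m]; the function is shifted by [k] to keep its variables apart from the bound ones. *)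
have := @nm_comp H (0 :: map succn (iota 0 k)) (env (Limp u b :: u))
  (App (Var 0) (Tup (vars H 1 k))) (fun n => if n is m.+1 then [:: m] else map (addn k) L)
  (ext u rho) (fun n => if n is m.+1 then Var m else ren (addn k) (Lam u s)).
rewrite (flatten_cons_succ id) map_id -/(last_bound k (fv s)).
have -> : 0 :: map succn (iota 0 k) = iota 0 k.+1.
  by rewrite /= -[1](addn0 1) iotaDl.
have -> : [seq nm (if x is m.+1 then [:: m] else map (addn k) L) (ext u rho)
    (if x is m.+1 then Var m else ren (addn k) (Lam u s)) | x <- iota 0 k.+1] =
    nm L rho (Lam u s) :: map (@aid FH) u.
  rewrite /= -[1](addn0 1) iotaDl -map_comp; congr (_ :: _).
    by rewrite (nm_ren nL') ?ext_addn // => x y _ _; exact: addnI.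
  rewrite -[in RHS](map_ext_iota u rho) -map_comp; apply: eq_map => n /=.
  by rewrite nm_Var.
have -> : subst (fun n => if n is m.+1 then Var m else ren (addn k) (Lam u s))
    (App (Var 0) (Tup (vars H 1 k))) = App (Lam u g) (Tup (vars H 0 k)).
  rewrite /= /vars -[1](addn0 1) iotaDl -!map_comp; congr (App _ (Tup _)).
rewrite nm_ev eA => h.
have {h} := h (named_typed (typed_ev u b)).
move=> h; have {h} := h _ ulast => h; have {h} : acomp (@aev FH u b) (nm L rho (Lam u s) :: map (@aid FH) u) =
    nm (last_bound k (fv s)) (ext u rho) s.
  apply: h => -[|n] hn; first by split; [exact: nk|rewrite ty_ren ext_addn].
  rewrite mem_iota /= add0n ltnS in hn; split; first by split.
  by rewrite [LHS](ext_lt rho (Tens [::]) hn) /env (ext_lt _ (Tens [::])).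

move/(congr1 image); rewrite image_acomp; last first.
  by rewrite /= nm_tgt // -map_comp map_id.
rewrite (image_nm_reo (nm_fv hw hu') (perm_last hb)) IH image_aev /= -map_comp.
have -> : map (image \o @aid FH) u = aids (map i u).
  by rewrite -map_comp; apply: eq_map => a; exact: image_aid.
move=> h; apply/esym/curry_uniq.
- by rewrite (src_reo (h := i \o ext u rho) hu' (perm_last hb)) ?src_sem // -obs_last.
- by rewrite src_image nm_src // /obs -map_comp.
- by rewrite tgt_image nm_tgt // tgt_reo tgt_sem // -i_limp.
- by rewrite tgt_reo tgt_sem.
Qed.

(** The class is that of [E], a [Let] over a variable, composed with the class of [t]. Precomposed
    with [re], the class of [E] becomes that of a redex which contracts to [s], so the image of [E]
    is the arrow given by [unrep]. *)
Lemma image_nm_Let rho u s t : wt rho (Let u s t) -> uniq (fv (Let u s t)) ->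
  image (nm (fv s) (ext u rho) s) = sem (ext u rho) s ->
  image (nm (fv t) rho t) = sem rho t ->
  image (nm (fv (Let u s t)) rho (Let u s t)) = sem rho (Let u s t).
Proof.
move=> hwl hul IHs IHt; have := hwl => /= /and4P[ht /eqP et hb hw].
have := hul; rewrite /= cat_uniq => /and3P[u1 _ u2].
have hu' := uniq_lower hb u2.
(* In [E] the variable [0] stands for the bound term, and [n.+1] for the free variable [n] of the
   body. *)
set k := size u; set L := lower k (fv s).
pose rho1 := ext [:: Tens u] rho; pose xs := 0 :: map succn L.
pose E : tm H := Let u (ren (upren k succn) s) (Var 0).
have r1 : rho1 \o succn = rho by apply: funext => n; exact: (@ext_ge _ [:: Tens u] rho n).
have uxs : uniq xs by rewrite /= (map_inj_uniq succn_inj) u2 andbT; apply/mapP => -[].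
have tE : ty_of rho1 E = ty_of (ext u rho) s by rewrite /= ty_ren ext_upren r1.
have nE : named xs rho1 E.
  split=> //; last by rewrite /= fv_ren lower_upren.
  by rewrite /= eqxx fv_ren binds_upren wt_ren ext_upren r1 hb hw.
have c1 : acomp (nm xs rho1 E) (nm (fv t) rho t :: map (@aid FH) (map rho L)) =
    nm (fv t ++ L) rho (Let u s t).
  have := @nm_comp H xs rho1 E (fun n => if n is m.+1 then [:: id m] else fv t) rho
    (fun n => if n is m.+1 then Var m else t) nE.
  rewrite flatten_cons_succ map_id.
  have -> : subst (fun n => if n is m.+1 then Var m else t) E = Let u s t.
    rewrite /= subst_ren up_comp_upren; congr (Let u _ t).
    by rewrite -[RHS]subst_Var -[in RHS](up_Var H k); congr (subst (up k _) s); apply: funext.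
  rewrite /xs /= -!map_comp => <- //.
  - by congr (acomp _ (_ :: _)); apply: eq_map => n /=; rewrite nm_Var.
  - move=> n; rewrite inE => /predU1P[->|/mapP[m _ ->]]; split=> //.
    by rewrite -r1.
have sv : size (vars H 0 k) = k by rewrite size_map size_iota.
pose g := ren (upren k (addn k)) s.
have ufirst : uniq (first_bound k (fv s)) by rewrite -(perm_uniq (perm_first hb)).
have nA : named (first_bound k (fv s)) (ext u rho) (Let u g (Tup (vars H 0 k))).
  split=> //; last by rewrite /= fv_vars fv_ren lower_upren.
  have [hwv _ _] := named_vars (ext u rho) 0 k.
  rewrite -[wt _ _]/[&& wt (ext u rho) (Tup (vars H 0 k)),
    Tens (map (ty_of (ext u rho)) (vars H 0 k)) == Tens u, binds k (fv g) & wt (ext u (ext u rho)) g].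
  by rewrite hwv map_ty_vars map_ext_iota eqxx fv_ren binds_upren hb wt_ren ext_upren ext_addn.
have ns : named (first_bound k (fv s)) (ext u rho) s by split=> //; exact: perm_first.
have eA : nm (first_bound k (fv s)) (ext u rho) (Let u g (Tup (vars H 0 k))) =
    nm (first_bound k (fv s)) (ext u rho) s.
  apply: nm_red => //; first by rewrite /= /g ty_ren ext_upren ext_addn.
  by rewrite -[X in red_aut _ (ren _ X)](subst_inst_upren k s); apply: red_beta1_ren; rewrite sv.
have c2 : acomp (nm xs rho1 E) (@are FH u :: map (@aid FH) (map rho L)) =
    nm (first_bound k (fv s)) (ext u rho) s.
  have := @nm_comp H xs rho1 E (fun n => if n is m.+1 then [:: k + m] else iota 0 k) (ext u rho)
    (untup H k) nE.
  rewrite flatten_cons_succ -eA.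
  have -> : subst (untup H k) E = Let u g (Tup (vars H 0 k)).
    by rewrite /= subst_ren up_comp_upren untup_succ up_Var_comp -renE.
  have -> : [seq nm (if x is m.+1 then [:: k + m] else iota 0 k) (ext u rho) (untup H k x) | x <- xs] =
      @are FH u :: map (@aid FH) (map rho L).
    rewrite /xs /= -!map_comp nm_vars ?map_ext_iota //; congr (_ :: _).
    by apply: eq_map => n /=; rewrite nm_Var ext_ge.
  apply=> // n; rewrite inE => /predU1P[->|/mapP[m _ ->]]; rewrite ty_untup; split=> //.
  exact: named_vars.
have t1 (m : arrow FH) : tgt m = Tens u -> map (@tgt FH) (m :: map (@aid FH) (map rho L)) = src (nm xs rho1 E).
  move=> tm; rewrite nm_src //= tm; congr (_ :: _).
  by rewrite -r1 -!map_comp.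
have ia (v : seq type) : map image (map (@aid FH) v) = aids (map i v).
  by rewrite -!map_comp; apply: eq_map => a; exact: image_aid.
have eo : map i (map rho L) = obs i rho L by rewrite /obs -map_comp.
have := congr1 image c2; rewrite image_acomp ?t1 // [map image _]/= image_are ia.
rewrite (image_nm_reo (nm_fv hw hu') (perm_first hb)) IHs eo => h2.
have := congr1 image c1; rewrite image_acomp ?t1 ?nm_tgt // [map image _]/= ia IHt eo => <-.
congr acomp; apply/esym/unrep_uniq.
- by rewrite (src_reo (h := i \o ext u rho) hu' (perm_first hb)) ?src_sem // -obs_first.
- rewrite src_image nm_src //= i_tens; congr (_ :: _).
  by rewrite -eo -r1 -!map_comp.
- by rewrite tgt_image nm_tgt // tE tgt_reo tgt_sem.
- exact: h2.
Qed.

(** Tuples, multiarrows and applications are composites of the classes of their subterms with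
    generic arrows whose images are prescribed; the two binders are determined by universal
    properties. *)
Lemma image_nm rho s : wt rho s -> uniq (fv s) -> image (nm (fv s) rho s) = sem rho s.
Proof.
have hl rh ss : {in ss, forall s rho, wt rho s -> uniq (fv s) ->
      image (nm (fv s) rho s) = sem rho s} ->
    all (wt rh) ss -> uniq (flatten (map fv ss)) ->
    map image [seq nm (fv t) rh t | t <- ss] = map (sem rh) ss /\
    map (@tgt FH) [seq nm (fv t) rh t | t <- ss] = map (ty_of rh) ss.
  elim: ss => //= x ss IH h /andP[hx hw]; rewrite cat_uniq => /and3P[h1 _ h2].
  have [|-> ->] := IH _ hw h2; first by move=> y hy; apply: h; rewrite inE hy orbT.
  by rewrite h ?mem_head // nm_tgt.
elim/tm_nested_ind: s rho => [n|u s IH|s t IHs IHt|ss IH|u s t IHs IHt|u b f ss IH] rho.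
- by move=> _ _; rewrite nm_Var image_aid.
- move=> hw hu; have /= /andP[hb hs] := hw; apply: image_nm_Lam => //; apply: IH => //.
  exact: uniq_lower hb hu.
- move=> hw hu; have := hw => /= /and3P[hs ht]; case e: (ty_of rho s) => [||v b] // /eqP et.
  have hall : all (wt rho) [:: s; t] by rewrite /= hs ht.
  have hu2 : uniq (flatten (map fv [:: s; t])) by rewrite /= cats0.
  have hty : map (ty_of rho) [:: s; t] = [:: Limp v b; Tens v] by rewrite /= e et.
  have h : typed (ctx_of [:: Limp v b; Tens v]) (App (Var 0) (Var 1)) b.
    by apply/typed_ctx_ofP; rewrite /= eqxx.
  have [|h1 h2] := hl rho [:: s; t] _ hall hu2.
    by move=> x; rewrite !inE => /orP[]/eqP->.
  have := nm_args h hty hall hu2; rewrite [flatten _]/= cats0 => <-.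
  rewrite image_acomp; last by rewrite h2 hty (clE h).
  by rewrite h1 image_app.
- move=> hw hu; have [h1 h2] := hl _ _ IH hw hu.
  have ht := typed_re (map (ty_of rho) ss).
  have := nm_args ht erefl hw hu.
  have -> : subst (inst ss) (Tup (vars H 0 (size (map (ty_of rho) ss)))) = Tup ss.
    by rewrite /= size_map /vars -map_comp (map_inst_iota id) map_id.
  have er : cl _ _ _ = @are FH (map (ty_of rho) ss) := clE (typed_re (map (ty_of rho) ss)).
  move=> <-; rewrite er image_acomp; last exact: h2.
  by rewrite h1 image_are /= -map_comp.
- move=> hw hu; have /= /and4P[ht _ hb hs] := hw.
  have := hu; rewrite /= cat_uniq => /and3P[u1 _ u2].
  by apply: image_nm_Let => //; [apply: IHs => //; exact: uniq_lower hb u2|exact: IHt].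
- move=> /= /andP[hw /eqP hty] hu; have [h1 h2] := hl _ _ IH hw hu.
  have ht := typed_gen f.
  have := nm_args ht hty hw hu.
  have -> : subst (inst ss) (Op f (vars H 0 (size u))) = Op f ss.
    have sz : size u = size ss by rewrite -hty size_map.
    by rewrite /= sz /vars -map_comp (map_inst_iota id) map_id.
  have er : cl _ _ _ = @Ar FH u b (gen_mor f) := clE (typed_gen f).
  move=> <-; rewrite er image_acomp; last by rewrite h2 hty.
  by rewrite h1 /=; congr acomp; exact: Fgen.
Qed.

Lemma image_cl u a s : typed (ctx_of u) s a -> image (cl u a s) = den i u s.
Proof.
move=> h; rewrite -(nm_iota h); have [hp hw _] := (typed_ctx_ofP _ _ _).1 h.
have hu : uniq (fv s) by rewrite (perm_uniq hp) iota_uniq.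
by rewrite (image_nm_reo (nm_fv hw hu) hp) image_nm.
Qed.

Lemma fhom_uniq u a (m : mor u a) : Ar (fhom F (m : hom FH u a)) = den i u (repr m).
Proof. by rewrite -(image_cl (repr_typed m)) (clE (repr_typed m)) /image /= reprK. Qed.

End Uniqueness.

Theorem theorem6p2 (H : autonomous_signature) (S : autonomous_multicategory)
    (i : signature_map H S) :
  exists! F : autonomous_functor (F_aut H) S,
    (forall a : type H, fob F a = iob i a) /\
    (forall (u : seq (type H)) (b : type H) (f : arr H u b)
        (eu : map (fob F) u = map (iob i) u) (eb : fob F b = iob i b),
      cast eu eb (fhom F (gen_mor f)) = iarr i f).
Proof.
exists (free_functor i); split.
  split=> // u b f eu eb; apply: Ar_inj; rewrite Ar_cast.
  by rewrite free_functor_gen.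
move=> F [hob hgen]; have eob : fob F = iob i by exact: funext.
apply: functor_eq => // u a m; rewrite [LHS]Ar_Fhom.
have hF u' b (f : arr H u' b) : Ar (fhom F (gen_mor f)) = Ar (iarr i f).
  have eu : map (fob F) u' = map (iob i) u' by rewrite eob.
  by rewrite -(hgen _ _ f eu (hob b)) Ar_cast.
by rewrite (fhom_uniq eob hF).
Qed.
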